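(* Let $F_1$ and $F_2$ be either two arbitrary skewfields or two arbitrary integral domains (in the sense given in the context), and let $V_1$ and $V_2$ be free modules of infinite ranks $\varkappa_1$ and $\varkappa_2$ over $F_1$ and $F_2$, respectively. Then the rings $\mathrm{End}_{F_1}V_1$ and $\mathrm{End}_{F_2}V_2$ are elementarily equivalent if and only if the theories $\mathrm{Th}_2^{\varkappa_1}(\langle \varkappa_1,F_1\rangle)$ and $\mathrm{Th}_2^{\varkappa_2}(\langle \varkappa_2,F_2\rangle)$ coincide.
   Context: Rings are associative with unit; modules are left modules. In this paper a ring is called an integral domain if it has no zero divisors and each of its ideals is principal (generated by one element); ideals are understood as submodules of the ring regarded as a left module over itself. Elementary equivalence of rings is with respect to the first order language of rings. For an infinite cardinal $\varkappa$ and a ring $R$, $\langle\varkappa,R\rangle$ is the two-sorted structure consisting of a set of cardinality $\varkappa$ (with equality only) and the ring $R$ with operations $+$ and $\cdot$. $\mathrm{Th}_2^{\varkappa}(\langle\varkappa,R\rangle)$ is the set of all true sentences of the following language: formulas are built by logical connectives from quantifiers over elements $\alpha\in\varkappa$ and over elements $r\in R$; atomic formulas $r_1=r_2+r_3$, $r_1=r_2\cdot r_3$, $r_1=r_2$, $\alpha_1=\alpha_2$; quantifiers $\forall$, $\exists$ over predicate variables $P(c_1,\dots,c_k;v_1,\dots,v_n)$, which range over the relations $P\subseteq\varkappa^k\times R^n$ of cardinality at most $\varkappa$; and atomic formulas $P(\alpha_1,\dots,\alpha_k;r_1,\dots,r_n)$. Sentences for different pairs $(\varkappa,R)$ are in the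 same formal language (with sort symbols for the set and for the ring), so that theories can be compared. *)

(* Defs.v *)
From HB Require Import structures.
From mathcomp Require Import all_boot all_algebra.
From mathcomp Require Import boolp classical_sets functions cardinality.

Set Implicit Arguments.
Unset Strict Implicit.
Unset Printing Implicit Defensive.

Import GRing.Theory.
Local Open Scope ring_scope.
Local Open Scope classical_set_scope.
Local Open Scope card_scope.

Definition is_skewfield (F : nzRingType) : Prop :=
  forall x : F, x != 0 -> exists y : F, y * x = 1 /\ x * y = 1.

(* Not necessarily commutative: no zero divisors, and every left ideal, i.e.
   every submodule of the regular left module F^o, is principal. *)
Definition is_left_pid (F : nzRingType) : Prop :=
  GRing.integral_domain_axiom F /\
  forall I : {pred F^o}, submod_closed I ->
    exists a : F, forall x : F, x \in I <-> exists r : F, x = r * a.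

Section Free.
Variables (F : nzRingType) (K : choiceType) (V : lmodType F).

Definition lin_independent (b : K -> V) : Prop :=
  forall (s : seq K) (c : K -> F), uniq s ->
    \sum_(i <- s) c i *: b i = 0 -> forall i, i \in s -> c i = 0.

Definition generating (b : K -> V) : Prop :=
  forall v : V, exists (s : seq K) (c : K -> F), v = \sum_(i <- s) c i *: b i.

(* A cardinal is represented by a type having that cardinality. *)
Definition free_of_rank : Prop :=
  exists b : K -> V, lin_independent b /\ generating b.

End Free.
Arguments free_of_rank {F} K V.

(* The endomorphism ring: pointwise addition; the product f * g is the
   composition v |-> f (g v). *)
Definition End (F : nzRingType) (V : lmodType F) : Type := {linear V -> V}.

Section EndRing.
Variables (F : nzRingType) (V : lmodType F).
Implicit Types f g h : End V.

Lemma EndP f g : (forall v, f v = g v) -> f = g.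
Proof.
case: f g => [f [fa fs]] [g [ga gs]] /= fg.
have {}fg : f = g by apply: funext.
subst g; congr GRing.Linear.Pack.
by congr GRing.Linear.Class; [case: fa ga => ? [?] | case: fs gs => ? [?]];
  f_equal; apply: Prop_irrelevance.
Qed.

HB.instance Definition _ := gen_eqMixin (End V).
HB.instance Definition _ := gen_choiceMixin (End V).

Definition End_zero : End V := \0 : {linear V -> V}.
Definition End_opp f : End V := (\- f) : {linear V -> V}.
Definition End_add f g : End V := (f \+ g) : {linear V -> V}.
Definition End_one : End V := idfun : {linear V -> V}.
Definition End_mul f g : End V := (f \o g) : {linear V -> V}.

Lemma End_addA : associative End_add.
Proof. by move=> f g h; apply: EndP => v /=; rewrite addrA. Qed.
Lemma End_addC : commutative End_add.
Proof. by move=> f g; apply: EndP => v /=; rewrite addrC. Qed.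
Lemma End_add0 : left_id End_zero End_add.
Proof. by move=> f; apply: EndP => v /=; rewrite add0r. Qed.
Lemma End_addN : left_inverse End_zero End_opp End_add.
Proof. by move=> f; apply: EndP => v /=; rewrite addNr. Qed.

HB.instance Definition _ :=
  GRing.isZmodule.Build (End V) End_addA End_addC End_add0 End_addN.

Lemma End_mulA : associative End_mul.
Proof. by move=> f g h; apply: EndP. Qed.
Lemma End_mul1l : left_id End_one End_mul.
Proof. by move=> f; apply: EndP. Qed.
Lemma End_mul1r : right_id End_one End_mul.
Proof. by move=> f; apply: EndP. Qed.
Lemma End_mulDl : left_distributive End_mul +%R.
Proof. by move=> f g h; apply: EndP. Qed.
Lemma End_mulDr : right_distributive End_mul +%R.
Proof. by move=> f g h; apply: EndP => v /=; rewrite linearD. Qed.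

HB.instance Definition _ := GRing.Zmodule_isPzRing.Build (End V)
  End_mulA End_mul1l End_mul1r End_mulDl End_mulDr.

End EndRing.

(* First-order language of rings, with variables named by natural numbers. *)
Inductive ring_term : Type :=
| TVar of nat
| TZero
| TOne
| TOpp of ring_term
| TAdd of ring_term & ring_term
| TMul of ring_term & ring_term.

Inductive ring_formula : Type :=
| FEq of ring_term & ring_term
| FNot of ring_formula
| FAnd of ring_formula & ring_formula
| FOr of ring_formula & ring_formula
| FImp of ring_formula & ring_formula
| FAll of nat & ring_formula
| FEx of nat & ring_formula.

(* [b] lists the variables bound so far. *)
Fixpoint closed_term (b : seq nat) (t : ring_term) : bool :=
  match t with
  | TVar i => i \in b
  | TZero | TOne => true
  | TOpp t => closed_term b t
  | TAdd t u | TMul t u => closed_term b t && closed_term b u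
  end.

Fixpoint closed_formula (b : seq nat) (phi : ring_formula) : bool :=
  match phi with
  | FEq t u => closed_term b t && closed_term b u
  | FNot f => closed_formula b f
  | FAnd f g | FOr f g | FImp f g => closed_formula b f && closed_formula b g
  | FAll i f | FEx i f => closed_formula (i :: b) f
  end.

Definition ring_sentence (phi : ring_formula) : bool := closed_formula [::] phi.

Section RingSemantics.
Variable R : pzRingType.

Fixpoint term_val (e : nat -> R) (t : ring_term) : R :=
  match t with
  | TVar i => e i
  | TZero => 0
  | TOne => 1
  | TOpp t => - term_val e t
  | TAdd t u => term_val e t + term_val e u
  | TMul t u => term_val e t * term_val e u
  end.

Fixpoint ring_holds (e : nat -> R) (phi : ring_formula) : Prop :=
  match phi with
  | FEq t u => term_val e t = term_val e u
  | FNot f => ~ ring_holds e f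
  | FAnd f g => ring_holds e f /\ ring_holds e g
  | FOr f g => ring_holds e f \/ ring_holds e g
  | FImp f g => ring_holds e f -> ring_holds e g
  | FAll i f => forall x : R, ring_holds [eta e with i |-> x] f
  | FEx i f => exists x : R, ring_holds [eta e with i |-> x] f
  end.

(* The truth of a sentence does not depend on the valuation. *)
Definition ring_true (phi : ring_formula) : Prop :=
  forall e : nat -> R, ring_holds e phi.

End RingSemantics.

Definition elementarily_equivalent (R S : pzRingType) : Prop :=
  forall phi : ring_formula, ring_sentence phi ->
    (ring_true R phi <-> ring_true S phi).

(* The two-sorted second-order language. The predicate variable ((k, n), i) is
   the i-th one with k arguments of the set sort and n of the ring sort. *)
Definition pvar : eqType := (nat * nat * nat)%type.
Definition arity_set (p : pvar) : nat := p.1.1.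
Definition arity_ring (p : pvar) : nat := p.1.2.

Inductive so_formula : Type :=
| SAdd of nat & nat & nat            (* r1 = r2 + r3 *)
| SMul of nat & nat & nat            (* r1 = r2 * r3 *)
| SEqRing of nat & nat
| SEqSet of nat & nat
| SPred (p : pvar) of (arity_set p).-tuple nat & (arity_ring p).-tuple nat
| SNot of so_formula
| SAnd of so_formula & so_formula
| SOr of so_formula & so_formula
| SImp of so_formula & so_formula
| SAllSet of nat & so_formula
| SExSet of nat & so_formula
| SAllRing of nat & so_formula
| SExRing of nat & so_formula
| SAllPred of pvar & so_formula
| SExPred of pvar & so_formula.

(* [bK], [bR], [bP] list the set, ring and predicate variables bound so far. *)
Fixpoint so_closed (bK bR : seq nat) (bP : seq pvar) (phi : so_formula) : bool :=
  match phi with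
  | SAdd x y z | SMul x y z => [&& x \in bR, y \in bR & z \in bR]
  | SEqRing x y => (x \in bR) && (y \in bR)
  | SEqSet x y => (x \in bK) && (y \in bK)
  | SPred p a r =>
      [&& p \in bP, all (fun x => x \in bK) a & all (fun x => x \in bR) r]
  | SNot f => so_closed bK bR bP f
  | SAnd f g | SOr f g | SImp f g => so_closed bK bR bP f && so_closed bK bR bP g
  | SAllSet x f | SExSet x f => so_closed (x :: bK) bR bP f
  | SAllRing x f | SExRing x f => so_closed bK (x :: bR) bP f
  | SAllPred p f | SExPred p f => so_closed bK bR (p :: bP) f
  end.

Definition so_sentence (phi : so_formula) : bool := so_closed [::] [::] [::] phi.

Section SecondOrderSemantics.
Variables (K : Type) (R : pzRingType).

Definition relation_of (p : pvar) : Type :=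
  set ((arity_set p).-tuple K * (arity_ring p).-tuple R).

(* Predicate quantifiers range over relations of cardinality at most |K|. *)
Fixpoint so_holds (eK : nat -> K) (eR : nat -> R) (eP : forall p, relation_of p)
    (phi : so_formula) : Prop :=
  match phi with
  | SAdd x y z => eR x = eR y + eR z
  | SMul x y z => eR x = eR y * eR z
  | SEqRing x y => eR x = eR y
  | SEqSet x y => eK x = eK y
  | SPred p a r => eP p (map_tuple eK a, map_tuple eR r)
  | SNot f => ~ so_holds eK eR eP f
  | SAnd f g => so_holds eK eR eP f /\ so_holds eK eR eP g
  | SOr f g => so_holds eK eR eP f \/ so_holds eK eR eP g
  | SImp f g => so_holds eK eR eP f -> so_holds eK eR eP g
  | SAllSet x f => forall u : K, so_holds [eta eK with x |-> u] eR eP f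
  | SExSet x f => exists u : K, so_holds [eta eK with x |-> u] eR eP f
  | SAllRing x f => forall u : R, so_holds eK [eta eR with x |-> u] eP f
  | SExRing x f => exists u : R, so_holds eK [eta eR with x |-> u] eP f
  | SAllPred p f => forall P : relation_of p, P #<= [set: K] ->
      so_holds eK eR (eqtype.dfwith eP P) f
  | SExPred p f => exists P : relation_of p, P #<= [set: K] /\
      so_holds eK eR (eqtype.dfwith eP P) f
  end.

(* The truth of a sentence does not depend on the valuations, which exist as
   soon as K is inhabited. *)
Definition Th2 : set so_formula :=
  [set phi | so_sentence phi /\
     forall eK eR eP, @so_holds eK eR eP phi].

End SecondOrderSemantics.

(* Main.v *)
From HB Require Import structures.
Require Import Defs.
From mathcomp Require Import all_boot all_algebra.
From mathcomp Require Import boolp classical_sets functions cardinality wochoice.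

(* An endomorphism of V is a row-finite matrix indexed by K, hence a relation
   of size at most |K|, and finite sums are definable by running through the
   support along an orbit of some map K -> K; so End V is interpretable in the
   second-order structure on K and F.

   Conversely, a primitive idempotent e of End V projects onto a line, with
   corner ring the opposite of F.  If a basis B of V is definable from
   parameters, then each relation of size at most |K| is of the form
   { (a_1 t, .., a_k t; d_1 t, .., d_n t) : t in B }, with endomorphisms a_j
   taking basis vectors to basis vectors and d_j taking them into the line, so
   that predicate quantifiers become quantifiers over endomorphisms.

   The point is to define B by finitely many parameters, uniformly in K.  It
   suffices to find finitely many partial maps K -> K such that every row-finite
   matrix commuting with the induced operators is diagonal on a copy of K.  This
   is done by induction on |K|.  A countable K is trivial, and a singular K is a
   union of fewer smaller sets, which are kept apart by the rows of a smaller
   index set.  If K is an uncountable regular cardinal, take a tree whose ranks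
   force a commuting matrix to be triangular, and adjoin to each ordinal d of
   countable cofinality a vector sent by operators S_n to the terms of a ladder
   d_n converging to d.  If d is closed under the matrix g, then g can only
   rescale that vector, hence also each b_(d_n); by Fodor's lemma, for some n the
   ordinals d_n so obtained include, for every g, a fixed set of size |K|. *)

Set Implicit Arguments.
Unset Strict Implicit.
Unset Printing Implicit Defensive.

Import GRing.Theory.
Local Open Scope classical_set_scope.
Local Open Scope card_scope.

(** * Cardinalities and well-orderings *)

(** The parameters of the interpretation are themselves quantified, so every tuple satisfying
    [good], not just a chosen one, must yield a basis of cardinality |K|. Independence and
    generation therefore have to be forced by conditions on endomorphisms alone. Principal left
    ideals enter there: they make the image of a primitive idempotent free of rank one, and every
    submodule the image of an endomorphism.

    The commutant of the three operators must be small, acting by scalars on each vector of the copy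
    of K, and yet contain enough diagonal projections to rule out all vectors other than the
    intended ones. Labels that are constant along the maps reconcile the two demands.

    Rigidity is argued on supports of rows, never on coefficients, so the maps depend on K and not
    on F; cancellation is controlled through terms with a unique preimage. Ladders have length omega
    because rows are finite: one index n then separates the largest entry of a row from all the
    others. *)

Definition emb {T U : Type} (A : set T) (B : set U) :=
  exists f : T -> U, (forall x, A x -> B (f x)) /\
    forall x y, A x -> A y -> f x = f y -> x = y.

Lemma emb_trans {T U W : Type} (A : set T) (B : set U) (C : set W) :
  emb A B -> emb B C -> emb A C.
Proof.
move=> [f [fB fi]] [g [gC gi]]; exists (g \o f); split.
  by move=> x /fB/gC.
by move=> x y Ax Ay /= /gi fxy; apply: fi => //; apply: fxy; apply: fB.
Qed.

Lemma emb_sub {T : Type} (A B : set T) : A `<=` B -> emb A B.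
Proof. by move=> AB; exists id; split. Qed.

Lemma emb_prod {T U T' U' : Type} (A : set T) (B : set U) (A' : set T')
    (B' : set U') : emb A B -> emb A' B' -> emb (A `*` A') (B `*` B').
Proof.
move=> [f [fB fi]] [g [gB gi]]; exists (fun p => (f p.1, g p.2)); split.
  by move=> [x y] [/= /fB ? /gB ?].
by move=> [x y] [x' y'] [/= Ax Ay] [/= Ax' Ay'] [/fi -> // /gi ->].
Qed.

Lemma emb_card_le {T U : Type} (A : set T) (B : set U) : emb A B -> A #<= B.
Proof.
case=> f [fB fi]; have [|g] := (@injfunPex _ _ A B).2; last exact: inj_card_le g.
by exists f => // x y /set_mem Ax /set_mem Ay; exact: fi.
Qed.

Lemma card_le_emb {T U : Type} (A : set T) (B : set U) (u0 : U) :
  A #<= B -> emb A B.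
Proof.
move=> /card_leP[f].
have [g gB gi] : exists2 g : T -> U, set_fun A B g & set_inj A g.
  by apply/injfunPex; squash (valLR u0 f).
by exists g; split=> [x /gB //|x y Ax Ay]; apply: gi; exact/mem_set.
Qed.

Lemma infinite_emb {T : Type} (A : set T) : infinite_set A <-> emb [set: nat] A.
Proof.
rewrite infiniteP; split=> [nA|]; last exact: emb_card_le.
have [|t0 _] := @infinite_setN0 _ A; first by apply/infiniteP.
exact: card_le_emb t0 nA.
Qed.

Lemma emb_infinite {T U : Type} (A : set T) (B : set U) :
  emb A B -> infinite_set A -> infinite_set B.
Proof. by move=> AB /infinite_emb nA; apply/infinite_emb; exact: emb_trans AB. Qed.

(** Hilbert's hotel: [x] takes the place of [f 0], each [f n] moves to [f n.+1], and all other
    points stay. *)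
Lemma emb_add1 {T : Type} (A : set T) (x : T) :
  infinite_set A -> emb (A `|` [set x]) A.
Proof.
case: (pselect (A x)) => [Ax _|nAx /infinite_emb [f [fA fi]]].
  by apply: emb_sub => y [|->].
pose g y := if pselect (y = x) then f 0
  else if pselect (exists n, y = f n) is left p then f (projT1 (cid p)).+1 else y.
have gP y : [\/ y = x /\ g y = f 0, exists2 n, y = f n & g y = f n.+1 |
             [/\ y <> x, (forall n, y <> f n) & g y = y]].
  rewrite /g; case: pselect => [yx|yx]; first exact: Or31.
  case: pselect => [p|hn]; last by apply: Or33; split=> // n yn; apply: hn; exists n.
  by case: cid => n /= yn; apply: Or32; exists n.
have fI m n : f m = f n -> m = n by exact: fi.
exists g; split.
  by move=> y Ay; case: (gP y) => [[_ ->]|[n _ ->]|[yx _ ->]];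
     [exact: fA | exact: fA | case: Ay].
move=> y z _ _; case: (gP y) => [[-> ->]|[n yn ->]|[yx yn ->]];
  case: (gP z) => [[-> ->]|[m zm ->]|[zx zm ->]] //.
- by move/fI.
- by move=> h; case: (zm 0).
- by move/fI.
- by move=> /fI[nm]; rewrite yn zm nm.
- by move=> h; case: (zm n.+1).
- by move=> h; case: (yn 0).
- by move=> h; case: (yn m.+1).
Qed.

Section WellOrder.
Variables (K : Type) (lt : K -> K -> Prop).
Hypothesis lt_wf : well_founded lt.
Hypothesis lt_trans : forall x y z, lt x y -> lt y z -> lt x z.
Hypothesis lt_total : forall x y, [\/ lt x y, x = y | lt y x].

Lemma lt_irr x : ~ lt x x.
Proof. by elim/(well_founded_ind lt_wf): x => x IH xx; exact: (IH _ xx xx). Qed.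

Definition le x y := x = y \/ lt x y.

Lemma le_nlt x y : le x y <-> ~ lt y x.
Proof.
split=> [[->|xy yx]|]; first exact: lt_irr.
  exact: lt_irr (lt_trans xy yx).
by case: (lt_total x y) => [|->|//]; [right | left].
Qed.

Lemma le_lt_trans x y z : le x y -> lt y z -> lt x z.
Proof. by move=> [->//|]; exact: lt_trans. Qed.

Lemma lt_le_trans x y z : lt x y -> le y z -> lt x z.
Proof. by move=> xy [<-//|]; exact: lt_trans. Qed.

Lemma le_trans x y z : le x y -> le y z -> le x z.
Proof. by move=> [->//|xy yz]; right; exact: lt_le_trans yz. Qed.

Definition seg x : set K := [set y | lt y x].
Definition downset (A : set K) := forall x y, A x -> lt y x -> A y.

Lemma wo_min (P : set K) x : P x -> exists y, P y /\ forall z, P z -> le y z.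
Proof.
elim/(well_founded_ind lt_wf): x => x IH Px.
case: (pselect (exists2 z, P z & lt z x)) => [[z Pz zx]|h]; first exact: IH Pz.
by exists x; split=> // z Pz; apply/le_nlt => zx; apply: h; exists z.
Qed.

Lemma emb_downset_or_seg {T : Type} (t0 : T) (A : set K) (S : set T) :
  downset A -> emb A S \/ exists2 x, A x & emb S (seg x).
Proof.
move=> dA.
pose F x (h : forall y, lt y x -> T) : T :=
  if pselect (exists t, S t /\ forall y (yx : lt y x), h y yx <> t) is left p
  then projT1 (cid p) else t0.
pose h := Fix lt_wf _ F.
have hE x : h x = F x (fun y _ => h y).
  rewrite /h Fix_eq // => y f g fg; rewrite /F.
  suff -> : f = g by [].
  by apply: functional_extensionality_dep => z;
     apply: functional_extensionality_dep => zy; exact: fg.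
have hP x : (exists t, S t /\ forall y, lt y x -> h y <> t) ->
    S (h x) /\ forall y, lt y x -> h y <> h x.
  by move=> p; rewrite hE /F; case: pselect => // q; case: cid.
case: (pselect (exists2 x, A x & forall t, S t -> exists2 y, lt y x & h y = t)).
  move=> [x Ax hx]; right; exists x => //.
  pose g t := if pselect (exists2 y, lt y x & h y = t) is left p
              then s2val (cid2 p) else x.
  have gP t : S t -> lt (g t) x /\ h (g t) = t.
    by move=> /hx p; rewrite /g; case: pselect => // q; case: cid2.
  exists g; split=> [t /gP[]//|t t' /gP[_ ht] /gP[_ ht'] e].
  by rewrite e ht' in ht.
move=> nx; left; exists h.
have hA x : A x -> S (h x) /\ forall y, lt y x -> h y <> h x.
  move=> Ax; apply: hP; apply: contrapT => nt; apply: nx; exists x => // t St.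
  apply: contrapT => ny; apply: nt; exists t; split=> // y yx hy.
  by apply: ny; exists y.
split=> [x /hA[]//|x y Ax Ay hxy].
case: (lt_total x y) => // [xy|yx].
  by have [_ /(_ _ xy)] := hA y Ay; rewrite hxy.
by have [_ /(_ _ yx)] := hA x Ax; rewrite hxy.
Qed.

(** Without a largest element, iterating a choice of larger elements would embed nat in [D]. *)
Lemma finite_max (D : set K) x : finite_set D -> D x ->
  exists2 m, D m & forall y, D y -> le y m.
Proof.
move=> fD Dx; apply: contrapT => nm; move: fD.
have [nx nxP] : {nx : K -> K & forall y, D y -> D (nx y) /\ lt y (nx y)}.
  apply: (@choice _ _ (fun y z => D y -> D z /\ lt y z)) => y.
  case: (pselect (D y)) => [Dy|]; last by exists y.
  apply: contrapT => nz; apply: nm; exists y => // z Dz.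
  by apply/le_nlt => yz; apply: nz; exists z.
pose s n := iter n nx x.
have Ds n : D (s n) by elim: n => //= n /nxP[].
have s_lt m n : (m < n)%N -> lt (s m) (s n).
  elim: n => // n IH; rewrite ltnS leq_eqVlt => /orP[/eqP ->|/IH mn].
    by case: (nxP _ (Ds n)).
  by apply: lt_trans mn _; case: (nxP _ (Ds n)).
apply/infinite_emb; exists s; split=> // m n _ _ smn.
by case: (ltngtP m n) => // /s_lt; rewrite smn => /lt_irr.
Qed.

End WellOrder.

(** The principle yields a relation under which every nonempty set has a unique minimum;
    reflexivity, antisymmetry, totality and transitivity come from the minima of sets of at most
    three points. *)
Lemma well_order_exists (K : eqType) : exists lt : K -> K -> Prop,
  [/\ well_founded lt, forall x y z, lt x y -> lt y z -> lt x z &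
      forall x y, [\/ lt x y, x = y | lt y x]].
Proof.
have [R woR] := well_ordering_principle K.
have min2 (P : set K) x : P x -> exists y, P y /\ forall z, P z -> R y z.
  move=> Px; have [|z [[zP zl] _]] := woR [pred y | `[< P y >]].
    by exists x; apply/asboolP.
  exists z; split; first exact/asboolP.
  by move=> t Pt; apply: zl; apply/asboolP.
have uniq2 (P : set K) x y : P x -> P y -> (forall z, P z -> R x z) ->
    (forall z, P z -> R y z) -> x = y.
  move=> Px Py Rx Ry; have [|z [_ zu]] := woR [pred y | `[< P y >]].
    by exists x; apply/asboolP.
  have m t : P t -> (forall z, P z -> R t z) ->
      minimum_of R [pred y | `[< P y >]] t.
    move=> Pt Rt; split; first exact/asboolP.
    by move=> w /asboolP; exact: Rt.
  by rewrite -(zu x) ?(zu y) //; apply: m.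
have Rxx x : R x x by have [y [-> /(_ x)]] := min2 [set x] x erefl; exact.
have Ranti x y : R x y -> R y x -> x = y.
  move=> xy yx; apply: (uniq2 [set x; y]); [by left|by right| |].
    by move=> z [->|->].
  by move=> z [->|->].
have Rtot x y : R x y \/ R y x.
  have [z [[->|->] zl]] := min2 [set x; y] x (or_introl erefl).
    by left; apply: zl; right.
  by right; apply: zl; left.
have Rtr x y z : R x y -> R y z -> R x z.
  move=> xy yz; case: (Rtot x z) => // zx.
  have [w [ww wl]] := min2 [set t | [\/ t = x, t = y | t = z]] x (Or31 _ _ erefl).
  case: ww => e; subst w.
  - by apply: wl; apply: Or33.
  - have yx : R y x by apply: wl; apply: Or31.
    by rewrite (Ranti _ _ xy yx).
  - have zy : R z y by apply: wl; apply: Or32.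
    by rewrite -(Ranti _ _ yz zy).
exists (fun x y => R x y /\ x <> y); split.
- move=> x; apply: contrapT => nx.
  have [y [ny yl]] := min2 [set x | ~ Acc (fun x y => R x y /\ x <> y) x] x nx.
  apply: ny; constructor => z [zy nzy]; apply: contrapT => nz.
  by apply: nzy; apply: Ranti => //; exact: yl.
- move=> x y z [xy nxy] [yz nyz]; split; first exact: Rtr yz.
  by move=> e; subst z; apply: nxy; exact: Ranti.
- move=> x y; case: (pselect (x = y)) => [->|nxy]; first exact: Or32.
  case: (Rtot x y) => h; [apply: Or31 | apply: Or33]; split=> // e.
  by apply: nxy.
Qed.

(** * Squares of infinite well-ordered sets *)

Section Square.
Variables (K : Type) (lt : K -> K -> Prop).
Hypothesis lt_wf : well_founded lt.
Hypothesis lt_trans : forall x y z, lt x y -> lt y z -> lt x z.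
Hypothesis lt_total : forall x y, [\/ lt x y, x = y | lt y x].

Let mx (p : K * K) := if pselect (lt p.1 p.2) then p.2 else p.1.

(* Goedel's ordering of pairs: the predecessors of a pair lie in the square of
   a proper initial segment. *)
Let plt (p q : K * K) := lt (mx p) (mx q) \/
  (mx p = mx q /\ (lt p.1 q.1 \/ (p.1 = q.1 /\ lt p.2 q.2))).

Let plt_wf : well_founded plt.
Proof.
suff h m a b : forall p, mx p = m -> p.1 = a -> p.2 = b -> Acc plt p.
  by move=> p; exact: (h _ _ _ p erefl erefl erefl).
elim/(well_founded_ind lt_wf): m a b => m IHm.
elim/(well_founded_ind lt_wf) => a IHa; elim/(well_founded_ind lt_wf) => b IHb.
move=> p pm pa pb; constructor => q [qm|[qm [qa|[qa qb]]]].
- by apply: (IHm (mx q) _ q.1 q.2) => //; rewrite -pm.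
- by apply: (IHa q.1 _ q.2) => //; [rewrite -pa | rewrite -pm].
- by apply: (IHb q.2) => //; [rewrite -pb | rewrite -pm | rewrite -pa].
Qed.

Let plt_total p q : [\/ plt p q, p = q | plt q p].
Proof.
case: (lt_total (mx p) (mx q)) => [h|e|h]; first by apply: Or31; left.
  case: (lt_total p.1 q.1) => [h|e1|h]; first by apply: Or31; right; split=> //; left.
    case: (lt_total p.2 q.2) => [h|e2|h].
    - by apply: Or31; right; split=> //; right.
    - by apply: Or32; case: p q e e1 e2 => [? ?] [? ?] /= _ -> ->.
    - by apply: Or33; right; split=> //; right.
  by apply: Or33; right; split=> //; left.
by apply: Or33; left.
Qed.

Let le_mx p : le lt p.1 (mx p) /\ le lt p.2 (mx p).
Proof.
rewrite /mx; case: pselect => h; split; [by right|by left|by left|].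
exact/(le_nlt lt_wf lt_trans lt_total).
Qed.

Let mx_in (A : set K) p : (A `*` A) p -> A (mx p).
Proof. by move=> [? ?]; rewrite /mx; case: pselect. Qed.

Let seg_plt p q : plt q p -> le lt q.1 (mx p) /\ le lt q.2 (mx p).
Proof.
have [h1 h2] := le_mx q.
by move=> [h|[<- _]] //; split; right; apply: (le_lt_trans lt_trans _ h).
Qed.

(** By induction one may assume that [B] embeds in none of its proper segments. If its square did
    not embed in [B], comparison along [plt] would embed [B] below some pair [p], hence in the
    square of the closed segment at [mx p], hence by induction in the open segment below [mx p]. *)
Lemma emb_square_downset (A : set K) : downset lt A -> infinite_set A ->
  emb (A `*` A) A.
Proof.
suff step (B : set K) : downset lt B ->
    (forall x, B x -> infinite_set (seg lt x) ->
       emb (seg lt x `*` seg lt x) (seg lt x)) ->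
    infinite_set B -> emb (B `*` B) B.
  move=> dA; apply: (step) => // x _.
  elim/(well_founded_ind lt_wf): x => x IH ix.
  apply: (step (seg lt x) _ _ ix) => [y z yx zy|y yx]; last exact: IH.
  exact: lt_trans yx.
move=> dB IH iB.
have [x0 _] : B !=set0 by exact: infinite_setN0.
case: (pselect (exists2 x, B x & emb B (seg lt x))) => [[x Bx Bs]|nB].
  have ifs := emb_infinite Bs iB.
  apply: emb_trans (emb_prod Bs Bs) _; apply: emb_trans (IH x Bx ifs) _.
  by apply: emb_sub => y; exact: dB.
have dBB : downset plt (B `*` B).
  move=> p q Bp qp; have [h1 h2] := seg_plt qp; have Bm := mx_in Bp.
  by split; [case: h1 => [->//|/dB] | case: h2 => [->//|/dB]]; exact.
have [//|[p Bp Bs]] :=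
  emb_downset_or_seg plt_wf plt_total x0 B dBB.
case: nB; exists (mx p); first exact: mx_in.
pose C := seg lt (mx p) `|` [set mx p].
have BC : emb B (C `*` C).
  apply: emb_trans Bs _; apply: emb_sub => q /seg_plt[h1 h2].
  by split; [case: h1 => [->|] | case: h2 => [->|]]; [right|left|right|left].
have ifs : infinite_set (seg lt (mx p)).
  move=> fs; apply: (emb_infinite BC iB).
  by apply: finite_setX; rewrite finite_setU; split=> //; exact: finite_set1.
apply: emb_trans BC _; apply: emb_trans (emb_prod _ _) (IH _ (mx_in Bp) ifs).
  exact: emb_add1.
exact: emb_add1.
Qed.

End Square.

Lemma emb_square (K : eqType) : infinite_set [set: K] ->
  emb [set: K * K] [set: K].
Proof.
move=> iK; have [lt [wf tr tot]] := well_order_exists K.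
rewrite -setXTT; exact: (emb_square_downset wf tr tot).
Qed.

Section Absorption.
Variable K : eqType.
Hypothesis infK : infinite_set [set: K].

Lemma embT_inj {T U : Type} : emb [set: T] [set: U] <->
  exists f : T -> U, injective f.
Proof.
split=> [[f [_ fi]]|[f fi]]; first by exists f => x y; exact: fi.
by exists f; split=> // x y _ _; exact: fi.
Qed.

Lemma inj_nat : exists f : nat -> K, injective f.
Proof. by apply/embT_inj/infinite_emb. Qed.

Lemma inj_pair (A B : Type) :
  (exists f : A -> K, injective f) -> (exists g : B -> K, injective g) ->
  exists h : A * B -> K, injective h.
Proof.
move=> [f fi] [g gi]; have /embT_inj[h hi] := emb_square infK.
by exists (fun p => h (f p.1, g p.2)) => -[x y] [x' y'] /hi[/fi -> /gi ->].
Qed.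

Lemma inj_sum (A B : Type) :
  (exists f : A -> K, injective f) -> (exists g : B -> K, injective g) ->
  exists h : A + B -> K, injective h.
Proof.
move=> [f fi] [g gi]; have /embT_inj[h hi] := emb_square infK.
have [n ni] := inj_nat.
exists (fun p => match p with inl x => h (n 0, f x) | inr y => h (n 1, g y) end).
by move=> [x|x] [y|y] /hi[] => [/fi ->|/ni|/ni|/gi ->].
Qed.

Lemma inj_seq : exists f : seq K -> K, injective f.
Proof.
have [n ni] := inj_nat.
have [h hi] : exists h : nat * K -> K, injective h.
  by apply: inj_pair; [exists n | exists id].
have /embT_inj[g gi] := emb_square infK.
pose fix f (s : seq K) : K :=
  if s is x :: s' then h (1, g (x, f s')) else h (0, n 0).
exists f; elim=> [|x s IH] [|y t] //= /hi; first by move=> [].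
  by move=> [].
by move=> [/gi[-> /IH ->]].
Qed.

End Absorption.

(** * Rigid systems of partial maps *)

(* [G x w] stands for "b_w occurs in g b_x", where g is an endomorphism of the
   free module on X; the three clauses are what remains of the commutation of g
   with the operator sending b_x to b_(f x), or to 0 if [f x = None]. *)
Definition supp_comm {X : Type} (f : X -> option X) (G : X -> X -> Prop) :=
  [/\ forall x y z, f x = Some y -> G y z -> exists2 w, G x w & f w = Some z,
      forall x y w z, f x = Some y -> G x w -> f w = Some z ->
        (forall w', G x w' -> f w' = Some z -> w' = w) -> G y z &
      forall x w z, f x = None -> G x w -> f w = Some z ->
        exists w', [/\ w' <> w, G x w' & f w' = Some z]].

Definition row_finite {X : Type} (G : X -> X -> Prop) :=
  forall x, finite_set (G x).

(** [X] is kept apart from [K] because the inductive steps adjoin auxiliary points;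
    [rigid_transport] brings them back into [K]. Countably many maps are allowed here and are
    reduced to three at the end. *)
Definition rigid {K : Type} (X : Type) (A : set K) :=
  exists (i : K -> X) (f : nat -> X -> option X),
    (forall a b, A a -> A b -> i a = i b -> a = b) /\
    forall G, row_finite G -> (forall n, supp_comm (f n) G) ->
      forall a w, A a -> G (i a) w -> w = i a.

(** Restriction of a matrix to the block with rows in [u X] and columns in [v X]. The last condition
    on [F] is the essential one: no index outside [v X] is sent into it, so no outside term takes
    part in a cancellation. Distinct [u] and [v] serve to compare differently labelled copies. *)
Lemma supp_comm_pull {X Y : Type} (u v : X -> Y) (f : X -> option X)
    (F : Y -> option Y) (G : Y -> Y -> Prop) : injective v ->
  (forall x, F (u x) = omap u (f x)) -> (forall x, F (v x) = omap v (f x)) ->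
  (forall w z, F w = Some (v z) -> exists w', w = v w') ->
  supp_comm F G -> supp_comm f (fun x x' => G (u x) (v x')).
Proof.
move=> vi Fu Fv Fim [C1 C2 C3].
have back w z : F w = Some (v z) -> exists2 w', w = v w' & f w' = Some z.
  move=> Fw; have [w' ww] := Fim _ _ Fw; exists w' => //.
  by move: Fw; rewrite ww Fv; case: (f w') => //= t [/vi ->].
split.
- move=> x y z fx Gyz; have [|w Gw /back[w' ww fw]] := C1 (u x) (u y) (v z) _ Gyz.
    by rewrite Fu fx.
  by exists w' => //; rewrite -ww.
- move=> x y w z fx Gxw fw uw; apply: (C2 (u x) (u y) (v w) (v z)) => //.
  + by rewrite Fu fx.
  + by rewrite Fv fw.
  by move=> w' Gw /back[w'' we fw'']; rewrite we (uw w'') // -we.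
- move=> x w z fx Gxw fw.
  have [||t [tw Gt /back[w' tw' fw']]] := C3 (u x) (v w) (v z) _ Gxw _.
  + by rewrite Fu fx.
  + by rewrite Fv fw.
  by exists w'; split=> [e||] //; [apply: tw; rewrite tw' e | rewrite -tw'].
Qed.

Lemma row_finite_pull {X Y : Type} (u v : X -> Y) (G : Y -> Y -> Prop) :
  injective v -> row_finite G -> row_finite (fun x x' => G (u x) (v x')).
Proof.
move=> vi Gf x; have := Gf (u x); apply: finite_preimage.
by move=> y z _ _ /vi.
Qed.

Lemma rigid_emb {K X : Type} (A B : set K) : emb A B -> rigid X B -> rigid X A.
Proof.
move=> [h [hB hi]] [i [f [ii fr]]]; exists (i \o h), f; split.
  by move=> a b Aa Ab /= /ii e; apply: hi => //; apply: e; exact: hB.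
by move=> G Gf Gc a w Aa; apply: (fr G) => //; exact: hB.
Qed.

Lemma partial_inverse {X Y : Type} (j : X -> Y) : injective j ->
  exists k : Y -> option X, (forall x, k (j x) = Some x) /\
    forall y x, k y = Some x -> y = j x.
Proof.
move=> ji; exists (fun y => if pselect (exists x, y = j x) is left p
                     then Some (projT1 (cid p)) else None).
split=> [x|y x]; case: pselect => //.
- by move=> p; case: cid => x' /= /ji ->.
- by move=> n; case: n; exists x.
- by move=> p [<-]; case: cid.
Qed.

Lemma rigid_transport {K X Y : Type} (A : set K) (j : X -> Y) :
  injective j -> rigid X A -> rigid Y A.
Proof.
move=> ji [i [f [ii fr]]]; have [k [kj kE]] := partial_inverse ji.
(* [F 0] is the partial identity on the image of [j]; commuting with it keeps the rows of that image
   inside it. *)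
pose F n (y : Y) : option Y := if n is m.+1
  then obind (fun x => omap j (f m x)) (k y) else omap j (k y).
exists (j \o i), F; split=> [a b Aa Ab /ji|G Gf Gc a w Aa Gw]; first exact: ii.
have [C0 _ _] := Gc 0.
have [|w' Gw'] := C0 (j (i a)) (j (i a)) w _ Gw; first by rewrite /F /= kj.
rewrite /F /=; case kw': (k w') => [x|] //= [wE].
suff <- : x = i a by [].
apply: (fr (fun x x' => G (j x) (j x'))) => //.
- exact: row_finite_pull.
- move=> n; apply: supp_comm_pull (Gc n.+1) => //.
  + by move=> z; rewrite /F /= kj.
  + by move=> z; rewrite /F /= kj.
  + move=> z t; rewrite /F /=; case kz: (k z) => [z'|] //= _.
    by exists z'; exact: kE.
by rewrite wE.
Qed.

(** Each point of [A] gets a partial identity defined at that point only. *)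
Lemma rigid_countable {K : Type} (A : set K) : emb A [set: nat] -> rigid K A.
Proof.
move=> [e [_ ei]].
pose f n x : option K := if pselect (A x /\ e x = n) then Some x else None.
exists id, f; split=> // G _ Gc a w Aa Gw.
have [C1 _ _] := Gc (e a).
have [|w' _] := C1 a a w _ Gw; first by rewrite /f; case: pselect => // -[].
rewrite /f; case: pselect => // -[Aw ew] [<-].
by apply: ei.
Qed.

Lemma emb_image {T U : Type} (h : T -> U) (S : set T) (t0 : T) :
  emb (h @` S) S.
Proof.
pose g u := if pselect (exists2 t, S t & h t = u) is left p
            then s2val (cid2 p) else t0.
have gP u : (h @` S) u -> S (g u) /\ h (g u) = u.
  by rewrite /g; case: pselect => [p _|n [t St hu]]; [case: cid2 | case: n; exists t].
exists g; split=> [u /gP[]//|u v /gP[_ hu] /gP[_ hv] e].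
by rewrite -hu e hv.
Qed.

Lemma finite_nat_bound (S : set nat) : finite_set S ->
  exists k, forall n, S n -> (n <= k)%N.
Proof.
move=> /finite_seqP[s ->]; exists (\max_(n <- s) n)%N => n ns.
exact: (leq_bigmax_seq (F := id)).
Qed.

(** * The uncountable regular case *)

Section Regular.
Variables (K : Type) (lt : K -> K -> Prop).
Hypothesis lt_wf : well_founded lt.
Hypothesis lt_trans : forall x y z, lt x y -> lt y z -> lt x z.
Hypothesis lt_total : forall x y, [\/ lt x y, x = y | lt y x].
Variable A : set K.
Hypothesis dA : downset lt A.
Hypothesis Aunc : ~ emb A [set: nat].
Hypothesis Ainit : forall x, A x -> ~ emb A (seg lt x).
Hypothesis Areg : forall B : set K, B `<=` A -> ~ emb A B ->
  exists2 b, A b & forall x, B x -> lt x b.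

Local Notation "x < y" := (lt x y).
Local Notation "x <= y" := (le lt x y).
Local Notation le_nlt := (le_nlt lt_wf lt_trans lt_total).

Let irr x : ~ x < x. Proof. exact: lt_irr. Qed.

Let bound_nat (h : nat -> K) : (forall n, A (h n)) ->
  exists2 b, A b & forall n, h n < b.
Proof.
move=> hA; have [|//|b Ab hb] := Areg (B := range h).
- by move=> _ [n _ <-].
- by move=> AB; apply: Aunc; apply: emb_trans AB _; exact: (emb_image _ _ 0).
by exists b => // n; apply: hb; exists n.
Qed.

Let bound2 x y : A x -> A y -> exists b, [/\ A b, x < b & y < b].
Proof.
move=> Ax Ay; have [[|n] //|b Ab hb] := @bound_nat (fun n => if n is 0 then x else y).
by exists b; split=> //; [exact: hb 0 | exact: hb 1].
Qed.

Let bound_le (h : K -> K) x : A x -> (forall y, A y -> A (h y)) ->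
  exists2 b, A b & forall y, y <= x -> h y < b.
Proof.
move=> Ax hA.
have [||b Ab hb] := Areg (B := h @` seg lt x).
- by move=> _ [y yx <-]; apply: hA; exact: dA yx.
- by move=> AB; apply: (Ainit Ax); apply: emb_trans AB _; exact: emb_image.
have [c [Ac bc hc]] := bound2 Ab (hA _ Ax).
exists c => // y [->//|yx]; apply: lt_trans bc; apply: hb.
by exists y.
Qed.

Let ladder d (l : nat -> K) := [/\ forall n, l n < d,
  forall n, l n < l n.+1 & forall x, x < d -> exists n, x < l n].

Let Lim d := A d /\ exists l, ladder d l.

Let lad d : nat -> K :=
  if pselect (exists l, ladder d l) is left p then projT1 (cid p) else fun=> d.

Let ladP d : Lim d -> ladder d (lad d).
Proof. by case=> _ p; rewrite /lad; case: pselect => // q; case: cid. Qed.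

Let ladder_mono d l : ladder d l -> forall m n, (m <= n)%N -> l m <= l n.
Proof.
move=> [_ l1 _] m n /subnK <-; elim: (n - m)%N => [|k IH]; first by left.
by rewrite addSn; apply: le_trans IH _ => //; right.
Qed.

Let ladder_cofinal d l : ladder d l -> forall x, x < d ->
  exists n, forall m, (n <= m)%N -> x < l m.
Proof.
move=> ll x xd; have [_ _ /(_ x xd)[n xn]] := ll; exists n => m nm.
exact: lt_le_trans xn (ladder_mono ll nm).
Qed.

Let closed_at (f : K -> K) d := forall b, b < d -> f b < d.

(** Stationarity among the points of countable cofinality, with closed unbounded sets replaced by
    the sets of closure points of functions. *)
Let stationary (S : set K) := forall f : K -> K, (forall b, A b -> A (f b)) ->
  exists d, [/\ Lim d, S d & closed_at f d].

(* Fodor's argument: otherwise the functions witnessing non-stationarity can be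
   merged into a single one, whose closure points contradict them all. *)
Let split_stationary : exists n, forall x, A x ->
  exists y, [/\ A y, x <= y & stationary (fun d => lad d n = y)].
Proof.
apply: contrapT => nS.
have [xi xiP] : {xi : nat -> K & forall n, A (xi n) /\ forall y, A y ->
    xi n <= y -> ~ stationary (fun d => lad d n = y)}.
  apply: (@choice _ _ (fun n x => A x /\ forall y, A y -> x <= y ->
     ~ stationary (fun d => lad d n = y))) => n.
  apply: contrapT => nx; apply: nS; exists n => x Ax; apply: contrapT => ny.
  apply: nx; exists x; split=> // y Ay xy st; apply: ny.
  by exists y; split.
(* For [y] at or above [xi n], no limit point [d] with [lad d n = y] is closed under [f (n, y)]; the
   remaining pairs get the identity. *)
have [f fP] : {f : nat * K -> K -> K & forall p, (forall b, A b -> A (f p b)) /\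
    (A p.2 -> xi p.1 <= p.2 ->
     forall d, Lim d -> lad d p.1 = p.2 -> ~ closed_at (f p) d)}.
  apply: (@choice _ _ (fun p g => (forall b, A b -> A (g b)) /\
    (A p.2 -> xi p.1 <= p.2 ->
     forall d, Lim d -> lad d p.1 = p.2 -> ~ closed_at g d))) => -[n y] /=.
  case: (pselect (A y /\ xi n <= y)) => [[Ay xy]|h]; last first.
    by exists id; split=> // Ay xy; case: h.
  apply: contrapT => ng; apply: ((xiP n).2 y Ay xy) => g gA.
  apply: contrapT => nd; apply: ng; exists g; split=> // _ _ d ld dy cd.
  by apply: nd; exists d.
have fA n y b : A b -> A (f (n, y) b) by apply: (fP (n, y)).1.
have [X AX xiX] := bound_nat (fun n => (xiP n).1).
(* Diagonal domination: [g b] lies above all [f (n, y) b'] with [y] and [b'] up to [b]. Regularity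
   bounds these values over [b'] and [y], and uncountable cofinality over [n]. *)
have [g gP] : {g : K -> K & forall b, A b -> [/\ A (g b), b < g b &
    forall n y b', y <= b -> b' <= b -> f (n, y) b' < g b]}.
  apply: (@choice _ _ (fun b c => A b -> [/\ A c, b < c &
    forall n y b', y <= b -> b' <= b -> f (n, y) b' < c])) => b.
  case: (pselect (A b)) => [Ab|]; last by exists b.
  have [h1 h1P] : {h1 : nat * K -> K & forall p, A (h1 p) /\
      forall b', b' <= b -> f p b' < h1 p}.
    apply: (@choice _ _ (fun p c => A c /\ forall b', b' <= b -> f p b' < c)).
    by move=> p; have [c] := bound_le Ab (fP p).1; exists c.
  have [h2 h2P] : {h2 : nat -> K & forall n, A (h2 n) /\
      forall y, y <= b -> h1 (n, y) < h2 n}.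
    apply: (@choice _ _ (fun n c => A c /\ forall y, y <= b -> h1 (n, y) < c)).
    move=> n; have [c] := bound_le Ab (fun y _ => (h1P (n, y)).1).
    by exists c.
  have [c Ac cP] := bound_nat (fun n => (h2P n).1).
  have [c' [Ac' cc' bc']] := bound2 Ac Ab.
  exists c' => _; split=> // n y b' yb b'b.
  apply: lt_trans cc'; apply: lt_trans (cP n).
  apply: lt_trans ((h2P n).2 y yb).
  exact: (h1P (n, y)).2.
(* The supremum [d] of these iterates is closed under every [f (n, y)] with [y] below [d]. As [X]
   lies above all [xi n], some term [lad d n] exceeds [xi n], and [y := lad d n] gives the
   contradiction. *)
pose s n := iter n g X.
have As n : A (s n) by elim: n => //= n /gP[].
have sS n : s n < s n.+1 by case: (gP _ (As n)).
have [u Au su] := bound_nat As.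
have [d [sd dmin]] := wo_min lt_wf lt_trans lt_total (P := fun y => forall n, s n < y) su.
have Ad : A d by case: (dmin _ su) => [->//|/(dA Au)].
have ls : ladder d s.
  split=> // x xd; apply: contrapT => nx.
  suff : d <= x by move/le_nlt; exact.
  apply: dmin => n; apply: contrapT => /le_nlt xn; apply: nx; exists n.+1.
  exact: le_lt_trans xn (sS n).
have Ld : Lim d by split=> //; exists s.
have [l1 _ /(_ X (sd 0))[n Xn]] := ladP Ld.
have Ay := dA Ad (l1 n).
have [_ /(_ Ay _ d Ld erefl)] := fP (n, lad d n); apply.
  by right; apply: lt_trans Xn; exact: xiX.
move=> b bd.
have [m1 h1] := ladder_cofinal ls bd.
have [m2 h2] := ladder_cofinal ls (l1 n).
apply: lt_trans (sd (maxn m1 m2).+1).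
have [_ _] := gP _ (As (maxn m1 m2)); apply; right.
- by apply: h2; exact: leq_maxr.
- by apply: h1; exact: leq_maxl.
Qed.

Lemma rigid_regular : rigid (seq K + K) A.
Proof.
have [n0 st] := split_stationary.
pose B := [set y | A y /\ stationary (fun d => lad d n0 = y)].
have [h0 [hB hi]] : emb A B.
  apply: contrapT => nAB; have [|b Ab bB] := Areg _ nAB; first by move=> y [].
  have [y [Ay by_ sy]] := st b Ab.
  by apply: (proj1 (le_nlt _ _) by_); exact: bB.
(* The children of a node [a :: t] are the nodes [c :: a :: t] with [c] below [a], and [P] goes to
   the parent. If the row of [a :: t] contained [b :: t'] with [b] below [a], the row of the child
   [b :: a :: t] would contain a child of [b :: t'], whose head is below [b]: a descent. *)
pose P (x : seq K + K) : option (seq K + K) :=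
  if x is inl (c :: a :: t) then
    (if pselect (c < a) then Some (inl (a :: t)) else None) else None.
(* The partial identities [Q] and [R] confine rows to the nodes [[:: a]] and to the limit vectors;
   [H] ties a limit vector to its node, so that triangularity passes to the limit vectors. *)
pose Q (x : seq K + K) : option (seq K + K) :=
  if x is inl [:: a] then (if pselect (A a) then Some x else None) else None.
pose R (x : seq K + K) : option (seq K + K) :=
  if x is inr d then (if pselect (Lim d) then Some x else None) else None.
pose H (x : seq K + K) : option (seq K + K) :=
  if x is inr d then Some (inl [:: d]) else None.
pose S n (x : seq K + K) : option (seq K + K) :=
  if x is inr d then (if pselect (Lim d) then Some (inl [:: lad d n]) else None)
  else None.
pose f n := match n with 0 => P | 1 => Q | 2 => R | 3 => H | n.+4 => S n end.
exists (fun a => inl [:: h0 a]), f; split.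
  by move=> a b Aa Ab [/hi]; exact.
move=> G Gf Gc.
(* Commuting with P, an endomorphism cannot lower the rank of a node. *)
have flag a t b t' : G (inl (a :: t)) (inl (b :: t')) -> a <= b.
  elim/(well_founded_ind lt_wf): a t b t' => a IH t b t' Gab.
  apply/le_nlt => ba; have [C1 _ _] := Gc 0.
  have [|[[|c [|b' s]]|d] //] := C1 (inl [:: b, a & t]) _ _ _ Gab.
    by rewrite /= ; case: pselect.
  move=> Gw /=; case: pselect => // cb [be _].
  have /le_nlt := IH b ba _ _ _ Gw; apply; rewrite -be.
  exact: cb.
have flag1 a w : A a -> G (inl [:: a]) w -> exists b, [/\ A b, a <= b & w = inl [:: b]].
  move=> Aa Gw; have [C1 _ _] := Gc 1.
  have [|w' _] := C1 (inl [:: a]) _ _ _ Gw; first by rewrite /=; case: pselect.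
  case: w' => [[|b [|c s]]|d] //=; case: pselect => // Ab [wE].
  by exists b; split=> //; apply: (flag a [::] b [::]); rewrite wE.
have flag2 d w : Lim d -> G (inr d) w -> exists e, [/\ Lim e, d <= e & w = inr e].
  move=> Ld Gw; have [C1 _ _] := Gc 2.
  have [|w' _] := C1 (inr d) _ _ _ Gw; first by rewrite /=; case: pselect.
  case: w' => [//|e] /=; case: pselect => // Le [wE]; exists e; split=> //.
  apply: (flag d [::] e [::]); have [_ C2 _] := Gc 3.
  apply: (C2 (inr d) (inl [:: d]) (inr e)) => //; first by rewrite wE.
  by move=> [//|e'] _ [->].
(* Rows are finite, hence bounded in [A]; a point closed under [g] is closed under the matrix. *)
have [g gP] : {g : K -> K & forall b, A b -> A (g b) /\
    forall b', G (inl [:: b]) (inl [:: b']) -> b' < g b}.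
  apply: (@choice _ _ (fun b c => A b -> A c /\
    forall b', G (inl [:: b]) (inl [:: b']) -> b' < c)) => b.
  case: (pselect (A b)) => [Ab|]; last by exists b.
  have [||c Ac cP] := Areg (B := [set b' | G (inl [:: b]) (inl [:: b'])]).
  - by move=> b' Gb; have [c [Ac _ [->]]] := flag1 _ _ Ab Gb.
  - move=> AF; apply: Aunc; apply: emb_trans AF _; apply: (card_le_emb 0).
    apply: finite_set_countable; apply: (finite_preimage (f := fun b' => inl [:: b'])).
      by move=> x y _ _ [].
    exact: Gf.
  by exists c => _; split.
have eigen d : Lim d -> closed_at g d -> forall w, G (inr d) w -> w = inr d.
  move=> Ld cd.
  suff hd e : G (inr d) (inr e) -> e <= d.
    move=> w Gw; have [e [Le de we]] := flag2 _ _ Ld Gw.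
    move: Gw; rewrite we => /hd[-> //|ed]; by move/le_nlt: de.
  move=> Ge.
  have [|m Gm mM] := @finite_max _ _ lt_wf lt_trans lt_total (fun e => G (inr d) (inr e)) e _ Ge.
    apply: (finite_preimage (f := inr)); last exact: Gf.
    by move=> x y _ _ [].
  have [m' [Lm dm [mE]]] := flag2 _ _ Ld Gm; subst m'.
  apply: le_trans (mM _ Ge) _ => //; apply/le_nlt => dm'.
  (* Suppose the largest entry [m] of the row lies above [d]. For large [n], [lad m n] exceeds [d]
     and all other entries, hence also their own [n]-th terms, so it is not cancelled under [S n].
     It then occurs in the row of [lad d n], although that row stays below [d]. *)
  have [n nP] : exists n, d < lad m n /\
      forall e', G (inr d) (inr e') -> e' < m -> e' < lad m n.
    have [N NP] : {N : K -> nat & forall e', e' < m -> forall k, (N e' <= k)%N ->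
        e' < lad m k}.
      apply: (@choice _ _ (fun e' n => e' < m -> forall k, (n <= k)%N ->
        e' < lad m k)) => e'.
      case: (pselect (e' < m)) => [em|]; last by exists 0.
      by have [n] := ladder_cofinal (ladP Lm) em; exists n.
    have [k kP] : exists k, forall e', G (inr d) (inr e') -> (N e' <= k)%N.
      have /finite_nat_bound[k kP] : finite_set (N @` [set e' | G (inr d) (inr e')]).
        apply: finite_image; apply: (finite_preimage (f := inr)); last exact: Gf.
        by move=> x y _ _ [].
      by exists k => e' Ge'; apply: kP; exists e'.
    exists (maxn k (N d)); split; first by apply: NP => //; exact: leq_maxr.
    move=> e' Ge' em; apply: NP => //; apply: leq_trans (kP _ Ge') _.
    exact: leq_maxl.
  have [ld _ _] := ladP Ld; have [_ C2 _] := Gc n.+4.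
  have Gl : G (inl [:: lad d n]) (inl [:: lad m n]).
    apply: (C2 (inr d) _ (inr m)) => //.
    - by rewrite /=; case: pselect.
    - by rewrite /=; case: pselect.
    move=> [//|e'] Ge' /=; case: pselect => // Le' [le'].
    have [->//|em] := mM _ Ge'.
    have := (nP.2 _ Ge' em); rewrite -le'.
    by have [h1 _ _] := ladP Le'; move=> h2; case: (irr (lt_trans h2 (h1 n))).
  have Al : A (lad d n) by apply: dA (ld n); case: Ld.
  apply: (@irr d); apply: lt_trans nP.1 _; apply: lt_trans (cd _ (ld n)).
  exact: (gP _ Al).2.
move=> a w Aa Gw.
have [Ah sh] := hB _ Aa.
(* The stationary fibre over [h0 a] contains a point [d] closed under [g]. The row of its vector is
   diagonal, and [S n0] carries this over to the node of [h0 a]. *)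
have [d [Ld dh cd]] := sh g (fun b Ab => (gP b Ab).1).
have [C1 _ _] := Gc n0.+4.
have [|w' Gw' Sw'] := C1 (inr d) _ _ _ Gw.
  by rewrite /=; case: pselect => // p; rewrite dh.
move: Sw'; rewrite (eigen d Ld cd w' Gw') /=; case: pselect => // p [<-].
by rewrite dh.
Qed.

End Regular.

(** The systems of the various [B j] run side by side on the points [mid (j, y)] and must not mix.
    Each such point is therefore tied to [iL j] in a private copy of the system for [L], whose
    rigidity prevents a row from changing [j]. *)
Lemma rigid_union (K : Type) (L A : set K) (B : K -> set K) :
  A `<=` [set a | exists2 j, L j & B j a] ->
  rigid K L -> (forall j, L j -> rigid K (B j)) ->
  rigid (K * (K * K) + K * K + K) A.
Proof.
move=> AB [iL [q [iLi qr]]] hB.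
have [ip ipP] : {ip : K -> (K -> K) * (nat -> K -> option K) & forall j, L j ->
    (forall a b, B j a -> B j b -> (ip j).1 a = (ip j).1 b -> a = b) /\
    forall G, row_finite G -> (forall n, supp_comm ((ip j).2 n) G) ->
      forall a w, B j a -> G ((ip j).1 a) w -> w = (ip j).1 a}.
  apply: (@choice _ _ (fun j (ip : (K -> K) * (nat -> K -> option K)) => L j ->
    (forall a b, B j a -> B j b -> ip.1 a = ip.1 b -> a = b) /\
    forall G, row_finite G -> (forall n, supp_comm (ip.2 n) G) ->
      forall a w, B j a -> G (ip.1 a) w -> w = ip.1 a)) => j.
  case: (pselect (L j)) => [/hB[i [p h]]|nL]; first by exists (i, p).
  by exists (id, fun=> some).
pose i j := (ip j).1; pose p j := (ip j).2.
pose X : Type := (K * (K * K) + K * K + K)%type.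
pose tag x d : X := inl (inl (x, d)); pose mid d : X := inl (inr d).
pose idm (x : X) : option X := if x is inl (inr d) then Some x else None.
pose th (x : X) : option X :=
  if x is inl (inr d) then Some (tag (iL d.1) d) else None.
(* The images of [a] in all systems that contain it are collapsed to the single point [inr a]. *)
pose ps (x : X) : option X := if x is inl (inr d) then
    (if pselect (exists a, [/\ L d.1, B d.1 a & d.2 = i d.1 a]) is left h
     then Some (inr (projT1 (cid h))) else None) else None.
pose Q n (x : X) : option X :=
  if x is inl (inl (x, d)) then omap (tag^~ d) (q n x) else None.
pose P n (x : X) : option X :=
  if x is inl (inr d) then omap (fun y => mid (d.1, y)) (p d.1 n d.2) else None.
pose f n := match n with 0 => idm | 1 => th | 2 => ps
  | n.+3 => if odd n then Q n./2 else P n./2 end.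
exists inr, f; split; first by move=> a b _ _ [].
move=> G Gf Gc a w Aa Gw.
have GQ n : supp_comm (Q n) G.
  by have := Gc (n.*2.+1).+3; rewrite /f /= odd_double /= uphalf_double.
have GP n : supp_comm (P n) G.
  by have := Gc (n.*2).+3; rewrite /f odd_double /= doubleK.
have [j Lj Ba] := AB a Aa; have [ii ir] := ipP j Lj.
have psE : ps (mid (j, i j a)) = Some (inr a).
  rewrite /ps /=; case: pselect => [h|[]]; last by exists a.
  by case: cid => a' /= [_ Ba' /ii ->].
have [C1 _ _] := Gc 2; have [w' Gw' psw] := C1 _ _ _ psE Gw.
have [C0 _ _] := Gc 0.
have [|w'' _] := C0 (mid (j, i j a)) (mid (j, i j a)) _ _ Gw'; first by [].
case: w'' => [[//|[j' y']]|//] [w'E]; subst w'.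
move: psw; rewrite /f /=; case: pselect => // h [wE].
move: h wE => /= h; case: (cid h) => a' /= [Lj' Ba' y'E] wE; subst w.
(* Commuting with [th] moves the entry into the block between the copies tagged [(j, i j a)] and
   [(j', y')]; this block commutes with the maps of [L]. *)
have jj : iL j' = iL j.
  apply: (qr (fun x x' => G (tag x (j, i j a)) (tag x' (j', y')))) Lj _.
  - by apply: row_finite_pull => // x x' [].
  - move=> n; apply: (supp_comm_pull _ _ _ _ (GQ n)) => //.
    + by move=> x x' [].
    + by move=> [[[x d]|//]|//] z /=; case: (q n x) => //= x' [_ ->]; exists x.
  have [_ C2 _] := Gc 1; apply: (C2 _ _ _ _ _ Gw') => //.
  by move=> [[//|d]|//] _ [_ ->].
have {}jj : j' = j by apply: iLi.
subst j'; congr inr; apply: ii => //; rewrite -/(i j) -y'E.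
apply: (ir (fun y y' => G (mid (j, y)) (mid (j, y')))) Ba Gw'.
  by apply: row_finite_pull => // x x' [].
move=> n; apply: (supp_comm_pull _ _ _ _ (GP n)) => //.
+ by move=> x x' [].
+ by move=> [[//|[j' x]]|//] z /=; case: (p j' n x) => //= x' [-> _]; exists x.
Qed.

Theorem rigid_infinite (K : eqType) : infinite_set [set: K] ->
  exists (i : K -> K) (f : nat -> K -> option K), injective i /\
    forall G, row_finite G -> (forall n, supp_comm (f n) G) ->
      forall a w, G (i a) w -> w = i a.
Proof.
move=> iK.
have injK : exists f : K -> K, injective f by exists id.
have sum_inj := inj_sum iK; have pair_inj := inj_pair iK.
have [lt [wf tr tot]] := well_order_exists K.
suff step (A : set K) : downset lt A ->
    (forall x, A x -> rigid K (seg lt x)) -> rigid K A.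
  have rs x : rigid K (seg lt x).
    elim/(well_founded_ind wf): x => x IH; apply: step => // y z yx zy.
    exact: tr yx.
  have [//|i [f [ii fr]]] := step setT _ (fun x _ => rs x).
  exists i, f; split=> [a b|G Gf Gc a w]; first exact: ii.
  exact: fr.
move=> dA IH.
case: (pselect (emb A [set: nat])) => [|Aunc]; first exact: rigid_countable.
case: (pselect (exists2 x, A x & emb A (seg lt x))) => [[x Ax As]|nA].
  exact: rigid_emb As (IH x Ax).
(* Singular case: by comparison, a cofinal [L] into which [A] does not embed is no larger than a
   proper segment, so induction covers both [L] and the closed segments indexed by it. *)
case: (pselect (exists L : set K, [/\ L `<=` A, ~ emb A L &
    forall b, A b -> exists2 x, L x & ~ lt x b])) => [[L [LA AL Lunb]]|Areg].
  have [j ji] : exists j : K * (K * K) + K * K + K -> K, injective j.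
    by apply: (sum_inj) => //; apply: (sum_inj); do ?apply: (pair_inj).
  have [x0 _] : A !=set0.
    by apply/set0P/eqP => A0; apply: Aunc; exists (fun=> 0); split; rewrite A0.
  apply: (rigid_transport ji).
  apply: (@rigid_union _ L A (fun x => seg lt x `|` [set x])).
  - move=> a Aa; have [x Lx ax] := Lunb a Aa; exists x => //.
    by case: (tot a x) => [?|->|//]; [left|right].
  - have [//|[x Ax Ls]] := emb_downset_or_seg wf tot x0 L dA.
    exact: rigid_emb Ls (IH x Ax).
  - move=> x /LA Ax; case: (pselect (finite_set (seg lt x))) => fx.
      apply: rigid_countable; apply: (card_le_emb 0); apply: finite_set_countable.
      by rewrite finite_setU; split=> //; exact: finite_set1.
    by apply: rigid_emb (IH x Ax); exact: emb_add1.
(* What remains is an uncountable initial segment that embeds in none of its proper segments and in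
   which every smaller subset is bounded. *)
have [j ji] : exists j : seq K + K -> K, injective j.
  by apply: sum_inj => //; exact: inj_seq.
apply: (rigid_transport ji).
apply: (rigid_regular wf tr tot dA Aunc) => [x Ax As|B BA AB].
  by apply: nA; exists x.
apply: contrapT => nb; apply: Areg; exists B; split=> // b Ab.
apply: contrapT => nx; apply: nb; exists b => // x Bx.
by apply: contrapT => xb; apply: nx; exists x.
Qed.

(* The two shifts along nat let the third map carry countably many maps; the
   copy of K is tied to the diagonal of a second copy, so that every diagonal
   operator, constant on the fibres of [lab], commutes with all three maps. *)
Lemma three_maps (K : eqType) : infinite_set [set: K] ->
  exists (y : K -> K) (lab : K -> option K) (p : 'I_3 -> K -> option K),
  [/\ forall k, lab (y k) = Some k,
      forall j x x', p j x = Some x' -> lab x' = lab x &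
      forall G, row_finite G -> (forall j, supp_comm (p j) G) ->
        forall k w, G (y k) w -> w = y k].
Proof.
move=> iK; have [i [f [ii fr]]] := rigid_infinite iK.
pose Z : Type := (K * K + K)%type.
have injK : exists f : K -> K, injective f by exists id.
have [J Ji] : exists J : Z * nat -> K, injective J.
  apply: inj_pair => //; last exact: inj_nat.
  by apply: inj_sum => //; exact: inj_pair.
have [J' [JK J'E]] := partial_inverse Ji.
(* [phi 0] ties [inr k] to the diagonal point [(i k, k)], [phi 1] keeps the rows of the copy inside
   it, and the later maps run the rigid system at each second coordinate. *)
pose phi n (z : Z) : option Z := match n, z with
  | 0, inr k => Some (inl (i k, k))
  | 1, inr k => Some (inr k)
  | n.+2, inl (x, k) => omap (fun x' => inl (x', k)) (f n x)
  | _, _ => None end.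
pose s x : option K := if J' x is Some (z, n) then Some (J (z, n.+1)) else None.
pose s' x : option K :=
  if J' x is Some (z, n.+1) then Some (J (z, n)) else None.
pose t x : option K :=
  if J' x is Some (z, n) then omap (fun z' => J (z', n)) (phi n z) else None.
pose lab x : option K :=
  if J' x is Some (z, _) then Some (match z with inl p => p.2 | inr k => k end)
  else None.
pose p (j : 'I_3) := match nat_of_ord j with 0 => s | 1 => s' | _ => t end.
exists (fun k => J (inr k, 0)), lab, p; split=> [k|j x x'|G Gf Gc].
- by rewrite /lab JK.
- rewrite /p; case: (nat_of_ord j) => [|[|_]].
  + by rewrite /s /lab; case: (J' x) => [[z n]|] // [<-]; rewrite JK.
  + by rewrite /s' /lab; case: (J' x) => [[z [|n]]|] // [<-]; rewrite JK.
  rewrite /t /lab; case: (J' x) => [[z n]|] //.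
  case: n z => [|[|n]] [[a k]|k] //=; [| |case: (f n a) => //= a'];
    by case=> <-; rewrite JK.
have Gs : supp_comm s G by exact: (Gc 0%R).
have Gs' : supp_comm s' G by exact: (Gc 1%R).
have Gt : supp_comm t G by have := Gc (inord 2); rewrite /p inordK.
(* The down shift [s'] is undefined at level 0 and injective above it, so a term of higher level in
   a row of level 0 could not be cancelled; the up shift [s] carries the claim to all levels. *)
have level z n w : G (J (z, n)) w -> exists z', w = J (z', n).
  elim: n w => [|n IH] w Gw; last first.
    have [C1 _ _] := Gs; have [|w' Gw'] := C1 (J (z, n)) _ _ _ Gw.
      by rewrite /s JK.
    have [z' ->] := IH _ Gw'; rewrite /s JK => -[<-].
    by exists z'.
  have [C1 _ C3] := Gs'.
  have [|w' _] := C1 (J (z, 1)) _ _ _ Gw; first by rewrite /s' JK.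
  rewrite /s'; case: (J' w') => [[z' [|m]]|] // [wE].
  case: m wE => [<-|m wE]; first by exists z'.
  have [||v [vw _]] := C3 (J (z, 0)) w (J (z', m)) _ Gw _.
  - by rewrite /s' JK.
  - by rewrite /s' -wE JK.
  rewrite /s'; case vE: (J' v) => [[z1 [|m1]]|] // [/Ji[z1z m1m]].
  by case: vw; rewrite -wE (J'E _ _ vE) z1z m1m.
pose Gn n z z' := G (J (z, n)) (J (z', n)).
have GnS n : Gn n.+1 = Gn n.
  apply/funext => z; apply/funext => z'; apply/propext; split=> h.
    have [_ C2 _] := Gs'; apply: (C2 _ _ _ _ _ h).
    - by rewrite /s' JK.
    - by rewrite /s' JK.
    move=> w /level[z1 ->]; rewrite /s' JK => -[/Ji[->]].
    by [].
  have [_ C2 _] := Gs; apply: (C2 _ _ _ _ _ h).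
  - by rewrite /s JK.
  - by rewrite /s JK.
  move=> w /level[z1 ->]; rewrite /s JK => -[/Ji[->]].
  by [].
have GnE n : Gn n = Gn 0 by elim: n => // n <-.
have Gphi n : supp_comm (phi n) (Gn 0).
  rewrite -(GnE n); apply: supp_comm_pull Gt => //.
  - by move=> z z' /Ji[].
  - by move=> z; rewrite /t JK.
  - by move=> z; rewrite /t JK.
  move=> w z; rewrite /t; case wE: (J' w) => [[z1 n1]|] //=.
  case: (phi n1 z1) => //= z2 [/Ji[_ <-]]; exists z1.
  exact: J'E.
have Gn_fin : row_finite (Gn 0) by apply: row_finite_pull => // z z' /Ji[].
move=> k w Gw; have [z' wE] := level _ _ _ Gw; subst w.
have [C1 _ _] := Gphi 1.
have [//|[[a c]|k'] Gk //=] := C1 (inr k) (inr k) z' _ Gw.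
case=> zE; subst z'.
have [_ C2 _] := Gphi 0.
have h : Gn 0 (inl (i k, k)) (inl (i k', k')).
  by apply: (C2 _ _ _ _ _ Gk) => // -[//|k2] _ [_ ->].
suff /ii -> : i k' = i k by [].
apply: (fr (fun x x' => Gn 0 (inl (x, k)) (inl (x', k')))) => //.
- by apply: row_finite_pull => // x x' [].
- move=> n; apply: (supp_comm_pull _ _ _ _ (Gphi n.+2)) => //.
  + by move=> x x' [].
  + by move=> [[x d]|//] z /=; case: (f n x) => //= x' [_ ->]; exists x.
Qed.

(** * Free modules and their endomorphisms *)

Local Open Scope ring_scope.

Section EndFacts.
Variables (F : nzRingType) (V : lmodType F).
Implicit Types f g : End V.

Lemma EndM f g v : (f * g) v = f (g v). Proof. by []. Qed.
Lemma EndD f g v : (f + g) v = f v + g v. Proof. by []. Qed.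
Lemma EndN f v : (- f) v = - f v. Proof. by []. Qed.
Lemma End0 v : (0 : End V) v = 0. Proof. by []. Qed.
Lemma End1 v : (1 : End V) v = v. Proof. by []. Qed.

Definition mkEnd (h : V -> V) (hl : linear h) : End V :=
  HB.pack_for {linear V -> V} h (GRing.isLinear.Build F V V *:%R h hl).

Lemma mkEndE h hl v : @mkEnd h hl v = h v. Proof. by []. Qed.

Section RankOne.
Variable c : V -> F.
Hypothesis c_linear : forall a u v, c (a *: u + v) = a * c u + c v.

Lemma linf0 : c 0 = 0.
Proof.
by apply: (@addrI _ (c 0)); rewrite -{1}[c 0]mul1r -c_linear scaler0 !addr0.
Qed.

Lemma linfZ a u : c (a *: u) = a * c u.
Proof. by rewrite -[a *: u]addr0 c_linear linf0 addr0. Qed.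

Lemma rank1_linear (w : V) : linear (fun v => c v *: w).
Proof. by move=> a u v; rewrite c_linear scalerDl scalerA. Qed.

Definition rank1 (w : V) : End V := mkEnd (rank1_linear w).

Lemma rank1E w v : rank1 w v = c v *: w. Proof. by []. Qed.

End RankOne.

Lemma linf_mulr (c : V -> F) (r : F) :
  (forall a u v, c (a *: u + v) = a * c u + c v) ->
  forall a u v, c (a *: u + v) * r = a * (c u * r) + c v * r.
Proof. by move=> cl a u v; rewrite cl mulrDl mulrA. Qed.

End EndFacts.

Lemma mem_joinl (T : eqType) (s t : seq T) : {subset s <= undup (s ++ t)}.
Proof. by move=> k; rewrite mem_undup mem_cat => ->. Qed.

Lemma mem_joinr (T : eqType) (s t : seq T) : {subset t <= undup (s ++ t)}.
Proof. by move=> k; rewrite mem_undup mem_cat orbC => ->. Qed.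

Lemma notin_join (T : eqType) (s t : seq T) k : k \notin undup (s ++ t) ->
  k \notin s /\ k \notin t.
Proof. by rewrite mem_undup mem_cat negb_or => /andP. Qed.

Section Coordinates.
Variables (F : nzRingType) (K : choiceType) (V : lmodType F) (b : K -> V).
Hypothesis b_indep : lin_independent b.
Hypothesis b_gen : generating b.

Let rep v := cid (b_gen v).
(** The list supplied by [generating] may repeat indices, so [cf] collects their coefficients; [sp]
    may still contain indices whose coefficient is 0. *)
Definition sp (v : V) : seq K := undup (projT1 (rep v)).
Definition cf (v : V) (k : K) : F :=
  \sum_(i <- projT1 (rep v) | i == k) projT1 (cid (projT2 (rep v))) i.

Lemma sp_uniq v : uniq (sp v). Proof. exact: undup_uniq. Qed.

Lemma cfE v : v = \sum_(k <- sp v) cf v k *: b k.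
Proof.
rewrite /cf /sp; case: (rep v) => s /=; move=> ex; case: cid => c /= vE.
rewrite {1}vE; under [RHS]eq_bigr => k _ do rewrite scaler_suml.
rewrite (exchange_big_dep predT) //= !big_seq; apply: eq_bigr => i si.
rewrite (big_rem i) ?mem_undup //= eqxx big_seq_cond big1 ?addr0 // => k.
rewrite (mem_rem_uniq _ (undup_uniq s)) inE => /andP[/andP[/negPf ki _]].
by rewrite eq_sym ki.
Qed.

Lemma cf_out v k : k \notin sp v -> cf v k = 0.
Proof.
rewrite /sp mem_undup /cf => ks; rewrite big_seq_cond big1 // => i.
by case/andP=> si /eqP ik; rewrite -ik si in ks.
Qed.

Lemma sum_widen (W : nmodType) (d : K -> W) s t : uniq s -> uniq t ->
  {subset s <= t} -> (forall k, k \notin s -> d k = 0) ->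
  \sum_(k <- t) d k = \sum_(k <- s) d k.
Proof.
move=> us ut st ds.
rewrite (bigID (mem s)) /= [X in _ + X]big1 ?addr0 // -big_filter.
apply: perm_big; apply: uniq_perm => [||k]; rewrite ?filter_uniq //.
by rewrite mem_filter /=; case: (boolP (k \in s)) => // /st ->.
Qed.

Lemma cf_unique v d s : uniq s -> (forall k, k \notin s -> d k = 0) ->
  v = \sum_(k <- s) d k *: b k -> cf v =1 d.
Proof.
move=> us ds vE; pose t := undup (s ++ sp v).
have ut : uniq t by exact: undup_uniq.
have ts : {subset s <= t} := @mem_joinl _ _ _.
have tv : {subset sp v <= t} := @mem_joinr _ _ _.
have sum0 : \sum_(k <- t) (cf v k - d k) *: b k = 0.
  under eq_bigr do rewrite scalerBl.
  rewrite sumrB (sum_widen (sp_uniq v)) // -?cfE; last first.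
    by move=> k /cf_out ->; rewrite scale0r.
  rewrite (sum_widen us ut ts) -?vE ?subrr // => k /ds ->.
  by rewrite scale0r.
move=> k; case: (boolP (k \in t)) => [kt|].
  by apply/eqP; rewrite -subr_eq0; apply/eqP; exact: (b_indep ut sum0).
by move=> /notin_join[/ds -> /cf_out].
Qed.

Lemma cf_linear k : linear (cf^~ k : V -> F^o).
Proof.
move=> a u v /=; pose t := undup (sp u ++ sp v).
have tu : {subset sp u <= t} := @mem_joinl _ _ _.
have tv : {subset sp v <= t} := @mem_joinr _ _ _.
apply: (@cf_unique _ (fun k => a * cf u k + cf v k) t).
- exact: undup_uniq.
- move=> i /notin_join[/cf_out -> /cf_out ->].
  by rewrite mulr0 addr0.
under eq_bigr do rewrite scalerDl -scalerA.
rewrite big_split /= -scaler_sumr.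
rewrite (sum_widen (sp_uniq u) (undup_uniq _) tu); last first.
  by move=> i /cf_out ->; rewrite scale0r.
rewrite (sum_widen (sp_uniq v) (undup_uniq _) tv); last first.
  by move=> i /cf_out ->; rewrite scale0r.
by rewrite -!cfE.
Qed.

Lemma cfD u v k : cf (u + v) k = cf u k + cf v k.
Proof. by have := cf_linear k 1 u v; rewrite !scale1r. Qed.

Lemma cf_zero k : cf 0 k = 0.
Proof. by apply: (@addrI _ (cf 0 k)); rewrite -cfD !addr0. Qed.

Lemma cfZ a u k : cf (a *: u) k = a * cf u k.
Proof. by have := cf_linear k a u 0; rewrite !addr0 cf_zero addr0. Qed.

Lemma cfN u k : cf (- u) k = - cf u k.
Proof. by rewrite -scaleN1r cfZ mulN1r. Qed.

Lemma cf_sum I (r : seq I) (P : pred I) (f : I -> V) k :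
  cf (\sum_(i <- r | P i) f i) k = \sum_(i <- r | P i) cf (f i) k.
Proof. by elim/big_rec2: _ => [|i y x _ <-]; [exact: cf_zero | exact: cfD]. Qed.

Lemma cf_b i k : cf (b i) k = (i == k)%:R.
Proof.
apply: (@cf_unique _ (fun k => (i == k)%:R) [:: i]) => // [j|].
  by rewrite inE eq_sym => /negPf ->.
by rewrite big_seq1 eqxx scale1r.
Qed.

Lemma cf_inj u v : cf u =1 cf v -> u = v.
Proof.
move=> uv; rewrite [u]cfE [v]cfE; pose t := undup (sp u ++ sp v).
have tu : {subset sp u <= t} := @mem_joinl _ _ _.
have tv : {subset sp v <= t} := @mem_joinr _ _ _.
rewrite -(sum_widen (sp_uniq u) (undup_uniq _) tu); last first.
  by move=> i /cf_out ->; rewrite scale0r.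
rewrite -(sum_widen (sp_uniq v) (undup_uniq _) tv); last first.
  by move=> i /cf_out ->; rewrite scale0r.
by apply: eq_bigr => i _; rewrite uv.
Qed.

Lemma cf_finite v : finite_set [set k | cf v k <> 0].
Proof.
apply: (@sub_finite_set _ _ [set` sp v]); last exact: finite_seq.
by move=> k /= ck; apply/negPn/negP => /cf_out.
Qed.

Section Extension.
Variable (w : K -> V).
Definition ext_fun (v : V) : V := \sum_(k <- sp v) cf v k *: w k.

Lemma ext_funE v s : uniq s -> {subset sp v <= s} ->
  ext_fun v = \sum_(k <- s) cf v k *: w k.
Proof.
move=> us vs; rewrite (sum_widen (sp_uniq v) us vs) // => k /cf_out ->.
by rewrite scale0r.
Qed.

Lemma ext_linear : linear ext_fun.
Proof.
move=> a u v; pose t := undup (sp (a *: u + v) ++ undup (sp u ++ sp v)).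
rewrite !(@ext_funE _ t) ?undup_uniq //; first last.
- exact: mem_joinl.
- by move=> i iu; apply/mem_joinr/mem_joinl.
- by move=> i iu; apply/mem_joinr/mem_joinr.
rewrite scaler_sumr -big_split /=; apply: eq_bigr => k _.
by rewrite cfD cfZ scalerDl scalerA.
Qed.

Lemma ext_exists : exists f : End V, forall k, f (b k) = w k.
Proof.
exists (mkEnd ext_linear) => k; rewrite mkEndE (@ext_funE _ (undup ([:: k] ++ sp (b k)))) ?undup_uniq //; last first.
  exact: mem_joinr.
rewrite (@sum_widen _ (fun i => cf (b k) i *: w i) [:: k]) ?undup_uniq //.
- by rewrite big_seq1 cf_b eqxx scale1r.
- exact: mem_joinl.
- by move=> i; rewrite inE cf_b eq_sym => /negPf ->; rewrite scale0r.
Qed.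

Definition ext : End V := projT1 (cid ext_exists).

Lemma ext_b k : ext (b k) = w k.
Proof. by rewrite /ext; case: cid. Qed.

End Extension.

Lemma End_eqb (f g : End V) : (forall k, f (b k) = g (b k)) -> f = g.
Proof.
move=> fg; apply: EndP => v; rewrite [v]cfE !linear_sum.
by apply: eq_bigr => k _; rewrite !linearZZ fg.
Qed.

Lemma End_cf (f : End V) v i : cf (f v) i = \sum_(k <- sp v) cf v k * cf (f (b k)) i.
Proof.
rewrite {1}[v]cfE linear_sum cf_sum; apply: eq_bigr => k _.
by rewrite linearZZ cfZ.
Qed.

End Coordinates.

(** * Left principal ideal domains *)

Section LeftPID.
Variable F : nzRingType.
Hypothesis pidF : is_left_pid F.

Lemma pid_domain (x y : F) : x * y = 0 -> x = 0 \/ y = 0.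
Proof.
by have [dF _] := pidF => /dF/orP[] /eqP; [left | right].
Qed.

Lemma pid_mulI (a x y : F) : a <> 0 -> x * a = y * a -> x = y.
Proof.
move=> a0 xy; apply/eqP; rewrite -subr_eq0; apply/eqP.
by have [] // := @pid_domain (x - y) a; rewrite mulrBl xy subrr.
Qed.

Lemma pid_ideal (J : F -> Prop) : J 0 ->
  (forall a x y, J x -> J y -> J (a * x + y)) ->
  exists2 a, J a & forall x, J x -> exists r, x = r * a.
Proof.
move=> J0 Jl; have [_ pF] := pidF.
have [|a aP] := pF [pred x : F^o | `[< J x >]].
  split=> [|a x y]; first exact/asboolP.
  by move=> /asboolP Jx /asboolP Jy; apply/asboolP; exact: Jl.
exists a => [|x Jx]; first by apply/asboolP/aP; exists 1; rewrite mul1r.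
by apply/aP/asboolP.
Qed.

End LeftPID.

Lemma skewfield_left_pid (F : nzRingType) : is_skewfield F -> is_left_pid F.
Proof.
move=> sF; split.
  move=> x y xy; apply/orP; case: (eqVneq x 0) => [|/sF[z [zx _]]]; first by left.
  by right; rewrite -[y]mul1r -zx -mulrA xy mulr0.
move=> I [I0 Il]; have IZ a x : x \in I -> a * x \in I.
  by move=> xI; rewrite -[a * x]addr0; exact: Il.
case: (pselect (exists2 x, x \in I & x != 0)) => [[x xI /sF[y [yx xy]]]|h].
  exists 1 => z; split=> [_|_]; first by exists z; rewrite mulr1.
  by rewrite -[z]mulr1 -yx mulrA; exact: IZ.
exists 0 => x; split=> [xI|[r ->]]; last by rewrite mulr0.
exists 0; rewrite mulr0; apply/eqP/negPn/negP => x0; apply: h.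
by exists x.
Qed.

(** * Definability of a basis *)

(* The values [env 0 .. env 5] are the parameters of the interpretation: a
   primitive idempotent e, whose corner ring is the opposite of F, a functional,
   an embedding and the three operators of [three_maps].  [inB] singles out the
   maps sending a generator of the image of e to a basis vector. *)
Definition inB {R : pzRingType} (env : nat -> R) (x : R) : Prop :=
  [/\ x * env 0 = x, env 1 * x = env 0 &
      forall g, g * env 3 = env 3 * g -> g * env 4 = env 4 * g ->
        g * env 5 = env 5 * g ->
        exists r, [/\ env 0 * r = r, r * env 0 = r &
                      g * (env 2 * x) = env 2 * x * r]].

Definition primitive_idempotent {R : pzRingType} (e : R) : Prop :=
  [/\ e <> 0, e * e = e &
      forall f, f * f = f -> e * f = f -> f * e = f -> f = 0 \/ f = e].

(** The second clause will give linear independence, by an operator that fixes one vector and kills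
    the others. The third gives generation: an endomorphism whose image contains all the vectors is
    onto, expressed by a right inverse. *)
Definition good {R : pzRingType} (env : nat -> R) : Prop :=
  [/\ primitive_idempotent (env 0),
      forall x, inB env x -> exists g, g * x = x /\
        forall y, inB env y -> y = x \/ g * y = 0 &
      forall h, (forall x, inB env x -> exists z, x = h * z) ->
        exists z, h * z = 1].

Section Existence.
Variables (F : nzRingType) (K : choiceType) (V : lmodType F) (b : K -> V).
Hypothesis pidF : is_left_pid F.
Hypothesis infK : infinite_set [set: K].
Hypothesis b_indep : lin_independent b.
Hypothesis b_gen : generating b.

Let cf := cf b_gen.
Let ext := ext b_indep b_gen.
Let End_eqb := @End_eqb F K V b b_gen.

Let ext_b w k : ext w (b k) = w k. Proof. exact: ext_b. Qed.
Let cf_b i k : cf (b i) k = (i == k)%:R. Proof. exact: cf_b. Qed.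
Let cf_inj u v : cf u =1 cf v -> u = v. Proof. exact: cf_inj. Qed.

Let op (p : K -> option K) : End V :=
  ext (fun k => if p k is Some k' then b k' else 0).

Let cf_op p v z : cf (op p v) z = \sum_(k <- sp b_gen v) cf v k * (p k == Some z)%:R.
Proof.
rewrite /cf (End_cf b_indep); apply: eq_bigr => k _.
rewrite ext_b; case: (p k) => [k'|]; first by rewrite -/cf cf_b.
by rewrite (cf_zero b_indep).
Qed.

(** Compare coefficients at [z]: on the side of [op p * g] one sums over the preimages of [z], and
    only one term is left when a single preimage lies in the support. *)
Lemma op_supp_comm p (g : End V) : g * op p = op p * g ->
  supp_comm p (fun x w => cf (g (b x)) w <> 0).
Proof.
move=> gp; have gpb x z : cf (g (op p (b x))) z =
    \sum_(k <- sp b_gen (g (b x))) cf (g (b x)) k * (p k == Some z)%:R.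
  by rewrite -cf_op -!EndM gp.
have pick1 v w z : p w = Some z ->
    (forall w', cf v w' <> 0 -> p w' = Some z -> w' = w) ->
    \sum_(k <- sp b_gen v) cf v k * (p k == Some z)%:R = cf v w.
  move=> pw uw;
  case: (boolP (w \in sp b_gen v)) => [wv|/(cf_out (b_gen := b_gen)) cw].
    rewrite (bigD1_seq w) ?sp_uniq //= pw eqxx mulr1 big1 ?addr0 // => k kw.
    case: eqP => [pk|_]; last by rewrite mulr0.
    case: (pselect (cf v k = 0)) => [->|ck]; first by rewrite mul0r.
    by rewrite (uw k) ?eqxx in kw.
  rewrite [RHS]cw big_seq big1 // => k kv; case: eqP => [pk|_]; last by rewrite mulr0.
  case: (pselect (cf v k = 0)) => [->|ck]; first by rewrite mul0r.
  by rewrite (uw k) // [cf _ _]cw mul0r.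
split.
- move=> x y z px cyz; apply: contrapT => nw; apply: cyz.
  have := gpb x z; rewrite ext_b px => ->; apply: big1 => k _.
  case: eqP => [pk|_]; last by rewrite mulr0.
  case: (pselect (cf (g (b x)) k = 0)) => [->|ck]; first by rewrite mul0r.
  by case: nw; exists k.
- move=> x y w z px cw pw uw; have := gpb x z.
  by rewrite ext_b px (pick1 _ _ _ pw uw) => ->.
- move=> x w z px cw pw; apply: contrapT => nw; apply: cw.
  have := gpb x z; rewrite ext_b px linear0 (pick1 _ _ _ pw).
    by rewrite /cf (cf_zero b_indep) => <-.
  by move=> w' cw' pw'; apply: contrapT => ww; apply: nw; exists w'; split.
Qed.

Let diag (d : K -> F) : End V := ext (fun k => d k *: b k).

Let diag_comm p d : (forall x y, p x = Some y -> d y = d x) ->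
  diag d * op p = op p * diag d.
Proof.
move=> dp; apply: End_eqb => x; rewrite !EndM /diag /op !ext_b linearZZ ext_b.
case px: (p x) => [y|]; first by rewrite ext_b (dp _ _ px).
by rewrite scaler0 linear0.
Qed.

Let cf_diag d v k : cf (diag d v) k = cf v k * d k.
Proof.
rewrite /cf (End_cf b_indep).
case: (boolP (k \in sp b_gen v)) => [kv|kv].
  rewrite (bigD1_seq k) ?sp_uniq //= big1 ?addr0 => [|i ik].
    by rewrite /diag ext_b (cfZ b_indep) -/cf cf_b eqxx mulr1.
  by rewrite /diag ext_b (cfZ b_indep) -/cf cf_b (negPf ik) !mulr0.
rewrite (cf_out kv) mul0r big_seq big1 // => i iv.
rewrite /diag ext_b (cfZ b_indep) -/cf cf_b; case: eqP => [ik|_]; last by rewrite !mulr0.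
by rewrite ik (negPf kv) in iv.
Qed.

Lemma good_exists : exists env : nat -> End V, good env.
Proof.
have [y [lab [p [ylab labp rig]]]] := three_maps infK.
have yi : injective y by move=> k k' e; have := ylab k; rewrite e ylab => -[].
have [k0 _] := infinite_setN0 infK.
pose u := b k0; pose c v := cf v k0.
have cl a v w : c (a *: v + w) = a * c v + c w by exact: cf_linear.
have cu : c u = 1 by rewrite /c cf_b eqxx.
(* [om] sums the coordinates, and so excludes nontrivial multiples of basis vectors; [th] moves the
   basis to the copy on which commuting matrices are diagonal. *)
pose e := rank1 cl u; pose om := ext (fun=> u); pose th := ext (fun k => b (y k)).
pose env n : End V := match n with 0 => e | 1 => om | 2 => th
  | 3 => op (p 0) | 4 => op (p 1) | _ => op (p (inord 2)) end.
have omb k : om (b k) = u by exact: ext_b.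
have thb k : th (b k) = b (y k) by exact: ext_b.
have cf_th v k : cf (th v) (y k) = cf v k.
  rewrite /cf (End_cf b_indep) -/cf.
  case: (boolP (k \in sp b_gen v)) => [kv|kv].
    rewrite (bigD1_seq k) ?sp_uniq //= big1 ?addr0 => [|i ik]; rewrite thb cf_b.
      by rewrite eqxx mulr1.
    by rewrite (inj_eq yi) (negPf ik) mulr0.
  rewrite [RHS](cf_out kv) big_seq big1 // => i iv; rewrite thb cf_b (inj_eq yi).
  by case: eqP => [ik|_]; [rewrite ik (negPf kv) in iv | rewrite mulr0].
have inBP x : inB env x <-> exists k, x = rank1 cl (b k).
  split=> [[xe ox xg]|[k ->]]; last first.
    split=> [||g g0 g1 g2].
    - by apply: EndP => v; rewrite EndM !rank1E (linfZ cl) cu mulr1.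
    - by apply: EndP => v; rewrite EndM !rank1E linearZZ omb.
    have gc j : supp_comm (p j) (fun x w => cf (g (b x)) w <> 0).
      apply: op_supp_comm; case: j => [[|[|[|//]]] j3].
      - by rewrite (_ : Ordinal j3 = 0); last exact: val_inj.
      - by rewrite (_ : Ordinal j3 = 1); last exact: val_inj.
      - by rewrite (_ : Ordinal j3 = inord 2) //; apply: val_inj; rewrite /= inordK.
    have grow : row_finite (fun x w => cf (g (b x)) w <> 0).
      by move=> z; exact: cf_finite.
    pose a := cf (g (b (y k))) (y k).
    have gE : g (b (y k)) = a *: b (y k).
      apply: cf_inj => w; rewrite /cf (cfZ b_indep) -/cf cf_b.
      case: eqP => [<-|yw]; first by rewrite mulr1.
      rewrite mulr0; apply: contrapT => /(rig _ grow gc) wy.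
      by rewrite wy in yw.
    exists (rank1 (linf_mulr a cl) u); split.
    - by apply: EndP => v; rewrite EndM !rank1E (linfZ cl) cu mulr1.
    - by apply: EndP => v; rewrite EndM !rank1E (linfZ cl) cu mulr1.
    apply: EndP => v; rewrite !EndM !rank1E !linearZZ (linfZ cl) cu mulr1.
    by rewrite thb gE scalerA.
  have xv v : x v = c v *: x u by rewrite -[x in LHS]xe EndM rank1E linearZZ.
  have ow : om (x u) = u by rewrite -EndM ox rank1E cu scale1r.
  set w := x u in ow xv.
  have u0 : u <> 0.
    by move=> u0; move/eqP: cu; rewrite u0 (linf0 cl) eq_sym oner_eq0.
  have [k1 wk1] : exists k1, cf w k1 <> 0.
    apply: contrapT => nw; apply: u0; rewrite -ow (_ : w = 0) ?linear0 //.
    apply: cf_inj => k; rewrite /cf (cf_zero b_indep).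
    by apply: contrapT => wk; apply: nw; exists k.
  have wk k : k != k1 -> cf w k = 0.
    (* The projection onto the vectors labelled [k1] commutes with the three operators, so [th w] is
       an eigenvector of it. Without zero divisors, [w] can only have the coordinate [k1]. *)
    move=> kk1; pose d z : F := (lab z == Some k1)%:R.
    have dc j : diag d * op (p j) = op (p j) * diag d.
      by apply: diag_comm => z z' /labp; rewrite /d => ->.
    have [r [_ _ rE]] := xg _ (dc 0) (dc 1) (dc (inord 2)).
    have {}rE k' : cf w k' * (k' == k1)%:R = c (r u) * cf w k'.
      have : cf ((diag d * (th * x)) u) (y k') = cf ((th * x * r) u) (y k').
        by rewrite [diag d * _]rE.
      rewrite !EndM cf_diag -/w cf_th /d ylab xv linearZZ /cf (cfZ b_indep).
      by rewrite -/cf cf_th => <-.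
    have := rE k; rewrite (negPf kk1) mulr0 => /esym /(pid_domain pidF)[] // c0.
    by case: wk1; have := rE k1; rewrite eqxx mulr1 c0 mul0r.
  have wE : w = cf w k1 *: b k1.
    apply: cf_inj => k; rewrite /cf (cfZ b_indep) -/cf cf_b.
    by case: (eqVneq k1 k) => [<-|/eqP kk]; rewrite ?mulr1 ?mulr0 // wk // eq_sym; apply/eqP.
  exists k1; apply: EndP => v; rewrite rank1E xv; congr (_ *: _).
  have : c (om (cf w k1 *: b k1)) = c u by rewrite -wE ow.
  rewrite linearZZ omb (linfZ cl) cu mulr1 => w1.
  by rewrite wE w1 scale1r.
exists env; split.
- split.
  + move=> e0; have eu : c (e u) = 1 by rewrite rank1E cu scale1r.
    have e00 : e = 0 := e0.
    by move/eqP: (oner_neq0 F); apply; rewrite -eu e00 End0 (linf0 cl).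
  + by apply: EndP => v; rewrite EndM !rank1E (linfZ cl) cu mulr1.
  move=> f ff ef fe.
  have fv v : f v = c v *: f u by rewrite -[f in LHS]fe EndM rank1E linearZZ.
  have fu : f u = c (f u) *: u by rewrite -[f in LHS]ef EndM rank1E.
  (* An idempotent of the corner is given by an idempotent scalar, which is 0 or 1 in a domain. *)
  have : c (f u) * (c (f u) - 1) = 0.
    have := congr1 (fun g : End V => c (g u)) ff.
    by rewrite EndM [f (f u)]fv (linfZ cl) mulrBr mulr1 => ->; rewrite subrr.
  move=> /(pid_domain pidF)[c0|/eqP].
    by left; apply: EndP => v; rewrite fv fu c0 scale0r scaler0.
  rewrite subr_eq0 => /eqP c1; right; apply: EndP => v.
  by rewrite fv fu c1 scale1r.
- move=> x /inBP[k ->].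
  have ckl a v w : cf (a *: v + w) k = a * cf v k + cf w k by exact: cf_linear.
  exists (rank1 ckl (b k)); split=> [|z /inBP[k' ->]].
    by apply: EndP => v; rewrite EndM !rank1E (linfZ ckl) cf_b eqxx mulr1.
  case: (eqVneq k' k) => [->|kk]; [by left | right].
  by apply: EndP => v; rewrite EndM !rank1E (linfZ ckl) cf_b (negPf kk) mulr0 scale0r.
- move=> h hB.
  have [w wP] : {w : K -> V & forall k, h (w k) = b k}.
    apply: (@choice _ _ (fun k v => h v = b k)) => k.
    have [|z zE] := hB (rank1 cl (b k)); first by apply/inBP; exists k.
    by exists (z u); rewrite -EndM -zE rank1E cu scale1r.
  by exists (ext w); apply: End_eqb => k; rewrite EndM ext_b wP.
Qed.
End Existence.

(** * Submodules as images, and comparison of bases *)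

Section Submodules.
Variables (F : nzRingType) (K : choiceType) (V : lmodType F) (b : K -> V).
Hypothesis pidF : is_left_pid F.
Hypothesis b_indep : lin_independent b.
Hypothesis b_gen : generating b.

Let cf := cf b_gen.

(* Each submodule is generated by elements whose leading coefficients generate
   the ideals of leading coefficients, for a well-ordering of the basis. *)
Lemma submodule_image (I : V -> Prop) : I 0 ->
  (forall a u v, I u -> I v -> I (a *: u + v)) ->
  exists h : End V, forall v, I v <-> exists z, v = h z.
Proof.
move=> I0 Il; have [lt [wf tr tot]] := well_order_exists K.
have leadP k : exists w, [/\ I w, forall i, lt k i -> cf w i = 0 &
    forall v, I v -> (forall i, lt k i -> cf v i = 0) ->
    exists r, cf v k = r * cf w k].
  have [||a [w [Iw wk <-]] aP] := pid_ideal pidF (J := fun a =>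
      exists v, [/\ I v, forall i, lt k i -> cf v i = 0 & cf v k = a]).
  - by exists 0; split=> // [i _|]; rewrite /cf (cf_zero b_indep).
  - move=> a _ _ [u [Iu uk <-]] [v [Iv vk <-]]; exists (a *: u + v).
    split=> [|i ki|]; first exact: Il.
      rewrite /cf (cfD b_indep) (cfZ b_indep) -/cf.
      by rewrite uk ?vk // mulr0 addr0.
    by rewrite /cf (cfD b_indep) (cfZ b_indep).
  by exists w; split=> // v Iv vk; apply: aP; exists v.
have [w wP] := choice leadP.
pose h := ext b_indep b_gen w.
have Is (s : seq K) (d : K -> F) : I (\sum_(k <- s) d k *: w k).
  elim: s => [|k s IH]; first by rewrite big_nil.
  by rewrite big_cons; apply: Il => //; case: (wP k).
have hE v : h v = \sum_(k <- sp b_gen v) cf v k *: w k.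
  rewrite {1}[v](cfE b_gen) linear_sum; apply: eq_bigr => k _.
  by rewrite linearZZ ext_b.
exists h => v; split=> [|[z ->]]; last by rewrite hE; exact: Is.
suff main m : forall v, I v -> (forall i, lt m i -> cf v i = 0) ->
    exists z, v = h z.
  move=> Iv; case: (pselect (exists k, cf v k <> 0)) => [[k vk]|nv].
    have [m _ mM] := finite_max wf tr tot (cf_finite b_gen v) vk.
    apply: (main m) => // i mi; apply: contrapT => vi.
    by have /(le_nlt wf tr tot) := mM _ vi.
  exists 0; rewrite linear0; apply: (cf_inj (b_gen := b_gen)) => k.
  rewrite (cf_zero b_indep).
  by apply: contrapT => vk; apply: nv; exists k.
elim/(well_founded_ind wf): m => m IH {}v Iv vm.
have [Iw wm /(_ v Iv vm)[r vr]] := wP m.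
(* This cancels the coefficient at [m], so the leading index drops. *)
pose v' := (- r) *: w m + v.
have Iv' : I v' by exact: Il.
have v'm i : le lt m i -> cf v' i = 0.
  rewrite /cf (cfD b_indep) (cfZ b_indep) -/cf => -[<-|mi].
    by rewrite vr mulNr addNr.
  by rewrite wm // vm // mulr0 addr0.
suff [z zE] : exists z, v' = h z.
  exists (r *: b m + z); rewrite linearD linearZZ ext_b -zE /v' addrA scaleNr.
  by rewrite subrr add0r.
case: (pselect (exists k, cf v' k <> 0)) => [[k vk]|nv]; last first.
  exists 0; rewrite linear0; apply: (cf_inj (b_gen := b_gen)) => k.
  by rewrite (cf_zero b_indep); apply: contrapT => vk; apply: nv; exists k.
have [m' m'v mM] := finite_max wf tr tot (cf_finite b_gen v') vk.
apply: (IH m') => // [|i mi].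
  apply: contrapT => /(le_nlt wf tr tot) mm'; exact: m'v (v'm _ mm').
by apply: contrapT => vi; have /(le_nlt wf tr tot) := mM _ vi.
Qed.

End Submodules.

(** Every [b i] occurs in the expansion of some [d j]; [i] is recovered from [j] and its position in
    that finite support. For infinite bases this yields the invariance of rank. *)
Lemma basis_emb (F : nzRingType) (I J : choiceType) (V : lmodType F)
    (b : I -> V) (d : J -> V) :
  lin_independent b -> generating b -> generating d ->
  emb [set: I] [set: J * nat] /\ (finite_set [set: J] -> finite_set [set: I]).
Proof.
move=> bi bg dg.
have hit i : exists j, cf bg (d j) i <> 0.
  apply: contrapT => nj; have [s [c biE]] := dg (b i).
  have := cf_b bi bg i i; rewrite biE (cf_sum bi) eqxx big1 => [|j _].
    by move/eqP; rewrite eq_sym oner_eq0.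
  rewrite (cfZ bi); suff -> : cf bg (d j) i = 0 by rewrite mulr0.
  by apply: contrapT => ?; apply: nj; exists j.
have [j jP] := choice hit.
have js i : i \in sp bg (d (j i)) by apply/negPn/negP => /cf_out /jP.
split.
  exists (fun i => (j i, index i (sp bg (d (j i))))); split=> // i i' _ _ [jE].
  rewrite -jE => e; rewrite -(nth_index i (js i)) e nth_index // jE.
  exact: js.
move=> fJ; apply: (@sub_finite_set _ _
  (\bigcup_(k in [set: J]) [set` sp bg (d k)])).
  by move=> i _; exists (j i) => //=; exact: js.
by apply: bigcup_finite => // k _; exact: finite_seq.
Qed.

Lemma card_eqT_bij {T U : Type} : [set: T] #= [set: U] ->
  exists f : T -> U, bijective f.
Proof.
move=> /card_bijP[f [g fg gf]].
pose iT (t : T) : set_type [set: T] := exist _ t (mem_set Logic.I).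
pose iU (u : U) : set_type [set: U] := exist _ u (mem_set Logic.I).
have iTK z : iT (val z) = z by exact: val_inj.
have iUK z : iU (val z) = z by exact: val_inj.
exists (fun t => val (f (iT t))), (fun u => val (g (iU u))).
  by move=> t; rewrite iUK fg.
by move=> u; rewrite iTK gf.
Qed.

Lemma span_pairs (F : nzRingType) (J : choiceType) (V : lmodType F) (d : J -> V)
    (l : seq (F * J)) :
  exists s c, \sum_(p <- l) p.1 *: d p.2 = \sum_(i <- s) c i *: d i.
Proof.
exists (undup (map snd l)), (fun i => \sum_(p <- l | p.2 == i) p.1).
under [RHS]eq_bigr => i _ do rewrite scaler_suml.
rewrite (exchange_big_dep predT) //= big_seq [RHS]big_seq.
apply: eq_bigr => p pl; have pu : p.2 \in undup (map snd l).
  by rewrite mem_undup; exact: map_f.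
rewrite big_mkcond (bigD1_seq p.2) ?undup_uniq //= eqxx big1 ?addr0 // => i.
by rewrite eq_sym => /negPf ->.
Qed.

(** * Recovering a basis from good parameters *)

Section Frame.
Variables (F : nzRingType) (K : choiceType) (V : lmodType F).
Hypothesis pidF : is_left_pid F.
Hypothesis infK : infinite_set [set: K].
Hypothesis freeV : free_of_rank K V.

Lemma good_frame (env : nat -> End V) : good env ->
  exists (b : K -> V) (u : V) (c : V -> F)
    (cl : forall a v w, c (a *: v + w) = a * c v + c w),
  [/\ lin_independent b, generating b, c u = 1,
      env 0 = rank1 cl u &
      forall x, inB env x <-> exists k, x = rank1 cl (b k)].
Proof.
have [b0 [b0i b0g]] := freeV; pose cf0 := cf b0g.
move=> [[e0 ee eprim] Bsep Bgen]; set e := env 0 in e0 ee eprim.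
(* The [k]-th coordinates of the image of [e] form a nonzero left ideal; [w] realises a generator of
   it, and dividing by that generator defines the functional [c]. *)
have [w [k [wk ew wP]]] : exists w k, [/\ cf0 w k <> 0, e w = w &
    forall v, exists r, cf0 (e v) k = r * cf0 w k].
  have [v [k vk]] : exists v k, cf0 (e v) k <> 0.
    apply: contrapT => nv; apply: e0; apply: EndP => v; rewrite End0.
    apply: (cf_inj (b_gen := b0g)) => k; rewrite (cf_zero b0i).
    by apply: contrapT => vk; apply: nv; exists v, k.
  have [||a [w wa] aP] := pid_ideal pidF (J := fun a => exists v, cf0 (e v) k = a).
  - by exists 0; rewrite linear0 /cf0 (cf_zero b0i).
  - move=> a _ _ [x <-] [z <-]; exists (a *: x + z).
    by rewrite linearD linearZZ /cf0 (cfD b0i) (cfZ b0i).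
  exists (e w), k; split=> [ewk||z].
  - have [|r rE] := aP (cf0 (e v) k); first by exists v.
    by apply: vk; rewrite rE -wa ewk mulr0.
  - by rewrite -EndM ee.
  by rewrite wa; apply: aP; exists z.
have [c cP] := choice wP.
have cl a x z : c (a *: x + z) = a * c x + c z.
  apply: (pid_mulI pidF wk); rewrite -cP linearD linearZZ /cf0.
  by rewrite (cfD b0i) (cfZ b0i) -/cf0 !cP mulrDl mulrA.
have cw : c w = 1 by apply: (pid_mulI pidF wk); rewrite -cP ew mul1r.
(* The right-hand side is a nonzero idempotent absorbed by [e] on both sides, so primitivity
   applies. *)
have eE : e = rank1 cl w.
  apply/esym; have [||||//] := eprim (rank1 cl w).
  - by apply: EndP => v; rewrite EndM !rank1E (linfZ cl) cw mulr1.
  - by apply: EndP => v; rewrite EndM !rank1E linearZZ ew.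
  - apply: EndP => v; rewrite EndM !rank1E; congr (_ *: _).
    by apply: (pid_mulI pidF wk); rewrite -!cP -EndM ee.
  move=> r0; case: wk; have -> : w = rank1 cl w w by rewrite rank1E cw scale1r.
  by rewrite r0 End0 /cf0 (cf_zero b0i).
have xv x v : x * e = x -> x v = c v *: x w.
  by move=> xe; rewrite -[x in LHS]xe EndM eE rank1E linearZZ.
pose B : set V := [set v | exists2 x, inB env x & v = x w].
have Bx v : B v -> inB env (rank1 cl v) /\ c (env 1 v) = 1.
  move=> [x xB vE]; have [xe ox _] := xB.
  have -> : rank1 cl v = x by apply: EndP => z; rewrite rank1E vE -xv.
  by split=> //; rewrite vE -EndM ox -/e eE rank1E cw scale1r.
pose bB (v : set_type B) : V := val v.
have bBP i : inB env (rank1 cl (bB i)) /\ c (env 1 (bB i)) = 1.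
  by apply: Bx; exact: set_valP.
(* The operator [g] isolates one term of a relation; [c] after [env 1] is 1 on all of [B] and reads
   off the coefficient. *)
have bBi : lin_independent bB.
  move=> s d us sd i si.
  have [g [gi gj]] := Bsep _ (bBP i).1.
  have gbi : g (bB i) = bB i.
    have := congr1 (fun f : End V => f w) gi.
    by rewrite EndM rank1E cw scale1r.
  have gbj j : j != i -> g (bB j) = 0.
    move=> ji; have [jE|g0] := gj _ (bBP j).1.
      have := congr1 (fun f : End V => f w) jE.
      by rewrite !rank1E cw !scale1r => /val_inj ij; rewrite ij eqxx in ji.
    have := congr1 (fun f : End V => f w) g0.
    by rewrite EndM rank1E cw scale1r.
  have := congr1 (fun v => c (env 1 (g v))) sd.
  rewrite linear_sum (bigD1_seq i) //= big1 ?addr0 => [|j ji]; last first.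
    by rewrite linearZZ gbj // scaler0.
  by rewrite linearZZ gbi linearZZ (linfZ cl) (bBP i).2 mulr1 !linear0 (linf0 cl).
have bBg : generating bB.
  (* The span, like any submodule, is the image of some [h], and the last clause of [good] makes [h]
     onto. *)
  pose I v := exists l : seq (F * set_type B), v = \sum_(p <- l) p.1 *: bB p.2.
  have I0 : I 0 by exists [::]; rewrite big_nil.
  have Il a x z : I x -> I z -> I (a *: x + z).
    move=> [l ->] [l' ->]; exists (map (fun p => (a * p.1, p.2)) l ++ l').
    rewrite big_cat big_map scaler_sumr; congr (_ + _).
    by apply: eq_bigr => p _; rewrite scalerA.
  have [h hI] := submodule_image pidF b0i b0g I0 Il.
  have [x xB|z hz v] := Bgen h.
    have /hI[v vE] : I (x w).
      have xwB : B (x w) by exists x.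
      exists [:: (1, exist _ (x w) (mem_set xwB))].
      by rewrite big_seq1 scale1r.
    exists (rank1 cl v); have [xe _ _] := xB; apply: EndP => t.
    by rewrite EndM rank1E linearZZ -vE -xv.
  have /hI[l vE] : exists t, v = h t by exists (z v); rewrite -EndM hz.
  by have [s [d E]] := span_pairs bB l; exists s, d; rewrite vE.
(* Comparing with the given basis in both directions allows the new one to be reindexed by [K]. *)
have [TK _] := basis_emb bBi bBg b0g.
have [KT finT] := basis_emb b0i b0g bBg.
have infT : infinite_set [set: set_type B] by move=> /finT.
have pairK (J : eqType) : infinite_set [set: J] -> emb [set: J * nat] [set: J].
  move=> infJ; apply/embT_inj; apply: inj_pair => //; last exact: inj_nat.
  by exists id.
have /card_eqT_bij[f [f' ff' f'f]] : [set: K] #= [set: set_type B].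
  apply/card_eqPle; split; apply: emb_card_le.
    by apply: emb_trans KT _; exact: pairK.
  by apply: emb_trans TK _; exact: pairK.
exists (bB \o f), w, c, cl; split=> //.
- move=> s d us sd i si.
  have := bBi (map f s) (d \o f') _ _ (f i).
  rewrite map_inj_uniq ?big_map => [|k1 k2 /(congr1 f')]; last by rewrite !ff'.
  under eq_bigr do rewrite /= ff'.
  by move=> /(_ us sd (map_f f si)); rewrite /= ff'.
- move=> v; have [s [d ->]] := bBg v.
  exists (map f' s), (d \o f); rewrite big_map.
  by apply: eq_bigr => i _ /=; rewrite f'f.
move=> x; split=> [xB|[i ->]]; last exact: (bBP (f i)).1.
have [xe _ _] := xB; have xwB : B (x w) by exists x.
exists (f' (exist _ (x w) (mem_set xwB))); apply: EndP => v.
by rewrite rank1E /= f'f /= -xv.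
Qed.

End Frame.

(** * From second-order formulas to ring formulas *)

Lemma term_val_coincide (R : pzRingType) (s : seq nat) t (e e' : nat -> R) :
  closed_term s t -> {in s, e =1 e'} -> term_val e t = term_val e' t.
Proof.
move=> + ee; elim: t => //= [t IH /IH -> //|t IHt u IHu|t IHt u IHu].
- by case/andP=> /IHt -> /IHu ->.
- by case/andP=> /IHt -> /IHu ->.
Qed.

Lemma eq_in_cons (R : Type) (s : seq nat) i (x : R) (e e' : nat -> R) :
  {in s, e =1 e'} -> {in i :: s, [eta e with i |-> x] =1 [eta e' with i |-> x]}.
Proof. by move=> ee j; rewrite inE /=; case: eqP => //= _; exact: ee. Qed.

Lemma ring_holds_coincide (R : pzRingType) phi (s : seq nat) (e e' : nat -> R) :
  closed_formula s phi -> {in s, e =1 e'} ->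
  ring_holds e phi <-> ring_holds e' phi.
Proof.
elim: phi s e e' => /= [t u|f IH|f IHf g IHg|f IHf g IHg|f IHf g IHg|i f IH|i f IH] s e e'.
- by move=> /andP[ct cu] ee; rewrite !(term_val_coincide _ ee).
- by move=> cf ee; rewrite (IH s _ _ cf ee).
- by move=> /andP[cf cg] ee; rewrite (IHf s _ _ cf ee) (IHg s _ _ cg ee).
- by move=> /andP[cf cg] ee; rewrite (IHf s _ _ cf ee) (IHg s _ _ cg ee).
- by move=> /andP[cf cg] ee; rewrite (IHf s _ _ cf ee) (IHg s _ _ cg ee).
- by move=> cf ee; split=> h x; have := h x;
     apply IH with (i :: s) => //; apply: eq_in_cons => // j js; rewrite ee.
- by move=> cf ee; split=> -[x h]; exists x; move: h;
     apply IH with (i :: s) => //; apply: eq_in_cons => // j js; rewrite ee.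
Qed.

Lemma so_holds_coincide (K : Type) (R : pzRingType) phi (sK sR : seq nat)
    (sP : seq pvar) (eK eK' : nat -> K) (eR eR' : nat -> R)
    (eP eP' : forall p, relation_of K R p) :
  so_closed sK sR sP phi -> {in sK, eK =1 eK'} -> {in sR, eR =1 eR'} ->
  (forall p, p \in sP -> eP p = eP' p) ->
  so_holds eK eR eP phi <-> so_holds eK' eR' eP' phi.
Proof.
have dfP p (P : relation_of K R p) sP0 (d d' : forall p, relation_of K R p) :
    (forall q, q \in sP0 -> d q = d' q) ->
    forall q, q \in p :: sP0 -> eqtype.dfwith d P q = eqtype.dfwith d' P q.
  move=> dd q; rewrite inE; case: (eqVneq q p) => [-> _|qp /= /dd].
    by rewrite !dfwith_in.
  by rewrite !dfwith_out // eq_sym.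
elim: phi sK sR sP eK eK' eR eR' eP eP' => /=
  [x y z|x y z|x y|x y|p a r|f IH|f IHf g IHg|f IHf g IHg|f IHf g IHg
  |x f IH|x f IH|x f IH|x f IH|p f IH|p f IH] sK sR sP eK eK' eR eR' eP eP' cl hK hR hP.
- by case/and3P: cl => hx hy hz; rewrite !hR.
- by case/and3P: cl => hx hy hz; rewrite !hR.
- by case/andP: cl => hx hy; rewrite !hR.
- by case/andP: cl => hx hy; rewrite !hK.
- case/and3P: cl => hp /allP ha /allP hr; rewrite (hP _ hp).
  rewrite (_ : map_tuple eK a = map_tuple eK' a); last first.
    by apply: val_inj; apply/eq_in_map => x xa; apply: hK; exact: ha.
  rewrite (_ : map_tuple eR r = map_tuple eR' r) //.
  by apply: val_inj; apply/eq_in_map => x xr; apply: hR; exact: hr.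
- by rewrite (IH _ _ _ _ _ _ _ _ _ cl hK hR hP).
- by case/andP: cl => cf cg; rewrite (IHf _ _ _ _ _ _ _ _ _ cf hK hR hP)
    (IHg _ _ _ _ _ _ _ _ _ cg hK hR hP).
- by case/andP: cl => cf cg; rewrite (IHf _ _ _ _ _ _ _ _ _ cf hK hR hP)
    (IHg _ _ _ _ _ _ _ _ _ cg hK hR hP).
- by case/andP: cl => cf cg; rewrite (IHf _ _ _ _ _ _ _ _ _ cf hK hR hP)
    (IHg _ _ _ _ _ _ _ _ _ cg hK hR hP).
- have h u := IH _ _ _ _ _ _ _ _ _ cl (@eq_in_cons _ _ x u _ _ hK) hR hP.
  by split=> H u; apply/h.
- have h u := IH _ _ _ _ _ _ _ _ _ cl (@eq_in_cons _ _ x u _ _ hK) hR hP.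
  by split=> -[u H]; exists u; apply/h.
- have h u := IH _ _ _ _ _ _ _ _ _ cl hK (@eq_in_cons _ _ x u _ _ hR) hP.
  by split=> H u; apply/h.
- have h u := IH _ _ _ _ _ _ _ _ _ cl hK (@eq_in_cons _ _ x u _ _ hR) hP.
  by split=> -[u H]; exists u; apply/h.
- have h P := IH _ _ _ _ _ _ _ _ _ cl hK hR (dfP p P _ _ _ hP).
  by split=> H P Ps; apply/h; exact: H.
- have h P := IH _ _ _ _ _ _ _ _ _ cl hK hR (dfP p P _ _ _ hP).
  by split=> -[P [Ps H]]; exists P; split=> //; apply/h.
Qed.

Lemma Th2P (K : Type) (R : pzRingType) (k0 : K) phi : so_sentence phi ->
  forall eK eR eP, Th2 K R phi <-> @so_holds K R eK eR eP phi.
Proof.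
move=> sphi eK eR eP; split=> [[_]|h]; first exact.
split=> // eK' eR' eP'.
by apply: (so_holds_coincide (eK := eK) (eR := eR) (eP := eP) sphi _ _ _).1.
Qed.

Section Translation.

(* Variables below 20 are reserved for the parameters and for bound variables
   of fixed subformulas. *)
Definition code (x : nat + nat + pvar * nat) : nat := 20 + pickle x.
Definition vK (x : nat) : nat := code (inl (inl x)).
Definition vR (x : nat) : nat := code (inl (inr x)).
Definition vP (p : pvar) (j : nat) : nat := code (inr (p, j)).

Lemma code_inj : injective code.
Proof. by move=> x y /addnI /(pcan_inj pickleK). Qed.

Lemma code_ge x : (20 <= code x)%N. Proof. exact: leq_addr. Qed.

Lemma eq_vK x y : (vK x == vK y) = (x == y).
Proof. by rewrite (inj_eq code_inj). Qed.
Lemma eq_vR x y : (vR x == vR y) = (x == y).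
Proof. by rewrite (inj_eq code_inj). Qed.
Lemma eq_vP p q i j : (vP p i == vP q j) = (p == q) && (i == j).
Proof. by rewrite (inj_eq code_inj). Qed.
Lemma eq_vKR x y : (vK x == vR y) = false.
Proof. by rewrite (inj_eq code_inj). Qed.
Lemma eq_vRK x y : (vR x == vK y) = false.
Proof. by rewrite (inj_eq code_inj). Qed.
Lemma eq_vKP x p j : (vK x == vP p j) = false.
Proof. by rewrite (inj_eq code_inj). Qed.
Lemma eq_vPK x p j : (vP p j == vK x) = false.
Proof. by rewrite (inj_eq code_inj). Qed.
Lemma eq_vRP x p j : (vR x == vP p j) = false.
Proof. by rewrite (inj_eq code_inj). Qed.
Lemma eq_vPR x p j : (vP p j == vR x) = false.
Proof. by rewrite (inj_eq code_inj). Qed.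

Local Notation "''v' i" := (TVar i) (at level 8, i at level 2, format "''v' i").
Local Notation "t *t u" := (TMul t u) (at level 40, left associativity).
Local Notation "t =t u" := (FEq t u) (at level 70).

Definition f_inF i := FAnd ('v0 *t 'v i =t 'v i) ('v i *t 'v0 =t 'v i).

Definition f_inB i :=
  FAnd ('v i *t 'v0 =t 'v i) (FAnd ('v1 *t 'v i =t 'v0)
  (FAll 6 (FImp ('v6 *t 'v3 =t 'v3 *t 'v6) (FImp ('v6 *t 'v4 =t 'v4 *t 'v6)
    (FImp ('v6 *t 'v5 =t 'v5 *t 'v6)
    (FEx 7 (FAnd (f_inF 7)
      ('v6 *t ('v2 *t 'v i) =t 'v2 *t 'v i *t 'v7)))))))).

Definition f_good :=
  FAnd (FAnd (FNot ('v0 =t TZero)) (FAnd ('v0 *t 'v0 =t 'v0)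
    (FAll 8 (FImp ('v8 *t 'v8 =t 'v8) (FImp ('v0 *t 'v8 =t 'v8)
      (FImp ('v8 *t 'v0 =t 'v8) (FOr ('v8 =t TZero) ('v8 =t 'v0))))))))
  (FAnd (FAll 8 (FImp (f_inB 8) (FEx 9 (FAnd ('v9 *t 'v8 =t 'v8)
      (FAll 10 (FImp (f_inB 10) (FOr ('v10 =t 'v8) ('v9 *t 'v10 =t TZero))))))))
    (FAll 8 (FImp (FAll 9 (FImp (f_inB 9) (FEx 10 ('v9 =t 'v8 *t 'v10))))
      (FEx 9 ('v8 *t 'v9 =t TOne))))).

Definition f_all (l : seq ring_formula) := foldr FAnd (TZero =t TZero) l.

Definition psize (p : pvar) : nat := arity_set p + arity_ring p.

(** One variable more than the arity: [vP p 0] marks the basis vectors that index tuples. *)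
Definition pvars (p : pvar) : seq nat := map (vP p) (iota 0 (psize p).+1).

(** The factors of [SMul] are exchanged because the corner ring is opposite to F. In [SPred],
    variable 11 is the basis vector indexing the tuple. *)
Fixpoint tr (phi : so_formula) : ring_formula :=
  match phi with
  | SAdd x y z => 'v(vR x) =t TAdd 'v(vR y) 'v(vR z)
  | SMul x y z => 'v(vR x) =t 'v(vR z) *t 'v(vR y)
  | SEqRing x y => 'v(vR x) =t 'v(vR y)
  | SEqSet x y => 'v(vK x) =t 'v(vK y)
  | SPred p a r => FEx 11 (FAnd (f_inB 11) (FAnd ('v(vP p 0) *t 'v11 =t 'v0)
      (f_all [seq 'v(vP p j.+1) *t 'v11 =t 'v(nth 0%N (map vK a ++ map vR r) j)
             | j <- iota 0 (psize p)])))
  | SNot f => FNot (tr f)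
  | SAnd f g => FAnd (tr f) (tr g)
  | SOr f g => FOr (tr f) (tr g)
  | SImp f g => FImp (tr f) (tr g)
  | SAllSet x f => FAll (vK x) (FImp (f_inB (vK x)) (tr f))
  | SExSet x f => FEx (vK x) (FAnd (f_inB (vK x)) (tr f))
  | SAllRing x f => FAll (vR x) (FImp (f_inF (vR x)) (tr f))
  | SExRing x f => FEx (vR x) (FAnd (f_inF (vR x)) (tr f))
  | SAllPred p f => foldr FAll (tr f) (pvars p)
  | SExPred p f => foldr FEx (tr f) (pvars p)
  end.

Definition tr_sentence phi :=
  FEx 0 (FEx 1 (FEx 2 (FEx 3 (FEx 4 (FEx 5 (FAnd f_good (tr phi))))))).

Lemma f_all_closed s l : all (closed_formula s) l -> closed_formula s (f_all l).
Proof. by elim: l => //= f l IH /andP[-> /IH]. Qed.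

Lemma foldr_all_closed s l f :
  closed_formula (rev l ++ s) f -> closed_formula s (foldr FAll f l).
Proof. by elim: l s => //= i l IH s; rewrite rev_cons cat_rcons => /IH. Qed.

Lemma foldr_ex_closed s l f :
  closed_formula (rev l ++ s) f -> closed_formula s (foldr FEx f l).
Proof. by elim: l s => //= i l IH s; rewrite rev_cons cat_rcons => /IH. Qed.

Lemma f_inB_closed (s : seq nat) i : {subset iota 0 6 <= s} -> i \in s ->
  closed_formula s (f_inB i).
Proof.
move=> ps si; have p j : (j < 6)%N -> j \in s.
  by move=> j6; apply: ps; rewrite mem_iota.
by rewrite /= !inE si (p 0) // (p 1) // (p 2) // (p 3) // (p 4) // (p 5) // !orbT.
Qed.

Lemma tr_closed phi sK sR sP (s : seq nat) : so_closed sK sR sP phi ->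
  {subset iota 0 6 <= s} -> {subset map vK sK <= s} -> {subset map vR sR <= s} ->
  (forall p j, p \in sP -> (j <= psize p)%N -> vP p j \in s) ->
  closed_formula s (tr phi).
Proof.
have cons_sub (t : seq nat) i (s1 : seq nat) : {subset t <= s1} -> {subset t <= i :: s1}.
  by move=> ts j /ts; rewrite inE orbC => ->.
have in_vK (x : nat) (t s0 : seq nat) : {subset map vK t <= s0} -> x \in t -> vK x \in s0.
  by move=> h xt; apply: h; exact: map_f.
have in_vR (x : nat) (t s0 : seq nat) : {subset map vR t <= s0} -> x \in t -> vR x \in s0.
  by move=> h xt; apply: h; exact: map_f.
elim: phi sK sR sP s =>
  [x y z|x y z|x y|x y|p a r|f IH|f IHf g IHg|f IHf g IHg|f IHf g IHg
  |x f IH|x f IH|x f IH|x f IH|p f IH|p f IH] sK sR sP s cl h0 hK hR hP;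
  rewrite [tr _]/=; rewrite [so_closed _ _ _ _]/= in cl.
- by case/and3P: cl => hx hy hz; rewrite /= !(in_vR _ _ _ hR).
- by case/and3P: cl => hx hy hz; rewrite /= !(in_vR _ _ _ hR).
- by case/andP: cl => hx hy; rewrite /= !(in_vR _ _ _ hR).
- by case/andP: cl => hx hy; rewrite /= !(in_vK _ _ _ hK).
- case/and3P: cl => hp /allP ha /allP hr.
  apply/andP; split; first by apply: f_inB_closed; [exact: cons_sub | rewrite inE].
  apply/andP; split.
    by rewrite /= !inE (hP p 0) // (h0 0) // ?eqxx ?orbT.
  apply: f_all_closed; rewrite all_map; apply/allP => j.
  rewrite mem_iota add0n /= => jp; rewrite !inE (hP p) // orbT /=.
  have : nth 0%N (map vK a ++ map vR r) j \in map vK a ++ map vR r.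
    by apply: mem_nth; rewrite size_cat !size_map !size_tuple.
  rewrite mem_cat => /orP[] /mapP[x xa ->].
    by rewrite (in_vK _ _ _ hK) ?orbT //; exact: ha.
  by rewrite (in_vR _ _ _ hR) ?orbT //; exact: hr.
- exact: IH cl _ _ _ _.
- by case/andP: cl => cf cg; apply/andP; split; [exact: IHf cf _ _ _ _ | exact: IHg cg _ _ _ _].
- by case/andP: cl => cf cg; apply/andP; split; [exact: IHf cf _ _ _ _ | exact: IHg cg _ _ _ _].
- by case/andP: cl => cf cg; apply/andP; split; [exact: IHf cf _ _ _ _ | exact: IHg cg _ _ _ _].
- apply/andP; split; first by apply: f_inB_closed; [exact: cons_sub | rewrite inE eqxx].
  apply: (IH _ _ _ _ cl); [exact: cons_sub| |exact: cons_sub|].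
    by move=> j; rewrite /= !inE => /orP[->//|/hK ->]; rewrite orbT.
  by move=> p j ps jp; rewrite inE hP ?orbT.
- apply/andP; split; first by apply: f_inB_closed; [exact: cons_sub | rewrite inE eqxx].
  apply: (IH _ _ _ _ cl); [exact: cons_sub| |exact: cons_sub|].
    by move=> j; rewrite /= !inE => /orP[->//|/hK ->]; rewrite orbT.
  by move=> p j ps jp; rewrite inE hP ?orbT.
- apply/andP; split; first by rewrite /= !inE eqxx (h0 0) // ?orbT.
  apply: (IH _ _ _ _ cl); [exact: cons_sub|exact: cons_sub| |].
    by move=> j; rewrite /= !inE => /orP[->//|/hR ->]; rewrite orbT.
  by move=> p j ps jp; rewrite inE hP ?orbT.
- apply/andP; split; first by rewrite /= !inE eqxx (h0 0) // ?orbT.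
  apply: (IH _ _ _ _ cl); [exact: cons_sub|exact: cons_sub| |].
    by move=> j; rewrite /= !inE => /orP[->//|/hR ->]; rewrite orbT.
  by move=> p j ps jp; rewrite inE hP ?orbT.
- apply: (@foldr_all_closed _ (pvars p)); apply: (IH _ _ _ _ cl).
  + by move=> j /h0 js; rewrite mem_cat; apply/orP; right.
  + by move=> j /hK js; rewrite mem_cat; apply/orP; right.
  + by move=> j /hR js; rewrite mem_cat; apply/orP; right.
  move=> q j; rewrite inE mem_cat mem_rev => /orP[/eqP -> jp|qs jp].
    by rewrite map_f // mem_iota.
  by rewrite hP ?orbT.
- apply: (@foldr_ex_closed _ (pvars p)); apply: (IH _ _ _ _ cl).
  + by move=> j /h0 js; rewrite mem_cat; apply/orP; right.
  + by move=> j /hK js; rewrite mem_cat; apply/orP; right.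
  + by move=> j /hR js; rewrite mem_cat; apply/orP; right.
  move=> q j; rewrite inE mem_cat mem_rev => /orP[/eqP -> jp|qs jp].
    by rewrite map_f // mem_iota.
  by rewrite hP ?orbT.
Qed.

Lemma tr_sentence_closed phi : so_sentence phi -> ring_sentence (tr_sentence phi).
Proof.
move=> sphi; rewrite /ring_sentence.
have c0 : closed_formula [:: 5; 4; 3; 2; 1; 0] (tr phi).
  apply: (tr_closed sphi) => // x.
  by rewrite -[[:: 5; 4; 3; 2; 1; 0]]/(rev (iota 0 6)) mem_rev.
by apply/andP; split=> //.
Qed.

Section Semantics.
Variable R : pzRingType.
Implicit Types e : nat -> R.

Lemma f_inBP e i : i != 6 -> i != 7 ->
  ring_holds e (f_inB i) <-> inB e (e i).
Proof.
move=> /negPf i6 /negPf i7; rewrite /f_inB /= i6 i7 /inB; split.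
  move=> [h1 [h2 h3]]; split=> // g g1 g2 g3.
  by have [r [[r1 r2] r3]] := h3 g g1 g2 g3; exists r.
move=> [h1 h2 h3]; split=> //; split=> // g g1 g2 g3.
by have [r [r1 r2 r3]] := h3 g g1 g2 g3; exists r.
Qed.

Lemma f_goodP e : ring_holds e f_good <-> good e.
Proof.
have B8 x : ring_holds [eta e with 8%N |-> x] (f_inB 8) <-> inB e x.
  exact: (@f_inBP [eta e with 8%N |-> x] 8).
have B9 h x : ring_holds [eta [eta e with 8%N |-> h] with 9%N |-> x] (f_inB 9)
    <-> inB e x.
  exact: (@f_inBP [eta [eta e with 8%N |-> h] with 9%N |-> x] 9).
have B10 h g x : ring_holds
    [eta [eta [eta e with 8%N |-> h] with 9%N |-> g] with 10%N |-> x] (f_inB 10)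
    <-> inB e x.
  exact: (@f_inBP [eta [eta [eta e with 8%N |-> h] with 9%N |-> g] with 10%N |-> x] 10).
split.
  move=> [[h1 [h2 h3]] [h4 h5]]; split=> //.
  - move=> x /B8 /h4[g [gx gy]]; exists g; split=> // y yB.
    exact/gy/B10.
  - by move=> h hB; apply: (h5 h) => x /B9; exact: hB.
move=> [[h1 h2 h3] h4 h5]; split; first by split.
split.
  move=> x /B8 /h4[g [gx gy]]; exists g; split=> // y /B10.
  exact: gy.
by move=> h hB; apply: h5 => x xB; apply: (hB x); exact/B9.
Qed.

End Semantics.
End Translation.

Section Override.
Variable R : pzRingType.

Definition over (e : nat -> R) (l : seq nat) (c : nat -> R) : nat -> R :=
  fun i => if i \in l then c i else e i.

Lemma over_cons e i l c : over [eta e with i |-> c i] l c = over e (i :: l) c.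
Proof.
apply: funext => j; rewrite /over inE /=.
by case: (j \in l); rewrite ?orbT // orbF; case: eqP => // ->.
Qed.

Lemma over_update e i l x c : over [eta e with i |-> x] l c =
  over e (i :: l) (fun j => if j \in l then c j else x).
Proof.
apply: funext => j; rewrite /over inE /=.
by case: (j \in l); rewrite ?orbT // orbF.
Qed.

Lemma over_nil e c : over e [::] c = e. Proof. exact: funext. Qed.

Lemma foldr_allP l f e : ring_holds e (foldr FAll f l) <->
  forall c, ring_holds (over e l c) f.
Proof.
elim: l e => [|i l IH] e /=.
  by split=> [h c|/(_ e)]; rewrite over_nil.
split=> [h c|h x].
  by rewrite -over_cons; apply: (IH _).1; exact: h.
by apply/IH => c; rewrite over_update; exact: h.
Qed.

Lemma foldr_exP l f e : ring_holds e (foldr FEx f l) <->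
  exists c, ring_holds (over e l c) f.
Proof.
elim: l e => [|i l IH] e /=.
  by split=> [h|[c]]; [exists e|]; rewrite over_nil.
split=> [[x /IH[c]]|[c]].
  by rewrite over_update => h; eexists; exact: h.
by rewrite -over_cons => h; exists (c i); apply/IH; exists c.
Qed.

Lemma f_all_mapP (T : eqType) (g : T -> ring_formula) s (e : nat -> R) :
  ring_holds e (f_all (map g s)) <-> forall x, x \in s -> ring_holds e (g x).
Proof.
elim: s => [|x s IH] /=; first by split.
split=> [[gx /IH gs] y|h].
  by rewrite inE => /orP[/eqP ->//|]; exact: gs.
split; first by apply: h; rewrite mem_head.
by apply/IH => y ys; apply: h; rewrite inE ys orbT.
Qed.

End Override.

(** * Correctness of the translation for a fixed basis *)

Section Interpretation.
Variables (F : nzRingType) (K : choiceType) (V : lmodType F).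
Variables (env : nat -> End V) (b : K -> V) (u : V) (c : V -> F).
Hypothesis infK : infinite_set [set: K].
Hypothesis cl : forall a v w, c (a *: v + w) = a * c v + c w.
Hypothesis b_indep : lin_independent b.
Hypothesis b_gen : generating b.
Hypothesis cu : c u = 1.
Hypothesis env0 : env 0 = rank1 cl u.
Hypothesis inB_env : forall x, inB env x <-> exists k, x = rank1 cl (b k).

Definition xi (k : K) : End V := rank1 cl (b k).
(** The scalar multiplies the coordinate on the right, which keeps the map left linear and makes
    [rho] reverse products. *)
Definition rho (r : F) : End V := rank1 (linf_mulr r cl) u.

Lemma b_inj : injective b.
Proof.
move=> i j /(congr1 (fun v => cf b_gen v i)); rewrite !cf_b // eqxx.
by case: eqVneq => // _ /eqP; rewrite oner_eq0.
Qed.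

Lemma xi_u k : xi k u = b k. Proof. by rewrite rank1E cu scale1r. Qed.
Lemma rho_u r : rho r u = r *: u. Proof. by rewrite rank1E cu mul1r. Qed.

Lemma xi_inj : injective xi.
Proof. by move=> i j /(congr1 (fun f : End V => f u)); rewrite !xi_u => /b_inj. Qed.

Lemma rho_inj : injective rho.
Proof.
move=> r s /(congr1 (fun f : End V => c (f u))).
by rewrite !rho_u !(linfZ cl) cu !mulr1.
Qed.

Lemma rhoD r s : rho (r + s) = rho r + rho s.
Proof. by apply: EndP => v; rewrite EndD !rank1E mulrDr scalerDl. Qed.

Lemma rhoM r s : rho (r * s) = rho s * rho r.
Proof. by apply: EndP => v; rewrite EndM !rank1E (linfZ cl) cu mulr1 mulrA. Qed.

Lemma inFP x : env 0 * x = x /\ x * env 0 = x <-> exists r, x = rho r.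
Proof.
split=> [[ex xe]|[r ->]].
  exists (c (x u)); apply: EndP => v; rewrite rank1E -[x in LHS]xe EndM env0.
  by rewrite rank1E linearZZ -[x in LHS]ex EndM env0 rank1E scalerA.
by split; apply: EndP => v; rewrite EndM env0 !rank1E (linfZ cl) cu mulr1.
Qed.

Definition listing {p : pvar}
    (q : (arity_set p).-tuple K * (arity_ring p).-tuple F) : seq (End V) :=
  map xi q.1 ++ map rho q.2.

Lemma size_listing p q : size (@listing p q) = psize p.
Proof. by rewrite size_cat !size_map !size_tuple. Qed.

Lemma listing_inj p : injective (@listing p).
Proof.
move=> [a r] [a' r'] /eqP; rewrite eqseq_cat /= ?size_map ?size_tuple //.
move=> /andP[/eqP /(inj_map xi_inj) /val_inj -> /eqP /(inj_map rho_inj)].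
by move=> /val_inj ->.
Qed.

(* The relation coded by [d 0, .., d (k + n)]: its elements are indexed by the
   basis vectors that [d 0] sends to u, and the other maps give their
   coordinates. *)
Definition decode (p : pvar) (d : nat -> End V) : relation_of K F p :=
  [set q | exists t, d 0 * xi t = env 0 /\
     forall j, (j < psize p)%N -> d j.+1 * xi t = nth 0 (listing q) j].

Arguments decode p d : clear implicits.

Lemma decode_ext p d d' : (forall j, (j <= psize p)%N -> d j = d' j) ->
  decode p d = decode p d'.
Proof.
move=> dd; apply/seteqP; split=> q [t [t0 tj]]; exists t; split.
- by rewrite -dd.
- by move=> j jp; rewrite -dd // tj.
- by rewrite dd.
- by move=> j jp; rewrite dd // tj.
Qed.

(** A tuple is determined by any basis index that witnesses it. *)
Lemma decode_small p d : decode p d #<= [set: K].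
Proof.
have [k0 _] := infinite_setN0 infK.
apply: emb_card_le; pose idx q t := d 0 * xi t = env 0 /\
     forall j, (j < psize p)%N -> d j.+1 * xi t = nth 0 (@listing p q) j.
have [f fP] : {f : _ -> K & forall q, decode p d q -> idx q (f q)}.
  apply: (@choice _ _ (fun q t => decode p d q -> idx q t)) => q.
  case: (pselect (decode p d q)) => [[t ht]|nq]; first by exists t.
  by exists k0.
exists f; split=> // q q' /fP[_ hq] /fP[_ hq'] ff.
apply: listing_inj; apply: (@eq_from_nth _ 0); first by rewrite !size_listing.
by move=> j; rewrite size_listing => jp; rewrite -hq // -hq' // ff.
Qed.

(** An injection [f] of [P] into [K] gives each tuple its own basis index; the coordinate maps are
    then prescribed freely on the basis, and the map with values [dom] marks the range of [f]. *)
Lemma decode_surj p (P : relation_of K F p) : P #<= [set: K] ->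
  exists d, decode p d = P.
Proof.
have [k0 _] := infinite_setN0 infK.
move=> /(card_le_emb k0)[f [_ fi]].
pose val_at (j : nat) (t : K) : V :=
  if pselect (exists2 q, P q & f q = t) is left h
  then (nth 0 (listing (s2val (cid2 h))) j) u else 0.
pose dom (t : K) : V := if pselect (exists2 q, P q & f q = t) then u else 0.
exists (fun j => if j is j'.+1 then ext b_indep b_gen (val_at j')
                 else ext b_indep b_gen dom).
have valE j q t : P q -> f q = t -> val_at j t = (nth 0 (listing q) j) u.
  move=> Pq fq; rewrite /val_at; case: pselect => [h|[]]; last by exists q.
  by case: cid2 => q' Pq' /= fq'; rewrite (fi q' q) // fq fq'.
have listE p' q j v : (nth 0 (@listing p' q) j) v = c v *: (nth 0 (listing q) j) u.
  case: (ltnP j (psize p')) => jp; last first.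
    by rewrite !nth_default ?size_listing // End0 scaler0.
  have : nth 0 (listing q) j \in listing q by apply: mem_nth; rewrite size_listing.
  rewrite mem_cat => /orP[] /mapP[x _ ->]; first by rewrite xi_u rank1E.
  by rewrite rho_u rank1E scalerA.
have u0 : u <> 0.
  move=> u0; move/eqP: cu; rewrite u0 (linf0 cl) eq_sym; apply/negP.
  exact: oner_neq0.
apply/seteqP; split=> q.
  move=> [t [t0 tj]].
  have [q' Pq' fq'] : exists2 q, P q & f q = t.
    have := congr1 (fun g : End V => g u) t0.
    rewrite EndM xi_u ext_b env0 rank1E cu scale1r /dom.
    by case: pselect => // _ /esym.
  suff -> : q = q' by [].
  apply: listing_inj; apply: (@eq_from_nth _ 0); first by rewrite !size_listing.
  move=> j; rewrite size_listing => jp; rewrite -tj //.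
  apply: EndP => v; rewrite listE EndM rank1E linearZZ ext_b.
  by rewrite (valE _ _ _ Pq' fq').
move=> Pq; exists (f q); split.
  apply: EndP => v; rewrite EndM rank1E linearZZ ext_b env0 rank1E /dom.
  by case: pselect => // -[]; exists q.
move=> j jp; apply: EndP => v; rewrite listE EndM rank1E linearZZ ext_b.
by rewrite (valE _ q).
Qed.

Lemma inB_agree (e : nat -> End V) x : (forall i, (i < 6)%N -> e i = env i) ->
  inB e x <-> inB env x.
Proof.
move=> ee; rewrite /inB (ee 0%N) // (ee 1%N) // (ee 2%N) // (ee 3%N) //.
by rewrite (ee 4%N) // (ee 5%N).
Qed.

Definition respects (eK : nat -> K) (eR : nat -> F)
    (eP : forall p, relation_of K F p) (e : nat -> End V) :=
  [/\ forall i, (i < 6)%N -> e i = env i,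
      forall x, e (vK x) = xi (eK x), forall x, e (vR x) = rho (eR x) &
      forall p, eP p = decode p (fun j => e (vP p j))].

Let code_ge6 x i : (i < 6)%N -> (i == code x) = false.
Proof.
move=> i6; apply/negbTE; rewrite neq_ltn; apply/orP; left.
by apply: leq_trans (code_ge x); apply: leq_trans i6 _.
Qed.

Lemma respects_set eK eR eP e x k : respects eK eR eP e ->
  respects [eta eK with x |-> k] eR eP [eta e with vK x |-> xi k].
Proof.
move=> [h0 hK hR hP]; split=> [i i6|y|y|p] /=.
- by rewrite /vK code_ge6 // h0.
- by rewrite eq_vK; case: eqP.
- by rewrite eq_vRK.
- by rewrite hP; apply: decode_ext => j _; rewrite eq_vPK.
Qed.

Lemma respects_ring eK eR eP e x r : respects eK eR eP e ->
  respects eK [eta eR with x |-> r] eP [eta e with vR x |-> rho r].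
Proof.
move=> [h0 hK hR hP]; split=> [i i6|y|y|p] /=.
- by rewrite /vR code_ge6 // h0.
- by rewrite eq_vKR.
- by rewrite eq_vR; case: eqP.
- by rewrite hP; apply: decode_ext => j _; rewrite eq_vPR.
Qed.

Lemma mem_pvars p q j : (vP q j \in pvars p) = (q == p) && (j <= psize p)%N.
Proof.
apply/mapP/andP => [[i + /eqP]|[/eqP -> jp]].
  by rewrite mem_iota /= add0n ltnS eq_vP => ip /andP[/eqP -> /eqP ->].
by exists j => //; rewrite mem_iota.
Qed.

Lemma respects_pred eK eR eP e p d : respects eK eR eP e ->
  respects eK eR (eqtype.dfwith eP (decode p (fun j => d (vP p j))))
    (over e (pvars p) d).
Proof.
have npv i : (forall j, i != vP p j) -> i \notin pvars p.
  by move=> h; apply/mapP => -[j _ /eqP]; rewrite (negPf (h j)).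
move=> [h0 hK hR hP]; split=> [i i6|y|y|q].
- rewrite /over (negPf (npv _ _)) ?h0 // => j.
  by rewrite /vP code_ge6.
- by rewrite /over (negPf (npv _ _)) ?hK // => j; rewrite eq_vKP.
- by rewrite /over (negPf (npv _ _)) ?hR // => j; rewrite eq_vRP.
- case: (eqVneq p q) => [<-|pq].
    rewrite dfwith_in; apply: decode_ext => j jp.
    by rewrite /over mem_pvars eqxx jp.
  rewrite dfwith_out // hP; apply: decode_ext => j _.
  by rewrite /over mem_pvars eq_sym (negPf pq).
Qed.

Lemma pvars_values p (d : nat -> End V) : exists d' : nat -> End V,
  forall j, (j <= psize p)%N -> d' (vP p j) = d j.
Proof.
exists (fun i => d (index i (pvars p))) => j jp.
rewrite index_map; last by move=> i i' /eqP; rewrite eq_vP eqxx => /eqP.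
by congr d; rewrite -[j in index j _](@nth_iota 0 0 (psize p).+1 j) //
  index_uniq ?iota_uniq ?size_iota.
Qed.

Lemma tr_pred_correct p (a : (arity_set p).-tuple nat)
    (r : (arity_ring p).-tuple nat) eK eR eP e : respects eK eR eP e ->
  ring_holds e (tr (@SPred p a r)) <-> so_holds eK eR eP (@SPred p a r).
Proof.
move=> [h0 hK hR hP]; rewrite [so_holds _ _ _ _]/= hP.
have lE j : (j < psize p)%N -> e (nth 0%N (map vK a ++ map vR r) j) =
    nth 0 (@listing p (map_tuple eK a, map_tuple eR r)) j.
  move=> jp; rewrite -(nth_map 0%N 0 e); last first.
    by rewrite size_cat !size_map !size_tuple.
  rewrite map_cat /listing /= -!map_comp; congr (nth 0 (_ ++ _) j).
    by apply: eq_map => x; exact: hK.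
  by apply: eq_map => x; exact: hR.
have code11 x : (code x == 11) = false.
  apply/negbTE; rewrite neq_ltn (@leq_trans 20 11.+1 _ isT (code_ge _)) ?orbT //.
have pne j : (vP p j == 11) = false by exact: code11.
have lge j : (j < psize p)%N ->
    (nth 0%N (map vK a ++ map vR r) j == 11) = false.
  move=> jp; have : nth 0%N (map vK a ++ map vR r) j \in map vK a ++ map vR r.
    by apply: mem_nth; rewrite size_cat !size_map !size_tuple.
  by rewrite mem_cat => /orP[] /mapP[x _ ->]; exact: code11.
have inB11 x : ring_holds [eta e with 11%N |-> x] (f_inB 11) <-> exists t, x = xi t.
  rewrite (@f_inBP _ [eta e with 11%N |-> x] 11) //.
  rewrite inB_agree; first exact: inB_env.
  by move=> i i6; rewrite -h0 //; move: i i6; do 6 case=> //.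
split=> [[x [/inB11[t xt] [x0 /f_all_mapP xj]]]|[t [t0 tj]]].
  exists t; split; first by move: x0; rewrite /= xt (h0 0).
  move=> j jp; have := xj j; rewrite mem_iota /= => /(_ jp).
  by rewrite ?pne lge // xt lE.
exists (xi t); split; first by apply/inB11; exists t.
split; first by rewrite /= (h0 0).
apply/f_all_mapP => j; rewrite mem_iota add0n /= => jp.
by rewrite ?pne lge // lE // tj.
Qed.

Lemma respects_inB eK eR eP e x y : respects eK eR eP e ->
  ring_holds [eta e with vK x |-> y] (f_inB (vK x)) <-> exists k, y = xi k.
Proof.
move=> [h0 _ _ _]; have ne n : (n < 20)%N -> vK x != n.
  by move=> n20; rewrite neq_ltn (leq_trans n20 (code_ge _)) orbT.
rewrite f_inBP ?ne // inB_agree /= ?eqxx; first exact: inB_env.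
by move=> i i6; rewrite /vK code_ge6 // h0.
Qed.

Lemma respects_inF eK eR eP e x y : respects eK eR eP e ->
  ring_holds [eta e with vR x |-> y] (f_inF (vR x)) <-> exists r, y = rho r.
Proof.
by move=> [h0 _ _ _]; rewrite /= eqxx (h0 0) //; exact: inFP.
Qed.

Lemma respects_pred_surj eK eR eP e p P : respects eK eR eP e ->
  P #<= [set: K] -> exists d, respects eK eR (@eqtype.dfwith _ _ eP p P) (over e (pvars p) d).
Proof.
move=> H /decode_surj[d dP]; have [d' d'd] := pvars_values p d.
exists d'; rewrite -dP (_ : decode p d = decode p (fun j => d' (vP p j))).
  exact: respects_pred.
by apply: decode_ext => j jp; rewrite d'd.
Qed.

Lemma tr_correct phi eK eR eP e : respects eK eR eP e ->
  ring_holds e (tr phi) <-> so_holds eK eR eP phi.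
Proof.
elim: phi eK eR eP e =>
  [x y z|x y z|x y|x y|p a r|f IH|f IHf g IHg|f IHf g IHg|f IHf g IHg
  |x f IH|x f IH|x f IH|x f IH|p f IH|p f IH] eK eR eP e H;
  have [h0 hK hR hP] := H.
- by rewrite /= !hR -rhoD; split=> [/rho_inj //|-> //].
- by rewrite /= !hR -rhoM; split=> [/rho_inj //|-> //].
- by rewrite /= !hR; split=> [/rho_inj //|-> //].
- by rewrite /= !hK; split=> [/xi_inj //|-> //].
- exact: tr_pred_correct.
- by rewrite /= (IH _ _ _ _ H).
- by rewrite /= (IHf _ _ _ _ H) (IHg _ _ _ _ H).
- by rewrite /= (IHf _ _ _ _ H) (IHg _ _ _ _ H).
- by rewrite /= (IHf _ _ _ _ H) (IHg _ _ _ _ H).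
- split=> [h k|h y].
    apply/(IH _ _ _ _ (respects_set x k H)); apply: h.
    by apply/(respects_inB x _ H); exists k.
  move=> /(respects_inB x _ H)[k ->]; apply/(IH _ _ _ _ (respects_set x k H)).
  exact: h.
- split=> [[y [/(respects_inB x _ H)[k ->] h]]|[k h]].
    by exists k; apply/(IH _ _ _ _ (respects_set x k H)).
  exists (xi k); split; first by apply/(respects_inB x _ H); exists k.
  exact/(IH _ _ _ _ (respects_set x k H)).
- split=> [h r|h y].
    apply/(IH _ _ _ _ (respects_ring x r H)); apply: h.
    by apply/(respects_inF x _ H); exists r.
  move=> /(respects_inF x _ H)[r ->]; apply/(IH _ _ _ _ (respects_ring x r H)).
  exact: h.
- split=> [[y [/(respects_inF x _ H)[r ->] h]]|[r h]].
    by exists r; apply/(IH _ _ _ _ (respects_ring x r H)).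
  exists (rho r); split; first by apply/(respects_inF x _ H); exists r.
  exact/(IH _ _ _ _ (respects_ring x r H)).
- rewrite -[tr _]/(foldr FAll (tr f) (pvars p)) foldr_allP; split=> [h P Ps|h d].
    have [d Hd] := respects_pred_surj H Ps.
    by apply/(IH _ _ _ _ Hd); exact: h.
  apply/(IH _ _ _ _ (respects_pred p d H)); apply: h.
  exact: decode_small.
- rewrite -[tr _]/(foldr FEx (tr f) (pvars p)) foldr_exP; split=> [[d h]|[P [Ps h]]].
    exists (decode p (fun j => d (vP p j))); split; first exact: decode_small.
    exact/(IH _ _ _ _ (respects_pred p d H)).
  have [d Hd] := respects_pred_surj H Ps.
  by exists d; apply/(IH _ _ _ _ Hd).
Qed.

End Interpretation.

Theorem tr_sentence_correct (F : nzRingType) (K : choiceType) (V : lmodType F)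
    phi : is_left_pid F -> infinite_set [set: K] -> free_of_rank K V ->
  so_sentence phi ->
  ring_true (End V) (tr_sentence phi) <-> Th2 K F phi.
Proof.
move=> pidF infK freeV sphi; have [k0 _] := infinite_setN0 infK.
have params (e : nat -> End V) : ring_holds e (tr_sentence phi) <->
    exists env : nat -> End V, good env /\ ring_holds env (tr phi).
  have coin := tr_closed (s := iota 0 6) sphi _ _ _ _.
  split=> [[x0 [x1 [x2 [x3 [x4 [x5 [h1 h2]]]]]]]|[env [genv h]]].
    pose e' : nat -> End V := [eta [eta [eta [eta [eta [eta e with 0%N |-> x0]
      with 1%N |-> x1] with 2%N |-> x2] with 3%N |-> x3] with 4%N |-> x4]
      with 5%N |-> x5].
    by exists e'; split; [exact: (proj1 (@f_goodP (End V) e') h1) | exact: h2].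
  exists (env 0), (env 1), (env 2), (env 3), (env 4), (env 5).
  have ag : {in iota 0 6, env =1 [eta [eta [eta [eta [eta [eta e with 0%N |-> env 0]
     with 1%N |-> env 1] with 2%N |-> env 2] with 3%N |-> env 3]
     with 4%N |-> env 4] with 5%N |-> env 5]}.
    by move=> i; rewrite mem_iota /=; move: i; do 6 case=> //.
  split; first by apply/f_goodP.
  apply: (ring_holds_coincide _ ag).1 h; apply: coin => //.
(* Every good tuple decides [phi] correctly, so the existential block is harmless once one good
   tuple exists. *)
have correct (env : nat -> End V) : good env ->
    ring_holds env (tr phi) <-> Th2 K F phi.
  move=> genv; have [b [u [c [cl [bi bg cu env0 inBE]]]]] :=
    good_frame pidF infK freeV genv.
  (* A dummy valuation beyond the parameters: set variables denote [k0], ring variables 0, and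
     relations are decoded from zero maps. *)
  pose e n : End V := if (n < 6)%N then env n else
    match unpickle (n - 20) : option (nat + nat + pvar * nat) with
    | Some (inl (inl _)) => xi b cl k0
    | Some (inl (inr _)) => rho u cl 0
    | _ => 0
    end.
  have eK x : e (vK x) = xi b cl k0.
    rewrite /e (_ : (vK x < 6)%N = false) /vK.
      by rewrite /code addKn pickleK.
    by rewrite ltnNge (@leq_trans 20 6 _ isT (code_ge _)).
  have eR x : e (vR x) = rho u cl 0.
    rewrite /e (_ : (vR x < 6)%N = false) /vR.
      by rewrite /code addKn pickleK.
    by rewrite ltnNge (@leq_trans 20 6 _ isT (code_ge _)).
  pose eP p := @decode F K V env b u c cl p (fun j => e (vP p j)).
  have H : respects env b u cl (fun=> k0) (fun=> 0) eP e.
    by split=> // i i6; rewrite /e i6.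
  rewrite (Th2P k0 sphi (fun=> k0) (fun=> 0) eP).
  rewrite -(tr_correct infK bi bg cu env0 inBE phi H).
  apply: (ring_holds_coincide (s := iota 0 6)); first by apply: tr_closed sphi _ _ _ _.
  by move=> i; rewrite mem_iota /= add0n /e => ->.
split=> [h|h e].
  have /params[env [genv henv]] := h (fun=> 0).
  exact/(correct env).
have [b [bi bg]] := freeV.
have [env genv] := good_exists pidF infK bi bg.
by apply/params; exists env; split=> //; apply/correct.
Qed.

(** * From ring formulas to second-order formulas *)

Definition at10 i x : so_formula := @SPred (1, 0, i)%N [tuple x] [tuple].
Definition at20 i x y : so_formula := @SPred (2, 0, i)%N [tuple x; y] [tuple].
Definition at11 i x r : so_formula := @SPred (1, 1, i)%N [tuple x] [tuple r].
Definition at21 i x y r : so_formula := @SPred (2, 1, i)%N [tuple x; y] [tuple r].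
Arguments at10 : simpl never.
Arguments at20 : simpl never.
Arguments at11 : simpl never.
Arguments at21 : simpl never.

Section Atoms.
Variables (K : Type) (R : pzRingType) (eK : nat -> K) (eR : nat -> R).
Lemma at11E (eP : forall p, relation_of K R p) i x r : so_holds eK eR eP (at11 i x r) =
  eP (1, 1, i)%N ([tuple eK x], [tuple eR r]).
Proof. by rewrite /=; congr (eP _ (_, _)); exact: val_inj. Qed.

Lemma at21E (eP : forall p, relation_of K R p) i x y r : so_holds eK eR eP (at21 i x y r) =
  eP (2, 1, i)%N ([tuple eK x; eK y], [tuple eR r]).
Proof. by rewrite /=; congr (eP _ (_, _)); exact: val_inj. Qed.

End Atoms.

Definition s_iff f g := SAnd (SImp f g) (SImp g f).

(* Relation (1,1,0) is a function a from K to the ring; the formula says that a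
   has finite support with sum r_z: some orbit o, s(o), s(s(o)), .. reaches w
   through the support of a, and the partial sums along it end in r_z. *)
Definition f_sum (z : nat) : so_formula :=
  SExPred (2, 0, 0)%N (SExPred (1, 1, 1)%N (SExSet 3 (SExSet 4
  (SAnd (SAllSet 5 (SExSet 6 (at20 0 5 6)))
  (SAnd (SAllSet 5 (SAllSet 6 (SAllSet 7
           (SImp (at20 0 5 6) (SImp (at20 0 5 7) (SEqSet 6 7))))))
  (SAnd (SExRing 3 (SAnd (at11 0 4 3) (SAdd 3 3 3)))
  (SAnd (SExRing 3 (SAnd (at11 1 3 3) (SAdd 3 3 3)))
  (SAnd (SAllSet 5 (SAllRing 3 (SAllRing 4
           (SImp (at11 1 5 3) (SImp (at11 1 5 4) (SEqRing 3 4))))))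
  (SAnd (SAllSet 5 (SAllSet 6 (SAllRing 3 (SAllRing 4
           (SImp (SNot (SEqSet 5 4)) (SImp (at20 0 5 6) (SImp (at11 1 5 3)
           (SImp (at11 0 5 4) (SExRing 5 (SAnd (SAdd 5 3 4) (at11 1 6 5)))))))))))
  (SAnd (at11 1 4 z)
  (SAllPred (1, 0, 0)%N (SImp (at10 0 3)
     (SImp (SAllSet 5 (SAllSet 6 (SImp (at10 0 5) (SImp (SNot (SEqSet 5 4))
              (SImp (at20 0 5 6) (at10 0 6))))))
       (SAnd (at10 0 4) (SAllSet 5 (SAllRing 3 (SImp (at11 0 5 3)
          (SImp (SNot (SAdd 3 3 3)) (at10 0 5))))))))))))))))))).

Lemma addrr_eq0 (R : pzRingType) (r : R) : r = r + r <-> r = 0.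
Proof.
split=> [h|->]; last by rewrite addr0.
by apply: (@addrI _ r); rewrite -h addr0.
Qed.

(** Before the first visit of [w] the points are distinct: if steps [i < j] agreed, cutting out the
    loop would reach [w] after [n - j + i] steps. *)
Lemma orbit_until (K : eqType) (s : K -> K) o w :
  (exists n, iter n s o = w) -> exists n, [/\ iter n s o = w,
    uniq [seq iter i s o | i <- iota 0 n] &
    forall i, (i < n)%N -> iter i s o <> w].
Proof.
move=> ex; have ex' : exists n, iter n s o == w by have [n <-] := ex; exists n.
have := ex_minnP ex' => -[n /eqP nw nmin].
have ni i : (i < n)%N -> iter i s o <> w.
  by move=> i_n iw; have := nmin i; rewrite iw eqxx leqNgt i_n => /(_ isT).
exists n; split=> //; rewrite map_inj_in_uniq ?iota_uniq // => i j.
wlog ij : i j / (i <= j)%N.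
  move=> h hi hj e; case: (leqP i j) => [|/ltnW] ij; first exact: h.
  by apply/esym; apply: h.
rewrite !mem_iota /= !add0n => i_n j_n e.
move: ij; rewrite leq_eqVlt => /orP[/eqP //|ij].
case: (ni (n - j + i)%N).
  by rewrite -[X in (_ < X)%N](subnK (ltnW j_n)) ltn_add2l.
by rewrite iterD e -iterD subnK // ltnW.
Qed.

Lemma map_tuple0 (T U : Type) (f : T -> U) (t : 0.-tuple T) :
  map_tuple f t = [tuple].
Proof. exact: val_inj (congr1 val (tuple0 _)). Qed.

Lemma map_tuple1 (T U : Type) (f : T -> U) x :
  map_tuple f [tuple x] = [tuple f x].
Proof. exact: val_inj. Qed.

Lemma map_tuple2 (T U : Type) (f : T -> U) x y :
  map_tuple f [tuple x; y] = [tuple f x; f y].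
Proof. exact: val_inj. Qed.

Section SumSemantics.
Variables (K : choiceType) (F : pzRingType).
Hypothesis infK : infinite_set [set: K].

Definition sums_to (f : K -> F) (z : F) := exists s : seq K,
  [/\ uniq s, forall k, k \notin s -> f k = 0 & z = \sum_(k <- s) f k].

(** The set coordinates determine the tuple, and finite sequences over [K] embed in [K]. *)
Lemma functional_small p (P : relation_of K F p) :
  (forall a r r', P (a, r) -> P (a, r') -> r = r') -> P #<= [set: K].
Proof.
move=> Pf; have [h hi] := inj_seq infK.
apply: emb_card_le; exists (fun q => h (val q.1)); split=> //.
move=> [a r] [a' r'] Pa Pa' /hi /val_inj /= e; subst a'.
by rewrite (Pf _ _ _ Pa Pa').
Qed.

Lemma set_small i (P : relation_of K F (1, 0, i)%N) : P #<= [set: K].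
Proof.
by apply: functional_small => a r r' _ _; rewrite (tuple0 r) (tuple0 r').
Qed.

Let eval_tuples := (@map_tuple2, @map_tuple1, @map_tuple0).

Local Ltac ev :=
  rewrite ?eval_tuples /=;
  do ?[rewrite dfwith_in | rewrite dfwith_out; last by []].

Lemma f_sumP eK eR (eP : forall p, relation_of K F p) z (f : K -> F) :
  (forall k r, eP (1, 1, 0)%N ([tuple k], [tuple r]) <-> r = f k) ->
  so_holds eK eR eP (f_sum z) <-> sums_to f (eR z).
Proof.
move=> eA; rewrite /f_sum [so_holds _ _ _ _]/=.
split.
  move=> [S [_ [T [_ [o [w]]]]]].
  move=> [S1 [S2 [A1 [T1 [T2 [T3 [T4 X]]]]]]].
  pose s2 x y := S ([tuple x; y], [tuple]).
  pose t2 x r := T ([tuple x], [tuple r]).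
  have {}S1 x : exists y, s2 x y by have [y] := S1 x; ev => ?; exists y.
  have {}S2 x y y' : s2 x y -> s2 x y' -> y = y'.
    by move=> h1 h2; have := S2 x y y'; ev; exact.
  have {A1} fw : f w = 0.
    by have [r [+ /addrr_eq0 r0]] := A1; ev => /eA <-.
  have {}T1 : t2 o 0.
    by have [r [+ /addrr_eq0 r0]] := T1; ev; rewrite r0.
  have {}T2 x r r' : t2 x r -> t2 x r' -> r = r'.
    by move=> h1 h2; have := T2 x r r'; ev; exact.
  have {}T3 x y r : x <> w -> s2 x y -> t2 x r -> t2 y (r + f x).
    move=> h1 h2 h3; have := T3 x y r (f x); ev.
    move=> /(_ h1 h2 h3) []; first exact/eA.
    by move=> r' [->]; ev.
  have {}T4 : t2 w (eR z) by move: T4; ev.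
  have {}X (P : set K) : P o ->
      (forall x y, P x -> x <> w -> s2 x y -> P y) ->
      P w /\ forall x, f x <> 0 -> P x.
    move=> Po PS; have := X [set q | P (thead q.1)] (set_small _).
    ev => /(_ Po) [].
      move=> x y; ev => Px xw sxy; exact: PS sxy.
    ev => Pw PX; split=> // x fx; have := PX x (f x); ev; apply; first exact/eA.
    by move=> /addrr_eq0.
  have [s sP] := choice S1.
  (* The closed set [P] is taken to be the whole orbit, which therefore reaches [w]. *)
  have [|n [nw nu nn]] := @orbit_until K s o w.
    apply: (X (fun x => exists n, iter n s o = x) _ _).1; first by exists 0%N.
    move=> x y [n <-] _ sxy; exists n.+1.
    by apply: S2 (sP _) sxy.
  (* The closed set is now the orbit up to the first visit of [w], which therefore contains the
     support of [f]. *)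
  have [||_ PX] := X (fun x => exists2 i, (i <= n)%N & iter i s o = x).
  - by exists 0%N.
  - move=> x y [i i_n ix] xw sxy; exists i.+1; last first.
      by apply: S2 sxy; rewrite /= ix; exact: sP.
    rewrite ltn_neqAle i_n andbT; apply/eqP => ii; apply: xw.
    by rewrite -ix ii.
  exists [seq iter i s o | i <- iota 0 n]; split=> // [x xn|].
    apply: contrapT => fx; have [i i_n ix] := PX x fx.
    move: i_n; rewrite leq_eqVlt => /orP[/eqP ii|i_n].
      by apply: fx; rewrite -ix ii nw.
    by case/negP: xn; rewrite -ix; apply: map_f; rewrite mem_iota.
  apply: (T2 w) => //.
  rewrite big_map -{1}nw.
  have : (n <= n)%N by [].
  elim: {1 3 4}n => [|m IH] mn; first by rewrite big_nil.
  rewrite -{2}addn1 iotaD big_cat big_seq1 /= add0n; apply: T3.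
  - exact: nn.
  - exact: sP.
  - by apply: IH; exact: ltnW.
move=> [s [us s0 zE]].
have [w ws] : exists w, w \notin s.
  apply: contrapT => nw; apply: infK; apply: sub_finite_set (finite_seq s) => k _ /=.
  by apply/negPn/negP => ks; apply: nw; exists k.
(* For [k] outside [s], [index] returns [size s], so [sg k] is the default [w] and [pt k] the full
   sum. The recurrence for partial sums thus also holds off the list. *)
pose l := rcons s w; pose sg k := nth w l (index k s).+1.
pose pt k := \sum_(x <- take (index k s) s) f x.
pose S : relation_of K F (2, 0, 0)%N :=
  [set q | if val q.1 is [:: x; y] then y = sg x else False].
pose T : relation_of K F (1, 1, 1)%N :=
  [set q | match val q.1, val q.2 with [:: x], [:: r] => r = pt x | _, _ => False end].
exists S; split.
  by apply: functional_small => a r r' _ _; rewrite (tuple0 r) (tuple0 r').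
exists T; split.
  apply: functional_small => -[[|x [|//]] ?] [[|r [|//]] ?] [[|r' [|//]] ?] //=.
  by rewrite /T /= => -> ->; exact: val_inj.
have ptw : pt w = eR z by rewrite /pt (memNindex ws) take_size.
have lw k : (k <= size s)%N -> pt (nth w l k) = \sum_(x <- take k s) f x.
  rewrite leq_eqVlt => /orP[/eqP ->|ks].
    by rewrite nth_rcons ltnn eqxx ptw take_size.
  by rewrite nth_rcons ks /pt index_uniq.
have sgP k : k <> w -> pt (sg k) = pt k + f k.
  move=> kw; case: (boolP (k \in s)) => ks.
    have ks' : (index k s < size s)%N by rewrite index_mem.
    by rewrite /sg lw // (take_nth w) // big_rcons /= addrC nth_index // addrC.
  rewrite (s0 _ ks) addr0 /sg (memNindex ks) nth_default ?size_rcons //.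
  by rewrite /pt (memNindex ws) (memNindex ks).
exists (nth w l 0%N), w.
split; first by move=> x; exists (sg x); ev.
split; first by move=> x y y'; ev => -> ->.
split; first by exists 0; ev; rewrite addr0; split=> //; apply/eA; rewrite s0.
split.
  by exists 0; ev; rewrite addr0; split=> //; rewrite /T /= lw // take0 big_nil.
split; first by move=> x r r'; ev => -> ->.
split.
  move=> x y r r' xw; ev => -> -> /eA ->; exists (pt x + f x); split=> //.
  by ev; rewrite /T /= sgP.
split; first by ev; rewrite /T /= ptw.
move=> P _; ev => Po PS.
have Pl k : (k <= size s)%N -> P ([tuple nth w l k], [tuple]).
  elim: k => [//|k IH] ks; have := PS (nth w l k) (nth w l k.+1); ev.
  apply; first exact: IH (ltnW ks).
    by move=> kw; move: ws; rewrite -kw nth_rcons ks mem_nth.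
  by rewrite /S /= /sg [nth w l k]nth_rcons ks index_uniq.
split.
  have e : nth w l (size s) = w by rewrite nth_rcons ltnn eqxx.
  by have := Pl (size s) (leqnn _); rewrite e.
move=> x r; ev => /eA -> fx; have xs : x \in s.
  by apply/negPn/negP => /s0 f0; apply: fx; apply/addrr_eq0.
have e : nth w l (index x s) = x by rewrite nth_rcons index_mem xs nth_index.
by have := Pl (index x s) (index_size _ _); rewrite e.
Qed.

End SumSemantics.

(* The ring variable i is represented by the matrix (2,1,2i), the auxiliary
   matrices are the (2,1,2k+1). *)
Definition mvar (i : nat) : pvar := (2, 1, i.*2)%N.
Definition tvar (k : nat) : pvar := (2, 1, k.*2.+1)%N.
Definition avar : pvar := (1, 1, 0)%N.

Definition f_matrix k (body : so_formula) : so_formula :=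
  SAllSet 0 (SAllSet 1 (SAllRing 0 (s_iff (at21 k.*2.+1 0 1 0) body))).

(** States that auxiliary matrix [k] is the value of [t]; only auxiliary indices above [k] are
    bound, so earlier matrices survive. Lacking constants, 0 is the [r] with [r = r + r], and 1 the
    [r] with [s = s * r] for all [s]. Rows are images of basis vectors, so [TMul t u] multiplies the
    matrix of [u] by that of [t]. *)
Fixpoint trm (t : ring_term) (k : nat) : so_formula :=
  match t with
  | TVar i => f_matrix k (at21 i.*2 0 1 0)
  | TZero => f_matrix k (SAdd 0 0 0)
  | TOne => f_matrix k (SOr (SAnd (SEqSet 0 1) (SAllRing 1 (SMul 1 1 0)))
                            (SAnd (SNot (SEqSet 0 1)) (SAdd 0 0 0)))
  | TOpp t => SExPred (tvar k.+1) (SAnd (trm t k.+1) (f_matrix k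
      (SExRing 1 (SAnd (at21 k.+1.*2.+1 0 1 1)
        (SExRing 2 (SAnd (SAdd 2 2 2) (SAdd 2 1 0)))))))
  | TAdd t u => SExPred (tvar k.+1) (SAnd (trm t k.+1)
      (SExPred (tvar k.+2) (SAnd (trm u k.+2) (f_matrix k
        (SExRing 1 (SExRing 2 (SAnd (at21 k.+1.*2.+1 0 1 1)
          (SAnd (at21 k.+2.*2.+1 0 1 2) (SAdd 0 1 2)))))))))
  | TMul t u => SExPred (tvar k.+1) (SAnd (trm t k.+1)
      (SExPred (tvar k.+2) (SAnd (trm u k.+2) (f_matrix k
        (SExPred avar (SAnd (SAllSet 2 (SAllRing 1 (s_iff (at11 0 2 1)
          (SExRing 2 (SExRing 3 (SAnd (at21 k.+2.*2.+1 0 2 2)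
             (SAnd (at21 k.+1.*2.+1 2 1 3) (SMul 1 2 3))))))))
          (f_sum 0)))))))
  end.

(** Row-finiteness is expressed by the existence of a sum of each row, since [f_sum] forces finite
    support. *)
Definition is_end i : so_formula :=
  SAnd (SAllSet 0 (SAllSet 1 (SExRing 0 (at21 i.*2 0 1 0))))
  (SAnd (SAllSet 0 (SAllSet 1 (SAllRing 0 (SAllRing 1
     (SImp (at21 i.*2 0 1 0) (SImp (at21 i.*2 0 1 1) (SEqRing 0 1)))))))
  (SAllSet 0 (SExRing 0 (SExPred avar (SAnd (SAllSet 2 (SAllRing 1
     (s_iff (at11 0 2 1) (at21 i.*2 0 2 1)))) (f_sum 0)))))).

Fixpoint trf (phi : ring_formula) : so_formula :=
  match phi with
  | FEq t u => SExPred (tvar 0) (SAnd (trm t 0) (trm u 0))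
  | FNot f => SNot (trf f)
  | FAnd f g => SAnd (trf f) (trf g)
  | FOr f g => SOr (trf f) (trf g)
  | FImp f g => SImp (trf f) (trf g)
  | FAll i f => SAllPred (mvar i) (SImp (is_end i) (trf f))
  | FEx i f => SExPred (mvar i) (SAnd (is_end i) (trf f))
  end.

Lemma trm_closed t k (s : seq nat) sK sR sP : closed_term s t ->
  (forall i, i \in s -> mvar i \in sP) -> tvar k \in sP ->
  so_closed sK sR sP (trm t k).
Proof.
elim: t k sK sR sP => [i|||t IH|t IHt u IHu|t IHt u IHu] k sK sR sP /=.
- by move=> si sm tk; rewrite (sm i si) tk.
- by move=> _ _ ->.
- by move=> _ _ ->.
- move=> ct sm tk; rewrite (IH k.+1) //=; last by rewrite inE eqxx.
    by rewrite /tvar in tk *; rewrite !inE tk !eqxx !orbT.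
  by move=> i si; rewrite inE sm ?orbT.
- case/andP=> ct cu sm tk.
  rewrite (IHt k.+1) //=; [|by move=> i si; rewrite inE sm ?orbT|by rewrite inE eqxx].
  rewrite (IHu k.+2) //=; [|by move=> i si; rewrite !inE sm ?orbT|by rewrite inE eqxx].
  by rewrite /tvar in tk *; rewrite !inE tk !eqxx !orbT.
- case/andP=> ct cu sm tk.
  rewrite (IHt k.+1) //=; [|by move=> i si; rewrite inE sm ?orbT|by rewrite inE eqxx].
  rewrite (IHu k.+2) //=; [|by move=> i si; rewrite !inE sm ?orbT|by rewrite inE eqxx].
  by rewrite /tvar in tk *; rewrite !inE tk !eqxx !orbT.
Qed.

Lemma trf_closed phi (s : seq nat) sK sR sP : closed_formula s phi ->
  (forall i, i \in s -> mvar i \in sP) -> so_closed sK sR sP (trf phi).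
Proof.
have endc i sK0 sR0 sP0 : mvar i \in sP0 -> so_closed sK0 sR0 sP0 (is_end i).
  by move=> iP; rewrite /= !inE iP !orbT.
elim: phi s sK sR sP => [t u|f IH|f IHf g IHg|f IHf g IHg|f IHf g IHg|i f IH|i f IH]
  s sK sR sP cl sm.
- have {}sm i : i \in s -> mvar i \in tvar 0 :: sP by move=> /sm; rewrite inE orbC => ->.
  move: cl => /andP[ct cu]; apply/andP; split.
    by apply: trm_closed ct _ _ => //; rewrite inE eqxx.
  by apply: trm_closed cu _ _ => //; rewrite inE eqxx.
- exact: IH cl sm.
- by move: cl => /andP[cf cg]; apply/andP; split; [exact: IHf cf sm | exact: IHg cg sm].
- by move: cl => /andP[cf cg]; apply/andP; split; [exact: IHf cf sm | exact: IHg cg sm].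
- by move: cl => /andP[cf cg]; apply/andP; split; [exact: IHf cf sm | exact: IHg cg sm].
- apply/andP; split; first by apply: endc; rewrite inE eqxx.
  apply: IH cl _ => j; rewrite !inE => /orP[/eqP -> |/sm ->]; last by rewrite orbT.
  by rewrite eqxx.
- apply/andP; split; first by apply: endc; rewrite inE eqxx.
  apply: IH cl _ => j; rewrite !inE => /orP[/eqP -> |/sm ->]; last by rewrite orbT.
  by rewrite eqxx.
Qed.

(** * Endomorphisms as row-finite matrices *)

Section MatrixSemantics.
Variables (F : nzRingType) (K : choiceType) (V : lmodType F) (b : K -> V).
Hypothesis infK : infinite_set [set: K].
Hypothesis b_indep : lin_independent b.
Hypothesis b_gen : generating b.

Let mx (f : End V) i j : F := cf b_gen (f (b i)) j.

(** Defined for every [p], and empty unless the arity is (2,1), so that it can also serve as a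
    valuation of all predicate variables. *)
Definition mrel (p : pvar) (m : K -> K -> F) : relation_of K F p :=
  [set q | match val q.1, val q.2 with
           | [:: x; y], [:: r] => r = m x y | _, _ => False end].
Arguments mrel : clear implicits.

Definition vrel (p : pvar) (f : K -> F) : relation_of K F p :=
  [set q | match val q.1, val q.2 with
           | [:: x], [:: r] => r = f x | _, _ => False end].
Arguments vrel : clear implicits.

Lemma mrel_small p m : mrel p m #<= [set: K].
Proof.
apply: functional_small => // a r r'; rewrite /mrel /=.
case: (val a) => [|x [|y [|//]]] //.
by case: r r' => -[|r [|//]] ? [] [|r' [|//]] ? //= -> ->; exact: val_inj.
Qed.

Lemma vrel_small p f : vrel p f #<= [set: K].
Proof.
apply: functional_small => // a r r'; rewrite /vrel /=.
case: (val a) => [|x [|//]] //.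
by case: r r' => -[|r [|//]] ? [] [|r' [|//]] ? //= -> ->; exact: val_inj.
Qed.

Lemma mrelP i (P : relation_of K F (2, 1, i)%N) m :
  (forall x y r, P ([tuple x; y], [tuple r]) <-> r = m x y) <-> P = mrel (2, 1, i)%N m.
Proof.
split=> [h|->] //; apply/seteqP; split=> -[[[|x [|y [|//]]] // s1] [[|r [|//]] // s2]].
  rewrite (_ : Tuple s1 = [tuple x; y]); last exact: val_inj.
  by rewrite (_ : Tuple s2 = [tuple r]); [move/h | exact: val_inj].
rewrite (_ : Tuple s1 = [tuple x; y]); last exact: val_inj.
by rewrite (_ : Tuple s2 = [tuple r]); [move=> ?; apply/h | exact: val_inj].
Qed.

Lemma mx_eq f g : mx f = mx g -> f = g.
Proof.
move=> fg; apply: (End_eqb b_gen) => i; apply: (cf_inj (b_gen := b_gen)) => j.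
exact: (congr1 (fun m => m i j) fg).
Qed.

(** The sums matter only through the finite supports that they certify. *)
Lemma mx_exists (m : K -> K -> F) : (forall i, exists z, sums_to (m i) z) ->
  exists f, mx f = m.
Proof.
move=> mi; have [z zP] := choice mi; have [s sP] := choice zP.
exists (ext b_indep b_gen (fun i => \sum_(j <- s i) m i j *: b j)).
apply: funext => i; apply: funext => j; rewrite /mx ext_b.
have [us s0 _] := sP i.
exact: (cf_unique b_indep b_gen us s0 erefl).
Qed.

Lemma mx_sums f i : exists z, sums_to (mx f i) z.
Proof.
exists (\sum_(k <- sp b_gen (f (b i))) mx f i k), (sp b_gen (f (b i))); split=> //.
  exact: sp_uniq.
by move=> k; exact: cf_out.
Qed.

Lemma mxM f g i j : sums_to (fun k => mx g i k * mx f k j) (mx (f * g) i j).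
Proof.
exists (sp b_gen (g (b i))); split; first exact: sp_uniq.
  by move=> k /cf_out; rewrite /mx => ->; rewrite mul0r.
by rewrite /mx EndM (End_cf b_indep).
Qed.

Lemma sums_to_unique (f : K -> F) z z' : sums_to f z -> sums_to f z' -> z = z'.
Proof.
move=> [s [us s0 ->]] [t [ut t0 ->]].
rewrite -(sum_widen us (undup_uniq (s ++ t))) //; last exact: mem_joinl.
rewrite -(sum_widen ut (undup_uniq (s ++ t))) //; exact: mem_joinr.
Qed.

Lemma f_matrixP eK eR (eP : forall p, relation_of K F p) k body m :
  (forall x y r, so_holds [eta [eta eK with 0%N |-> x] with 1%N |-> y]
     [eta eR with 0%N |-> r] eP body <-> r = m x y) ->
  so_holds eK eR eP (f_matrix k body) <-> eP (tvar k) = mrel (tvar k) m.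
Proof.
move=> bodyP; rewrite -mrelP.
pose EK x y := [eta [eta eK with 0%N |-> x] with 1%N |-> y] : nat -> K.
pose ER r := [eta eR with 0%N |-> r] : nat -> F.
have atE x y r : so_holds (EK x y) (ER r) eP (at21 k.*2.+1 0 1 0) =
    eP (tvar k) ([tuple x; y], [tuple r]) by exact: at21E.
split=> [h x y r|h x y r].
  have [h1 h2] : (so_holds (EK x y) (ER r) eP (at21 k.*2.+1 0 1 0) ->
      so_holds (EK x y) (ER r) eP body) /\ (so_holds (EK x y) (ER r) eP body ->
      so_holds (EK x y) (ER r) eP (at21 k.*2.+1 0 1 0)) := h x y r.
  by rewrite atE in h1 h2; rewrite -bodyP; split.
suff : (so_holds (EK x y) (ER r) eP (at21 k.*2.+1 0 1 0) ->
      so_holds (EK x y) (ER r) eP body) /\ (so_holds (EK x y) (ER r) eP body ->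
      so_holds (EK x y) (ER r) eP (at21 k.*2.+1 0 1 0)) by [].
rewrite atE; split; first by move/h; rewrite -bodyP.
by move/bodyP/h.
Qed.

Lemma at21P eK eR (eP : forall p, relation_of K F p) i x y r m :
  eP (2, 1, i)%N = mrel (2, 1, i)%N m ->
  so_holds eK eR eP (at21 i x y r) <-> eR r = m (eK x) (eK y).
Proof. by rewrite at21E => ->. Qed.

Lemma vrelP i (P : relation_of K F (1, 1, i)%N) f :
  (forall x r, P ([tuple x], [tuple r]) <-> r = f x) <-> P = vrel (1, 1, i)%N f.
Proof.
split=> [h|->] //; apply/seteqP; split=> -[[[|x [|//]] // s1] [[|r [|//]] // s2]].
  rewrite (_ : Tuple s1 = [tuple x]); last exact: val_inj.
  by rewrite (_ : Tuple s2 = [tuple r]); [move/h | exact: val_inj].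
rewrite (_ : Tuple s1 = [tuple x]); last exact: val_inj.
by rewrite (_ : Tuple s2 = [tuple r]); [move=> ?; apply/h | exact: val_inj].
Qed.

Section Connectives.
Variables (eK : nat -> K) (eR : nat -> F).
Implicit Type eP : forall p, relation_of K F p.

Lemma soAndE eP f g : so_holds eK eR eP (SAnd f g) =
  (so_holds eK eR eP f /\ so_holds eK eR eP g). Proof. by []. Qed.
Lemma soImpE eP f g : so_holds eK eR eP (SImp f g) =
  (so_holds eK eR eP f -> so_holds eK eR eP g). Proof. by []. Qed.
Lemma soIffE eP f g : so_holds eK eR eP (s_iff f g) =
  (so_holds eK eR eP f <-> so_holds eK eR eP g). Proof. by []. Qed.
Lemma soAllSetE eP x f : so_holds eK eR eP (SAllSet x f) =
  (forall u, so_holds [eta eK with x |-> u] eR eP f). Proof. by []. Qed.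
Lemma soAllRingE eP x f : so_holds eK eR eP (SAllRing x f) =
  (forall u, so_holds eK [eta eR with x |-> u] eP f). Proof. by []. Qed.
Lemma soExRingE eP x f : so_holds eK eR eP (SExRing x f) =
  (exists u, so_holds eK [eta eR with x |-> u] eP f). Proof. by []. Qed.
Lemma soExPredE eP p f : so_holds eK eR eP (SExPred p f) =
  (exists P : relation_of K F p, P #<= [set: K] /\
     so_holds eK eR (eqtype.dfwith eP P) f). Proof. by []. Qed.
Lemma soAllPredE eP p f : so_holds eK eR eP (SAllPred p f) =
  (forall P : relation_of K F p, P #<= [set: K] ->
     so_holds eK eR (eqtype.dfwith eP P) f). Proof. by []. Qed.

End Connectives.

Lemma tvar_mvar k i : tvar k != mvar i.
Proof.
rewrite /tvar /mvar xpair_eqE /=; apply/eqP => /(congr1 odd).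
by rewrite /= !odd_double.
Qed.

Lemma tvar_eq k l : (tvar k == tvar l) = (k == l).
Proof. by rewrite /tvar xpair_eqE /= eqSS (inj_eq double_inj). Qed.

Lemma mvar_eq k l : (mvar k == mvar l) = (k == l).
Proof. by rewrite /mvar xpair_eqE /= (inj_eq double_inj). Qed.

Definition represents (eP : forall p, relation_of K F p) (e : nat -> End V) :=
  forall i, eP (mvar i) = mrel (mvar i) (mx (e i)).

Lemma represents_out eP e p (P : relation_of K F p) :
  (forall i, p != mvar i) -> represents eP e -> represents (eqtype.dfwith eP P) e.
Proof. by move=> pm H i; rewrite dfwith_out. Qed.

(** [f] pins down the quantified relation, so the quantifier acts as a substitution; a matrix always
    meets the size bound. *)
Lemma ex_matrixP eK eR eP k f g (m : K -> K -> F) (Q : Prop) :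
  (forall P : relation_of K F (tvar k), so_holds eK eR (eqtype.dfwith eP P) f <->
     P = mrel (tvar k) m) ->
  (so_holds eK eR (eqtype.dfwith eP (mrel (tvar k) m)) g <-> Q) ->
  so_holds eK eR eP (SExPred (tvar k) (SAnd f g)) <-> Q.
Proof.
move=> fP gQ; rewrite soExPredE -gQ; split=> [[P [_ []]]|gP].
  by move=> /fP ->.
by exists (mrel (tvar k) m); split; [exact: mrel_small | split=> //; apply/fP].
Qed.

Lemma trmP t k eK eR eP e : represents eP e ->
  so_holds eK eR eP (trm t k) <->
  eP (tvar k) = mrel (tvar k) (mx (term_val e t)).
Proof.
elim: t k eK eR eP => [i|||t IH|t IHt u IHu|t IHt u IHu] k eK eR eP H.
- by apply: f_matrixP => x y r; exact: (at21P _ _ _ _ _ (H i)).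
- apply: f_matrixP => x y r; rewrite /= addrr_eq0 /mx End0.
  by rewrite (cf_zero b_indep).
- apply: f_matrixP => x y r; rewrite /= /mx End1 cf_b //.
  have one : (forall s : F, s = s * r) <-> r = 1.
    by split=> [/(_ 1)|-> s]; rewrite ?mul1r ?mulr1.
  rewrite one addrr_eq0; case: (eqVneq x y) => [->|/eqP xy].
    by split=> [[[]|[]]//|->]; left.
  by split=> [[[]|[]]//|->]; right.
- apply: ex_matrixP => [P|].
    have HP : represents (eqtype.dfwith eP P) e.
      by apply: represents_out H => i; exact: tvar_mvar.
    by rewrite (IH _ _ _ _ HP) dfwith_in; exact: iff_refl.
  set m := mx (term_val e t).
  have tk : eqtype.dfwith eP (mrel (tvar k.+1) m) (tvar k) = eP (tvar k).
    by rewrite dfwith_out // tvar_eq gtn_eqF.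
  rewrite -tk; apply: f_matrixP => x y r.
  rewrite soExRingE; split=> [[r1]|re].
    rewrite soAndE (@at21P _ _ _ _ _ _ _ m) /= ?dfwith_in // => -[-> [r2]].
    by move=> [/addrr_eq0 -> /esym /eqP]; rewrite addrC addr_eq0 => /eqP ->; rewrite /mx EndN (cfN b_indep).
  exists (m x y); rewrite soAndE (@at21P _ _ _ _ _ _ _ m) /= ?dfwith_in //.
  split=> //; exists 0; split; first by rewrite addr0.
  by rewrite re /m /mx EndN (cfN b_indep) addrN.
- apply: ex_matrixP => [P|].
    have HP : represents (eqtype.dfwith eP P) e.
      by apply: represents_out H => i; exact: tvar_mvar.
    by rewrite (IHt _ _ _ _ HP) dfwith_in; exact: iff_refl.
  set m := mx (term_val e t); set eP1 := eqtype.dfwith eP _.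
  have H1 : represents eP1 e.
    by apply: represents_out H => i; exact: tvar_mvar.
  apply: ex_matrixP => [P|].
    have HP : represents (eqtype.dfwith eP1 P) e.
      by apply: represents_out H1 => i; exact: tvar_mvar.
    by rewrite (IHu _ _ _ _ HP) dfwith_in; exact: iff_refl.
  set n := mx (term_val e u); set eP2 := eqtype.dfwith eP1 _.
  have tk : eP2 (tvar k) = eP (tvar k).
    by rewrite /eP2 /eP1 !dfwith_out // tvar_eq gtn_eqF.
  have tk1 : eP2 (tvar k.+1) = mrel (tvar k.+1) m.
    by rewrite /eP2 /eP1 dfwith_out ?dfwith_in // tvar_eq gtn_eqF.
  have tk2 : eP2 (tvar k.+2) = mrel (tvar k.+2) n by rewrite /eP2 dfwith_in.
  rewrite -tk; apply: f_matrixP => x y r.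
  have -> : mx (term_val e (TAdd t u)) x y = m x y + n x y.
    by rewrite /m /n /mx -(cfD b_indep).
  rewrite soExRingE; split=> [[r1]|->].
    rewrite soExRingE => -[r2]; rewrite !soAndE.
    by rewrite (at21P _ _ _ _ _ tk1) (at21P _ _ _ _ _ tk2) /= => -[-> [->]].
  exists (m x y); rewrite soExRingE; exists (n x y); rewrite !soAndE.
  by rewrite (at21P _ _ _ _ _ tk1) (at21P _ _ _ _ _ tk2).
- apply: ex_matrixP => [P|].
    have HP : represents (eqtype.dfwith eP P) e.
      by apply: represents_out H => i; exact: tvar_mvar.
    by rewrite (IHt _ _ _ _ HP) dfwith_in; exact: iff_refl.
  set m := mx (term_val e t); set eP1 := eqtype.dfwith eP _.
  have H1 : represents eP1 e.
    by apply: represents_out H => i; exact: tvar_mvar.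
  apply: ex_matrixP => [P|].
    have HP : represents (eqtype.dfwith eP1 P) e.
      by apply: represents_out H1 => i; exact: tvar_mvar.
    by rewrite (IHu _ _ _ _ HP) dfwith_in; exact: iff_refl.
  set n := mx (term_val e u); set eP2 := eqtype.dfwith eP1 _.
  have tk : eP2 (tvar k) = eP (tvar k).
    by rewrite /eP2 /eP1 !dfwith_out // tvar_eq gtn_eqF.
  have tk1 : eP2 (tvar k.+1) = mrel (tvar k.+1) m.
    by rewrite /eP2 /eP1 dfwith_out ?dfwith_in // tvar_eq gtn_eqF.
  have tk2 : eP2 (tvar k.+2) = mrel (tvar k.+2) n by rewrite /eP2 dfwith_in.
  rewrite -tk; apply: f_matrixP => x y r.
  pose f z := n x z * m z y.
  have rE : r = mx (term_val e (TMul t u)) x y <-> sums_to f r.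
    split=> [->|fr]; first exact: mxM.
    by apply: sums_to_unique fr _; exact: mxM.
  rewrite rE; set EK := [eta [eta eK with _ |-> _] with _ |-> _].
  set ER := [eta eR with _ |-> _].
  have aP (A : relation_of K F avar) :
      so_holds EK ER (eqtype.dfwith eP2 A) (SAllSet 2 (SAllRing 1 (s_iff (at11 0 2 1)
          (SExRing 2 (SExRing 3 (SAnd (at21 k.+2.*2.+1 0 2 2)
             (SAnd (at21 k.+1.*2.+1 2 1 3) (SMul 1 2 3)))))))) <-> A = vrel avar f.
    have tk1' : eqtype.dfwith eP2 A (tvar k.+1) = mrel (tvar k.+1) m.
      by rewrite dfwith_out.
    have tk2' : eqtype.dfwith eP2 A (tvar k.+2) = mrel (tvar k.+2) n.
      by rewrite dfwith_out.
    have inner z w :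
        so_holds [eta EK with 2%N |-> z] [eta ER with 1%N |-> w] (eqtype.dfwith eP2 A)
          (SExRing 2 (SExRing 3 (SAnd (at21 k.+2.*2.+1 0 2 2)
             (SAnd (at21 k.+1.*2.+1 2 1 3) (SMul 1 2 3))))) <-> w = f z.
      rewrite soExRingE; split=> [[r1]|->].
        rewrite soExRingE => -[r2]; rewrite !soAndE.
        by rewrite (at21P _ _ _ _ _ tk1') (at21P _ _ _ _ _ tk2') /= => -[-> [->]].
      exists (n x z); rewrite soExRingE; exists (m z y); rewrite !soAndE.
      by rewrite (at21P _ _ _ _ _ tk1') (at21P _ _ _ _ _ tk2').
    rewrite -vrelP soAllSetE; split=> h z.
      move=> w; have := h z; rewrite soAllRingE => /(_ w).
      by rewrite soIffE inner at11E dfwith_in.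
    by rewrite soAllRingE => w; rewrite soIffE inner at11E dfwith_in; exact: h.
  rewrite soExPredE -(@f_sumP _ _ infK EK ER (eqtype.dfwith eP2 (vrel avar f)) 0 f);
    last by move=> z w; rewrite dfwith_in.
  split=> [[A [_]]|h].
    by rewrite soAndE aP => -[->].
  by exists (vrel avar f); split; [exact: vrel_small | rewrite soAndE aP].
Qed.

Lemma is_endP i eK eR (eP : forall p, relation_of K F p) :
  so_holds eK eR eP (is_end i) <->
  exists f : End V, eP (mvar i) = mrel (mvar i) (mx f).
Proof.
have sumP m x w (A : relation_of K F avar) : eP (mvar i) = mrel (mvar i) m ->
    so_holds [eta eK with 0%N |-> x] [eta eR with 0%N |-> w] (eqtype.dfwith eP A)
      (SAllSet 2 (SAllRing 1 (s_iff (at11 0 2 1) (at21 i.*2 0 2 1)))) <->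
    A = vrel avar (m x).
  move=> Pm; have Pm' : eqtype.dfwith eP A (mvar i) = mrel (mvar i) m.
    by rewrite dfwith_out.
  rewrite -vrelP soAllSetE; split=> h z.
    move=> r; have := h z; rewrite soAllRingE => /(_ r).
    by rewrite soIffE (at21P _ _ _ _ _ Pm') at11E dfwith_in.
  rewrite soAllRingE => r.
  by rewrite soIffE (at21P _ _ _ _ _ Pm') at11E dfwith_in; exact: h.
rewrite /is_end !soAndE; split=> [[h1 [h2 h3]]|[f fP]].
  have {}h1 x y : exists r, eP (mvar i) ([tuple x; y], [tuple r]).
    move: h1; rewrite soAllSetE => /(_ x); rewrite soAllSetE => /(_ y).
    by rewrite soExRingE => -[r]; rewrite at21E => ?; exists r.
  have {}h2 x y r r' : eP (mvar i) ([tuple x; y], [tuple r]) ->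
      eP (mvar i) ([tuple x; y], [tuple r']) -> r = r'.
    move: h2; rewrite soAllSetE => /(_ x); rewrite soAllSetE => /(_ y).
    rewrite soAllRingE => /(_ r); rewrite soAllRingE => /(_ r').
    by rewrite !soImpE !at21E.
  have [m mP] : {m : K * K -> F & forall p,
      eP (mvar i) ([tuple p.1; p.2], [tuple m p])}.
    by apply: (@choice _ _ (fun p r => eP (mvar i) ([tuple p.1; p.2], [tuple r]))) => -[].
  pose m2 x y := m (x, y).
  have Pm : eP (mvar i) = mrel (mvar i) m2.
    apply/mrelP => x y r; split=> [h|->]; last exact: (mP (x, y)).
    exact: h2 h (mP (x, y)).
  have [|f fE] := @mx_exists m2; last by exists f; rewrite fE.
  move=> x; move: h3; rewrite soAllSetE => /(_ x); rewrite soExRingE => -[w].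
  rewrite soExPredE => -[A [_]]; rewrite soAndE (sumP _ _ _ _ Pm) => -[AE].
  rewrite (@f_sumP _ _ infK _ _ _ _ (m2 x)) => [|z r]; last by rewrite dfwith_in AE.
  by move=> h; eexists; exact: h.
split.
  rewrite soAllSetE => x; rewrite soAllSetE => y; rewrite soExRingE.
  by exists (mx f x y); rewrite (at21P _ _ _ _ _ fP).
split.
  rewrite soAllSetE => x; rewrite soAllSetE => y; rewrite soAllRingE => r.
  rewrite soAllRingE => r'; rewrite !soImpE !(at21P _ _ _ _ _ fP) /= => -> ->.
  by [].
rewrite soAllSetE => x; have [w wP] := mx_sums f x.
rewrite soExRingE; exists w; rewrite soExPredE; exists (vrel avar (mx f x)).
split; first exact: vrel_small.
rewrite soAndE (sumP _ _ _ _ fP); split=> //.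
by rewrite (@f_sumP _ _ infK _ _ _ _ (mx f x)) => // z r; rewrite dfwith_in.
Qed.

Lemma represents_set eP e i f : represents eP e ->
  represents (eqtype.dfwith eP (mrel (mvar i) (mx f))) [eta e with i |-> f].
Proof.
move=> H j /=; case: (eqVneq j i) => [->|ji]; first by rewrite dfwith_in.
by rewrite dfwith_out ?H // mvar_eq eq_sym.
Qed.

Lemma trfP phi eK eR eP e : represents eP e ->
  so_holds eK eR eP (trf phi) <-> ring_holds e phi.
Proof.
elim: phi eP e => [t u|f IH|f IHf g IHg|f IHf g IHg|f IHf g IHg|i f IH|i f IH] eP e H.
- rewrite [trf _]/=; apply: (ex_matrixP (m := mx (term_val e t))) => [P|].
    have HP : represents (eqtype.dfwith eP P) e.
      by apply: represents_out H => i; exact: tvar_mvar.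
    by rewrite (trmP _ _ _ _ HP) dfwith_in.
  set eP1 := eqtype.dfwith eP _; have HP : represents eP1 e.
    by apply: represents_out H => i; exact: tvar_mvar.
  rewrite (trmP _ _ _ _ HP) /eP1 dfwith_in; split=> [h|/= -> //]; apply: mx_eq.
  apply: funext => x; apply: funext => y.
  have : mrel (tvar 0) (mx (term_val e t)) ([tuple x; y], [tuple mx (term_val e t) x y]).
    by [].
  by rewrite h.
- by have := IH eP e H; rewrite /=; tauto.
- by have := IHf eP e H; have := IHg eP e H; rewrite /=; tauto.
- by have := IHf eP e H; have := IHg eP e H; rewrite /=; tauto.
- by have := IHf eP e H; have := IHg eP e H; rewrite /=; tauto.
- rewrite [trf _]/= soAllPredE; split=> [h x|h P _].
    apply/(IH _ _ (represents_set i x H)); move: (h _ (mrel_small (mvar i) (mx x))).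
    by rewrite soImpE is_endP dfwith_in; apply; exists x.
  rewrite soImpE is_endP dfwith_in => -[x ->].
  exact/(IH _ _ (represents_set i x H))/h.
- rewrite [trf _]/= soExPredE; split=> [[P [_]]|[x h]].
    rewrite soAndE is_endP dfwith_in => -[[x ->] h]; exists x.
    exact/(IH _ _ (represents_set i x H)).
  exists (mrel (mvar i) (mx x)); split; first exact: mrel_small.
  rewrite soAndE is_endP dfwith_in; split; first by exists x.
  exact/(IH _ _ (represents_set i x H)).
Qed.

End MatrixSemantics.

Theorem trf_correct (F : nzRingType) (K : choiceType) (V : lmodType F) phi :
  infinite_set [set: K] -> free_of_rank K V -> ring_sentence phi ->
  ring_true (End V) phi <-> Th2 K F (trf phi).
Proof.
move=> infK [b [bi bg]] sphi; have [k0 _] := infinite_setN0 infK.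
pose e0 : nat -> End V := fun=> 0.
pose eP p := @mrel F K p (fun i j => cf bg (e0 0%N (b i)) j).
have H : represents bg eP e0 by [].
have trs : so_sentence (trf phi) by apply: trf_closed sphi _.
rewrite (Th2P k0 trs (fun=> k0) (fun=> 0) eP) (trfP infK bi phi _ _ H).
split=> [|h e]; first exact.
by apply: (ring_holds_coincide sphi _).1 h.
Qed.

(** [trf] turns equality of theories into elementary equivalence and [tr_sentence] gives the
    converse: both translations are uniform in the structure. *)
Lemma corollary6_pid (F1 F2 : nzRingType) (K1 K2 : choiceType)
    (V1 : lmodType F1) (V2 : lmodType F2) :
  is_left_pid F1 -> is_left_pid F2 ->
  infinite_set [set: K1] -> infinite_set [set: K2] ->
  free_of_rank K1 V1 -> free_of_rank K2 V2 ->
  elementarily_equivalent (End V1) (End V2) <-> Th2 K1 F1 = Th2 K2 F2.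
Proof.
move=> pid1 pid2 inf1 inf2 free1 free2; split=> [ee|th phi sphi]; last first.
  by rewrite (trf_correct inf1 free1 sphi) th -(trf_correct inf2 free2 sphi).
have ths phi : so_sentence phi -> Th2 K1 F1 phi <-> Th2 K2 F2 phi.
  move=> sphi; rewrite -(tr_sentence_correct pid1 inf1 free1 sphi).
  rewrite -(tr_sentence_correct pid2 inf2 free2 sphi).
  exact: ee (tr_sentence_closed sphi).
by apply/seteqP; split=> phi h; have [sphi _] := h; apply/(ths phi sphi).
Qed.

Theorem corollary6 (F1 F2 : nzRingType) (K1 K2 : choiceType)
    (V1 : lmodType F1) (V2 : lmodType F2)
    (F12 : (is_skewfield F1 /\ is_skewfield F2) \/
           (is_left_pid F1 /\ is_left_pid F2))
    (infK1 : infinite_set [set: K1]) (infK2 : infinite_set [set: K2])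
    (freeV1 : free_of_rank K1 V1) (freeV2 : free_of_rank K2 V2) :
  elementarily_equivalent (End V1) (End V2) <-> Th2 K1 F1 = Th2 K2 F2.
Proof.
have [pid1 pid2] : is_left_pid F1 /\ is_left_pid F2.
  by case: F12 => [[/skewfield_left_pid ? /skewfield_left_pid ?]|].
exact: corollary6_pid.
Qed.
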